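(* Let $\eta^{ij}$ be a constant nondegenerate symmetric $N\times N$ matrix. For an arbitrary solution $\Phi(u)$ of the associativity equations $$\sum_{k,l=1}^N\frac{\partial^3\Phi}{\partial u^i\partial u^j\partial u^k}\eta^{kl}\frac{\partial^3\Phi}{\partial u^l\partial u^m\partial u^n}=\sum_{k,l=1}^N\frac{\partial^3\Phi}{\partial u^i\partial u^m\partial u^k}\eta^{kl}\frac{\partial^3\Phi}{\partial u^l\partial u^j\partial u^n},\qquad 1\le i,j,m,n\le N,$$ each structural flow $$u^i_{t_n}=\eta^{is}\frac{\partial^3\Phi}{\partial u^s\partial u^n\partial u^k}u^k_x,\qquad 1\le n\le N,$$ generates an integrable hierarchy of hydrodynamic type with the recursion operator given by the compatible Hamiltonian operators $$L^{ij}_{0,1}=\sum_{m=1}^N\sum_{n=1}^N\eta^{mn}\eta^{ip}\eta^{jr}\frac{\partial^3\Phi}{\partial u^p\partial u^m\partial u^k}u^k_x\left(\frac{d}{dx}\right)^{-1}\circ\frac{\partial^3\Phi}{\partial u^r\partial u^n\partial u^s}u^s_x\qquad\text{and}\qquad L^{ij}_{1,0}=\eta^{ij}\frac{d}{dx};$$ each of these integrable hierarchies is local and bi-Hamiltonian with respect to the compatible Hamiltonian operators $L^{ij}_{0,1}$ and $L^{ij}_{1,0}$.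
   Context: Here $u^i(x)$ are fields of one variable $x$; functions of $u$ are smooth and existence statements are local; repeated upper and lower indices are summed. An operator $M^{ij}$ is Hamiltonian if $\{I,J\}=\int\frac{\delta I}{\delta u^i(x)}M^{ij}\frac{\delta J}{\delta u^j(x)}\,dx$ is a Poisson bracket (skew-symmetric, Jacobi identity); two Hamiltonian operators are compatible if every constant-coefficient linear combination is Hamiltonian. The recursion operator is $$R^i_j=\left(L_{0,1}(L_{1,0})^{-1}\right)^i_j=\sum_{m,n=1}^N\eta^{mn}\eta^{ip}\frac{\partial^3\Phi}{\partial u^p\partial u^m\partial u^k}u^k_x\left(\frac{d}{dx}\right)^{-1}\circ\frac{\partial^3\Phi}{\partial u^j\partial u^n\partial u^s}u^s_x\left(\frac{d}{dx}\right)^{-1},$$ and the hierarchy generated by a flow $u^i_t=V^i$ consists of the systems $u^i_{t^{(q)}}=(R^q)^i_jV^j$, $q\ge0$, obtained by successively applying $R$. The hierarchy is local if each of its systems is a (local) system of hydrodynamic type $u^i_t=W^i_j(u)u^j_x$; it is bi-Hamiltonian if each system is of the form $u^i_t=M^{ij}\,\delta H/\delta u^j(x)$ for both $M=L_{0,1}$ and $M=L_{1,0}$, with suitable Hamiltonians $H$. *)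

(* Defs.v *)
From HB Require Import structures.
From mathcomp Require Import all_boot all_order all_algebra.
From mathcomp Require Import all_classical all_reals all_analysis.
Set Implicit Arguments.
Unset Strict Implicit.
Unset Printing Implicit Defensive.
Import Order.TTheory GRing.Theory Num.Theory.
Import numFieldNormedType.Exports.
Local Open Scope classical_set_scope.
Local Open Scope ring_scope.

Section SmoothFunctions.
Context {R : realType}.

Definition pd {m n : nat} (i : 'I_m) (j : 'I_n) (f : 'M[R]_(m, n) -> R) :
  'M[R]_(m, n) -> R := fun x => 'D_(delta_mx i j) f x.

Fixpoint iter_pd {m n : nat} (s : seq ('I_m * 'I_n)) (f : 'M[R]_(m, n) -> R) :
  'M[R]_(m, n) -> R :=
  if s is ij :: s' then pd ij.1 ij.2 (iter_pd s' f) else f.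

(* C^oo on A: all iterated partial derivatives exist and are Frechet
   differentiable at the points of A. *)
Definition smooth_on {m n : nat} (A : set 'M[R]_(m, n)) (f : 'M[R]_(m, n) -> R)
  : Prop := forall s x, A x -> differentiable (iter_pd s f) x.

End SmoothFunctions.

Section Fields.
Context {R : realType} {N : nat}.

(* A field x |-> u(x) = (u^1(x), ..., u^N(x)). *)
Definition field : Type := R -> 'rV[R]_N.

Definition d_ (i : 'I_N) (f : 'rV[R]_N -> R) : 'rV[R]_N -> R := pd ord0 i f.

Definition grad (h : 'rV[R]_N -> R) (u : 'rV[R]_N) : 'rV[R]_N :=
  \row_i d_ i h u.

Definition d3 (Phi : 'rV[R]_N -> R) (i j k : 'I_N) : 'rV[R]_N -> R :=
  d_ i (d_ j (d_ k Phi)).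

Definition ux (u : field) (i : 'I_N) (x : R) : R := derive1 u x ord0 i.

Definition associativity (U : set 'rV[R]_N) (eta : 'M[R]_N)
    (Phi : 'rV[R]_N -> R) : Prop :=
  forall u, U u -> forall i j m n : 'I_N,
    \sum_k \sum_l d3 Phi i j k u * eta k l * d3 Phi l m n u =
    \sum_k \sum_l d3 Phi i m k u * eta k l * d3 Phi l j n u.

Definition L10 (eta : 'M[R]_N) (u : field) (xi : R -> 'rV[R]_N) :
  R -> 'rV[R]_N := fun x => \row_i \sum_j eta i j * derive1 xi x ord0 j.

(* L_{0,1} is cut in two at its (d/dx)^{-1}: [L01_arg] is what (d/dx)^{-1} is
   applied to, [L01_out] is what is done with the antiderivatives phi_n. *)
Definition L01_arg (eta : 'M[R]_N) (Phi : 'rV[R]_N -> R) (u : field)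
    (xi : R -> 'rV[R]_N) (n : 'I_N) : R -> R :=
  fun x => \sum_j \sum_r \sum_s
    eta j r * d3 Phi r n s (u x) * ux u s x * xi x ord0 j.

Definition L01_out (eta : 'M[R]_N) (Phi : 'rV[R]_N -> R) (u : field)
    (phi : 'I_N -> R -> R) : R -> 'rV[R]_N :=
  fun x => \row_i \sum_m \sum_n \sum_p \sum_k
    eta m n * eta i p * d3 Phi p m k (u x) * ux u k x * phi n x.

(* (d/dx)^{-1} has an integration constant.  In a Poisson bracket it is fixed
   by skew-symmetry of (d/dx)^{-1}; on compactly supported functions this is
   convolution with sgn(x) / 2. *)
Definition ddx_inv (f : R -> R) : R -> R := fun x =>
  (\int[lebesgue_measure]_(y in `]-oo, x]) f y
   - \int[lebesgue_measure]_(y in `[x, +oo[) f y) / 2.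

Definition L01 (eta : 'M[R]_N) (Phi : 'rV[R]_N -> R) (u : field)
    (xi : R -> 'rV[R]_N) : R -> 'rV[R]_N :=
  L01_out eta Phi u (fun n => ddx_inv (L01_arg eta Phi u xi n)).

(* [operator]: (M u xi)^i = M^{ij}[u] xi_j. *)
Definition operator : Type := field -> (R -> 'rV[R]_N) -> R -> 'rV[R]_N.

(* Phase space: smooth fields with values in U, equal to u0 near x = -oo and
   near x = +oo. *)
Definition phase_space (U : set 'rV[R]_N) (u0 : 'rV[R]_N) : set field :=
  [set u | (forall k x, derivable (derive1n k u) x 1) /\ (forall x, U (u x)) /\
           exists A : R, forall x, A <= `|x| -> u x = u0].

(* Joint smoothness in (s, x), for s in S and x in R, of a family of functions
   of x depending on n parameters. *)
Definition smooth_family (n : nat) (S : set 'rV[R]_n)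
    (p : 'rV[R]_n -> R -> 'rV[R]_N) : Prop :=
  forall i : 'I_N,
    smooth_on [set z : 'rV[R]_(n + 1) | S (lsubmx z)]
      (fun z => p (lsubmx z) (rsubmx z ord0 ord0) ord0 i).

Definition smooth_variation (U : set 'rV[R]_N) (u0 : 'rV[R]_N) (n : nat)
    (S : set 'rV[R]_n) (p : 'rV[R]_n -> field) : Prop :=
  [/\ open S,
      smooth_family S p,
      (forall s x, S s -> U (p s x)) &
      forall s, S s -> exists A : R, \forall t \near s,
        forall x, A <= `|x| -> p t x = u0].

(* I is a smooth functional on the phase space with (smooth) variational
   derivative dI = delta I / delta u, i.e.
   delta I = \int (delta I / delta u^i) delta u^i dx for all smooth variations.
   Since u is constant near infinity, dI[u] has to be constant there too.
   For instance I[u] = \int (f(u, u_x, ..., u_(k)) - f(u0, 0, ..., 0)) dx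
   qualifies, dI being the Euler operator applied to f. *)
Definition functional (U : set 'rV[R]_N) (u0 : 'rV[R]_N)
    (I : field -> R) (dI : field -> R -> 'rV[R]_N) : Prop :=
  forall (n : nat) (S : set 'rV[R]_n) (p : 'rV[R]_n -> field),
    smooth_variation U u0 S p ->
    [/\ smooth_on S (fun s => I (p s)),
        smooth_family S (fun s => dI (p s)),
        (forall s, S s -> exists A : R, \forall t \near s,
           forall x y, A <= `|x| -> A <= `|y| -> dI (p t) x = dI (p t) y) &
        forall s (k : 'I_n), S s ->
          pd ord0 k (fun t => I (p t)) s =
          \int[lebesgue_measure]_x
            \sum_(i < N) dI (p s) x ord0 i *
                         pd ord0 k (fun t => p t x ord0 i) s].

Definition bracket (M : operator) (dI dJ : field -> R -> 'rV[R]_N) :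
  field -> R := fun u =>
  \int[lebesgue_measure]_x
    \sum_(i < N) dI u x ord0 i * M u (dJ u) x ord0 i.

(* The bracket is a Lie bracket on the space of functionals: it takes values
   in this space, is skew-symmetric and satisfies the Jacobi identity. *)
Definition hamiltonian (U : set 'rV[R]_N) (u0 : 'rV[R]_N) (M : operator)
  : Prop :=
  [/\ (forall I dI J dJ, functional U u0 I dI -> functional U u0 J dJ ->
         exists dIJ, functional U u0 (bracket M dI dJ) dIJ),
      (forall I dI J dJ, functional U u0 I dI -> functional U u0 J dJ ->
         forall u, phase_space U u0 u ->
           bracket M dI dJ u = - bracket M dJ dI u) &
      (forall I dI J dJ K dK dIJ dJK dKI,
         functional U u0 I dI -> functional U u0 J dJ ->
         functional U u0 K dK ->
         functional U u0 (bracket M dI dJ) dIJ ->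
         functional U u0 (bracket M dJ dK) dJK ->
         functional U u0 (bracket M dK dI) dKI ->
         forall u, phase_space U u0 u ->
           bracket M dIJ dK u + bracket M dJK dI u + bracket M dKI dJ u = 0)].

Definition compatible (U : set 'rV[R]_N) (u0 : 'rV[R]_N) (M1 M2 : operator)
  : Prop :=
  forall a b : R,
    hamiltonian U u0 (fun u xi x => a *: M1 u xi x + b *: M2 u xi x).

(* V : [flow] stands for the system u_t(x) = V[u](x). *)
Definition flow : Type := field -> field.

(* Systems are considered locally in x and in u: the field u is only required
   to be defined and smooth near x, with u(x) in the domain B. *)
Definition admissible (B : set 'rV[R]_N) (u : field) (x : R) : Prop :=
  B (u x) /\ \forall y \near x, forall k, derivable (derive1n k u) y 1.

Definition jet (k : nat) (u : field) (x : R) : 'M[R]_(k.+1, N) :=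
  \matrix_(a, i) derive1n a u x ord0 i.

(* Smooth functions of u, u_x, ..., u_(k), for some k. *)
Definition differential_function (B : set 'rV[R]_N) (F : field -> R -> R)
  : Prop :=
  exists (k : nat) (f : 'M[R]_(k.+1, N) -> R),
    smooth_on [set J | B (row ord0 J)] f /\
    forall u x, admissible B u x -> F u x = f (jet k u x).

(* G = (d/dx)^{-1} F in the ring of differential functions, where the
   integration constant is arbitrary. *)
Definition primitive (B : set 'rV[R]_N) (F G : field -> R -> R) : Prop :=
  differential_function B G /\
  forall u x, admissible B u x -> is_derive x 1 (G u) (F u x).

(* V is the value of L_{1,0}, resp. a value of L_{0,1}, on xi. *)
Definition L10_value (B : set 'rV[R]_N) (eta : 'M[R]_N)
    (xi : field -> R -> 'rV[R]_N) (V : flow) : Prop :=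
  (forall j, differential_function B (fun u x => xi u x ord0 j)) /\
  forall u x, admissible B u x -> V u x = L10 eta u (xi u) x.

Definition L01_value (B : set 'rV[R]_N) (eta : 'M[R]_N) (Phi : 'rV[R]_N -> R)
    (xi : field -> R -> 'rV[R]_N) (V : flow) : Prop :=
  (forall j, differential_function B (fun u x => xi u x ord0 j)) /\
  exists phi : 'I_N -> field -> R -> R,
    (forall n, primitive B (fun u => L01_arg eta Phi u (xi u) n) (phi n)) /\
    forall u x, admissible B u x ->
      V u x = L01_out eta Phi u (fun n => phi n u) x.

(* W is a value of R = L_{0,1} (L_{1,0})^{-1} on V. *)
Definition recursion (B : set 'rV[R]_N) (eta : 'M[R]_N) (Phi : 'rV[R]_N -> R)
    (V W : flow) : Prop :=
  exists xi, L10_value B eta xi V /\ L01_value B eta Phi xi W.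

Fixpoint hierarchy (B : set 'rV[R]_N) (eta : 'M[R]_N) (Phi : 'rV[R]_N -> R)
    (V0 : flow) (q : nat) (V : flow) : Prop :=
  match q with
  | 0 => V = V0
  | q'.+1 => exists V', hierarchy B eta Phi V0 q' V' /\
                        recursion B eta Phi V' V
  end.

Definition structural_flow (eta : 'M[R]_N) (Phi : 'rV[R]_N -> R) (n : 'I_N)
  : flow := fun u x =>
  \row_i \sum_s \sum_k eta i s * d3 Phi s n k (u x) * ux u k x.

Definition hydrodynamic (B : set 'rV[R]_N) (V : flow) : Prop :=
  exists W : 'rV[R]_N -> 'M[R]_N,
    (forall i j, smooth_on B (fun u => W u i j)) /\
    forall u x, admissible B u x -> forall i,
      V u x ord0 i = \sum_j W (u x) i j * ux u j x.

(* V = M (delta H / delta u) for a functional H = \int h(u) dx, whose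
   variational derivative is the gradient of h at u(x); [value] is the
   relation between an argument and a value of M. *)
Definition hamiltonian_flow (B : set 'rV[R]_N)
    (value : (field -> R -> 'rV[R]_N) -> flow -> Prop) (V : flow) : Prop :=
  exists h : 'rV[R]_N -> R,
    smooth_on B h /\ value (fun u x => grad h (u x)) V.

Definition bi_hamiltonian (B : set 'rV[R]_N) (eta : 'M[R]_N)
    (Phi : 'rV[R]_N -> R) (V : flow) : Prop :=
  hamiltonian_flow B (L01_value B eta Phi) V /\
  hamiltonian_flow B (L10_value B eta) V.

(* u_{t tau} = u_{tau t} for the systems u_t = V[u], u_tau = W[u]: the Frechet
   derivatives V'[u](W[u]) and W'[u](V[u]) exist and agree. *)
Definition commuting (B : set 'rV[R]_N) (V W : flow) : Prop :=
  forall u x, admissible B u x -> exists l : 'rV[R]_N,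
    is_derive (0 : R) 1 (fun e : R => V (fun y => u y + e *: W u y) x) l /\
    is_derive (0 : R) 1 (fun e : R => W (fun y => u y + e *: V u y) x) l.

End Fields.

(* Main.v *)
(* Write c for the trilinear form of the third derivatives of Phi and
   phi_xi = (d/dx)^{-1} c(xi, u_x) for the antiderivatives in L01, indices being
   raised by eta.  By associativity and the symmetry of the fourth derivatives
   of Phi, the variation of the density of {I, J} is, up to exact terms,
     dI'[v] . M dJ - dJ'[v] . M dI
       + a (c(dJ_x, phi_dI, v) - c(dI_x, phi_dJ, v)),   M = a L01 + b L10,
   where the boundary terms vanish because (d/dx)^{-1} takes opposite values at
   both ends.  This gives the variational derivative of {I, J}.  In the Jacobi
   sum the second variations of I, J, K cancel by their symmetry, obtained from
   two-parameter variations, and the remaining terms cancel pointwise, once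
   more by associativity.

   On a ball, all flows of the hierarchy are u_t = f * u_x, the product being
   the one with structure constants c, for vector fields f such that c(f) is
   the Hessian of a function H.  If h is such a function for f, then the form
   c(dh) is closed by associativity, so its primitives (Poincare lemma) give
   values of (d/dx)^{-1} that are functions of u, and these are again components
   of such a vector field.  A differential function whose total derivative
   vanishes is constant, so there are no other values up to constants.  The
   flows commute because the multiplications commute and Hessians are
   symmetric. *)

Require Import Defs.
From HB Require Import structures.
From mathcomp Require Import all_boot all_order all_algebra.
From mathcomp Require Import all_classical all_reals all_analysis ring lra.
Set Implicit Arguments.
Unset Strict Implicit.
Unset Printing Implicit Defensive.
Import Order.TTheory GRing.Theory Num.Theory.
Import numFieldNormedType.Exports.
Local Open Scope classical_set_scope.
Local Open Scope ring_scope.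

(** * Calculus on spaces of matrices *)

(** A variation is a family p(s, x) with finitely many parameters, and (s, x) is stored as one row:
    smoothness, Leibniz rules and the symmetry of second derivatives for functions of matrices then
    apply to s and x at once. Integrals over the line and (d/dx)^{-1} become values of a primitive
    based at -A, with A locally uniform in s, so that differentiation under the integral is needed
    only over [0, 1]. Antiderivatives do not vanish at infinity; the end values of a product of two
    agree because both factors change sign, which is where the normalisation of (d/dx)^{-1} enters.
    The direction M dJ of a second variation depends on u, so it is frozen before the symmetry of
    the Hessian is applied. In the hierarchy each (d/dx)^{-1} leaves free constants and the claims
    concern every resulting flow. The induction carries these constants: they are affine terms of
    the density and constants in f. Up to affine terms, the density for L01 at one level is the
    density for L10 one level below. The first level has no predecessor: its density for L01 is 0,
    because the antiderivatives of 0 may be any constants. *)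

Section DirectionalDerivative.
Context {R : realType}.

(** Only the difference quotient along one line enters, so the derivative may be computed in another
    space: a partial derivative of a function of (s, x), say, as an ordinary derivative in x. *)
Lemma derive_transfer (V V' W : normedModType R) (f : V -> W) (g : V' -> W) a v a' v' :
  (forall h : R, f (h *: v + a) = g (h *: v' + a')) ->
  'D_v f a = 'D_v' g a' /\ (derivable f a v <-> derivable g a' v').
Proof.
move=> fg; rewrite /derive /derivable.
suff -> : (fun h : R => h^-1 *: ((f \o shift a) (h *: v) - f a)) =
          (fun h : R => h^-1 *: ((g \o shift a') (h *: v') - g a')) by [].
apply/funext => h /=; rewrite fg; congr (_ *: (_ - _)).
by have := fg 0; rewrite !scale0r !add0r.
Qed.

Lemma differentiable_bound (V W : normedModType R) (f : V -> W) (df : {linear V -> W}) x :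
  continuous df ->
  (forall e, 0 < e -> \forall h \near (0 : V), `|f (h + x) - f x - df h| <= e * `|h|) ->
  differentiable f x.
Proof.
move=> dfc H.
have E : f \o shift x = cst (f x) + df +o_ 0 id.
  apply/eqaddoP => e e0 /=; have := H e e0; apply: filterS => h /=.
  by rewrite opprD addrA.
have D := diff_unique dfc E.
by apply/diff_locallyP; rewrite D; split.
Qed.

Lemma differentiable_mx (V : normedModType R) (p q : nat) (g : V -> 'M[R]_(p, q)) x :
  (forall i j, differentiable (fun y => g y i j) x) -> differentiable g x.
Proof.
move=> H.
have -> : g = \sum_(i < p) \sum_(j < q) (fun y => g y i j *: delta_mx i j).
  apply/funext => y; rewrite {1}(matrix_sum_delta (g y)) fct_sumE.
  by apply: eq_bigr => i _; rewrite fct_sumE.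
apply: differentiable_sum => i; apply: differentiable_sum => j.
exact: differentiableZl.
Qed.

Lemma mx_entry_le (m n : nat) (M : 'M[R]_(m, n)) i j : `|M i j| <= `|M|.
Proof.
rewrite [leRHS]/Num.Def.normr /= mx_normrE.
exact: (le_bigmax _ (fun ij : 'I_m * 'I_n => `|M ij.1 ij.2|) (i, j)).
Qed.

Lemma mx_norm_le (m n : nat) (M : 'M[R]_(m, n)) e :
  0 <= e -> (forall i j, `|M i j| <= e) -> `|M| <= e.
Proof.
move=> e0 H; rewrite [leLHS]/Num.Def.normr /= mx_normrE.
by apply: bigmax_le => // -[i j] _; exact: H.
Qed.

Lemma diff_pd (m n : nat) (f : 'M[R]_(m, n) -> R) x h : differentiable f x ->
  'd f x h = \sum_i \sum_j h i j * pd i j f x.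
Proof.
move=> df; rewrite {1}(matrix_sum_delta h) linear_sum; apply: eq_bigr => i _.
rewrite linear_sum; apply: eq_bigr => j _.
by rewrite linearZ /pd deriveE.
Qed.

Lemma pd_comp (m n p q : nat) (f : 'M[R]_(p, q) -> R) (g : 'M[R]_(m, n) -> 'M[R]_(p, q)) x k l :
  differentiable f (g x) -> (forall i j, differentiable (fun y => g y i j) x) ->
  pd k l (fun y => f (g y)) x =
  \sum_i \sum_j pd i j f (g x) * pd k l (fun y => g y i j) x.
Proof.
move=> df dg.
have dgx := differentiable_mx dg.
rewrite /pd deriveE; last exact: (differentiable_comp dgx df).
rewrite (_ : (fun y => f (g y)) = f \o g)// diff_comp //= diff_pd //.
apply: eq_bigr => i _; apply: eq_bigr => j _; rewrite mulrC -deriveE // derive_mx ?mxE//.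
exact: diff_derivable.
Qed.

Lemma is_derive_comp_curve (m n : nat) (f : 'M[R]_(m, n) -> R) (c : R -> 'M[R]_(m, n)) (dc : 'M[R]_(m, n)) t :
  differentiable f (c t) -> is_derive t 1 c dc ->
  is_derive t 1 (fun s => f (c s)) ('d f (c t) dc).
Proof.
move=> df [cd cE]; have cdf : differentiable c t by apply/derivable1_diffP.
have fc : differentiable (f \o c) t by exact: differentiable_comp.
apply: DeriveDef; first exact: diff_derivable.
by rewrite (_ : (fun y => f (c y)) = f \o c)// deriveE// diff_comp //= -cE deriveE.
Qed.

Lemma is_derive_line (V W : normedModType R) (f : V -> W) (a v : V) (t : R) :
  derivable f (t *: v + a) v ->
  is_derive t 1 (fun s : R => f (s *: v + a)) ('D_v f (t *: v + a)).
Proof.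
have [E1 E2] := @derive_transfer R V W (fun s : R => f (s *: v + a)) f t 1 (t *: v + a) v
  (fun h => ltac:(by rewrite addrA -scalerDl [_%:A]mulr1)).
by move=> /E2 df; apply: DeriveDef.
Qed.

Lemma MVT_line (V : normedModType R) (f : V -> R) (a v : V) :
  (forall t : R, 0 <= t <= 1 -> derivable f (t *: v + a) v) ->
  exists2 t : R, 0 <= t <= 1 & f (v + a) - f a = 'D_v f (t *: v + a).
Proof.
move=> H; pose g s : R := f (s *: v + a).
have gd (t : R) : 0 <= t <= 1 -> is_derive t 1 g ('D_v f (t *: v + a)).
  by move=> /H; exact: is_derive_line.
have [||t tI E] := @MVT_segment R g (fun t => 'D_v f (t *: v + a)) 0 1 ler01.
- by move=> x xI; apply: gd; rewrite !ltW ?(itvP xI).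
- apply: derivable_within_continuous => x xI.
  by have [] := gd x ltac:(by rewrite !(itvP xI)).
exists t; first by rewrite !(itvP tI).
by move: E; rewrite /g scale1r scale0r add0r subr0 mulr1.
Qed.

End DirectionalDerivative.

Section PartialDerivatives.
Context {R : realType} {m n : nat}.
Implicit Types (f g : 'M[R]_(m, n) -> R) (A : set 'M[R]_(m, n)).

(** Displacements on a path from [x] to [h + x] that changes one entry at a time; [s] lists the
    entries already changed. *)
Let msk (s : seq ('I_m * 'I_n)) (h : 'M[R]_(m, n)) : 'M[R]_(m, n) :=
  \matrix_(i, j) (if (i, j) \in s then h i j else 0).

Lemma is_derive_scale (V : normedModType R) (f : V -> R) y v (c : R) : derivable f y v ->
  is_derive y (c *: v) f (c * 'D_v f y).
Proof.
move=> df; pose g t : R := f (t *: v + y).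
have D0 : is_derive (0 : R) 1 g ('D_v f y).
  by have := @is_derive_line R _ _ f y v 0; rewrite scale0r add0r; apply.
have [E1 E2] := @derive_transfer R _ _ _ (fun t : R => g (c * t)) f 0 1 y (c *: v)
  (fun t => ltac:(by rewrite /g addr0 [_%:A]mulr1 scalerA mulrC)).
have D1 : is_derive (0 : R) 1 (fun t : R => c * t) c by apply: is_derive_eq; exact: mulr1.
have D2 : is_derive (0 : R) 1 (g \o (fun t : R => c * t)) ('D_v f y * c).
  by apply: is_derive1_comp; rewrite mulr0.
rewrite mulrC; apply: DeriveDef; first by apply/E2; apply: ex_derive.
by rewrite -E1; apply: derive_val.
Qed.

(** On each step of the path only one entry moves, so the mean value theorem expresses the increment
    by one partial derivative near [x], which continuity compares with its value at [x]. *)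
Lemma continuous_pd_differentiable f x :
  (forall i j, \forall y \near x, derivable f y (delta_mx i j)) ->
  (forall i j, {for x, continuous (pd i j f)}) -> differentiable f x.
Proof.
move=> Df Cf.
pose dl (h : 'M[R]_(m, n)) := \sum_i \sum_j h i j * pd i j f x.
have dl_lin : linear dl.
  move=> a u v; rewrite /dl scaler_sumr -big_split; apply: eq_bigr => i _ /=.
  rewrite scaler_sumr -big_split; apply: eq_bigr => j _ /=.
  by rewrite !mxE mulrDl -mulrA.
pose dlM := GRing.isLinear.Build _ _ _ _ _ dl_lin.
pose df : {linear 'M[R]_(m, n) -> R} := HB.pack dl dlM.
have dl0 : dl 0 = 0 := linear0 df.
have dlD u v : dl (u + v) = dl u + dl v := linearD df u v.
have dlZ a u : dl (a *: u) = a * dl u := linearZ_LR df a u.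
have dfc : continuous df.
  move=> y; apply: (@differentiable_continuous _ _ _ y dl).
  have -> : dl = \sum_i \sum_j (fun h : 'M[R]_(m, n) => h i j * pd i j f x).
    apply/funext => h; rewrite fct_sumE; apply: eq_bigr => i _.
    by rewrite fct_sumE.
  apply: differentiable_sum => i; apply: differentiable_sum => j.
  apply: differentiableM; [exact: differentiable_coord | exact: differentiable_cst].
apply: (differentiable_bound dfc) => e e0.
(* The path has m * n steps, each allowed an error e / k relative to the norm of h; the successor
   keeps k positive for empty matrices. *)
pose k := (m * n).+1.
have k0 : 0 < k%:R :> R by rewrite ltr0n.
have H : \forall y \near x, forall ij : 'I_m * 'I_n,
    derivable f y (delta_mx ij.1 ij.2) /\ `|pd ij.1 ij.2 f y - pd ij.1 ij.2 f x| <= e / k%:R.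
  apply: (@filter_forall _ _ (fun (ij : 'I_m * 'I_n) (y : 'M[R]_(m, n)) =>
    derivable f y (delta_mx ij.1 ij.2) /\ `|pd ij.1 ij.2 f y - pd ij.1 ij.2 f x| <= e / k%:R) (nbhs x) _).
  move=> [i j] /=; near=> y; split; first by near: y; exact: Df.
  rewrite distrC; near: y.
  by move: (Cf i j) => /cvgrPdist_le; apply; rewrite divr_gt0.
have [d /= d0 Hd] := (nbhs_ballP _ _).1 H.
near=> h.
have hd : `|h| < d.
  by near: h; apply/nbhs_ballP; exists d => //= z; rewrite mx_norm_ball /ball_ /= sub0r normrN.
suff {Df Cf} S (s : seq ('I_m * 'I_n)) : uniq s ->
    `|f (msk s h + x) - f x - dl (msk s h)| <= (size s)%:R * (e / k%:R) * `|h|.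
  have := S (enum {: 'I_m * 'I_n}) (enum_uniq _).
  have -> : msk (enum {: 'I_m * 'I_n}) h = h.
    by apply/matrixP => i j; rewrite mxE mem_enum.
  move=> /le_trans; apply; apply: ler_wpM2r => //.
  rewrite mulrCA -[leRHS]mulr1 ler_pM2l// ler_pdivrMr// mul1r ler_nat.
  by rewrite -cardE card_prod !card_ord /k.
elim: s => [_|[i j] s IH /= /andP[ijs us]].
  have -> : msk [::] h = 0 by apply/matrixP => i j; rewrite !mxE.
  by rewrite add0r subrr sub0r dl0 oppr0 normr0 !mul0r.
have Es : msk ((i, j) :: s) h = h i j *: delta_mx i j + msk s h.
  apply/matrixP => a b; rewrite !mxE in_cons xpair_eqE.
  case: (boolP (_ && _)) => [/andP[/eqP -> /eqP ->]|_] /=.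
    by rewrite (negbTE ijs) mulr1 addr0.
  by rewrite mulr0 add0r.
pose a := msk s h + x; pose v : 'M[R]_(m, n) := h i j *: delta_mx i j.
(* In the maximum norm no point of the path is farther from x than h + x may be: as (i, j) is not in
   s, each entry of the displacement is 0, an entry of h, or t times one. *)
have line (t : R) : 0 <= t <= 1 -> ball x d (t *: v + a).
  move=> /andP[t0 t1]; rewrite mx_norm_ball /ball_ /= distrC addrA addrK.
  apply: le_lt_trans hd; apply: mx_norm_le => // b c.
  have Ev : v b c = if (b, c) == (i, j) then h b c else 0.
    rewrite !mxE xpair_eqE; case: (boolP (_ && _)) => [/andP[/eqP -> /eqP ->]|_] /=.
      by rewrite mulr1.
    by rewrite mulr0.
  rewrite mxE [X in X + _]mxE [X in _ + X]mxE Ev; case: eqP => [[-> ->]|_].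
    rewrite (negbTE ijs) addr0 normrM (ger0_norm t0) (le_trans _ (mx_entry_le h i j))//.
    exact: ler_piMl.
  rewrite mulr0 add0r; case: ifP => _; last by rewrite normr0.
  exact: mx_entry_le.
have dv (t : R) : 0 <= t <= 1 -> derivable f (t *: v + a) (delta_mx i j).
  by move=> /line /Hd /(_ (i, j))[].
have dE (y : 'M[R]_(m, n)) : derivable f y (delta_mx i j) ->
    is_derive y v f (h i j * pd i j f y).
  exact: is_derive_scale.
have [t t01 E] := @MVT_line R _ f a v (fun t t01 => (@ex_derive _ _ _ _ _ _ _ (dE _ (dv t t01)))).
rewrite Es -[_ + _ + x]addrA -/a -/v.
have -> : dl (v + msk s h) = h i j * pd i j f x + dl (msk s h).
  rewrite dlD; congr (_ + _); rewrite dlZ; congr (_ * _).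
  rewrite /dl (bigD1 i)//= (bigD1 j)//= !mxE !eqxx mul1r.
  rewrite big1 ?addr0 => [|c cj]; last by rewrite mxE (negbTE cj) andbF mul0r.
  by rewrite big1 ?addr0// => b bi; apply: big1 => c _; rewrite mxE (negbTE bi) mul0r.
have -> : f (v + a) - f x - (h i j * pd i j f x + dl (msk s h)) =
   (f a - f x - dl (msk s h)) + (f (v + a) - f a - h i j * pd i j f x).
  by ring.
apply: le_trans (ler_normD _ _) _.
rewrite -natr1 !mulrDl mul1r lerD ?IH//.
rewrite E (@derive_val _ _ _ _ _ _ _ (dE _ (dv t t01))) -mulrBr normrM mulrC.
apply: ler_pM => //; last exact: mx_entry_le.
by have [_] := Hd _ (line t t01) (i, j).
Unshelve. all: by end_near. Qed.

End PartialDerivatives.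

(** * Smooth functions of matrices and the symmetry of second derivatives *)

Section Smooth.
Context {R : realType}.

Lemma iter_pd_rcons (m n : nat) s i j (f : 'M[R]_(m, n) -> R) :
  iter_pd (rcons s (i, j)) f = iter_pd s (pd i j f).
Proof. by elim: s => //= a s ->. Qed.

Lemma smooth_differentiable (m n : nat) A (f : 'M[R]_(m, n) -> R) x :
  smooth_on A f -> A x -> differentiable f x.
Proof. by move=> sf; exact: (sf [::]). Qed.

Lemma smooth_pd (m n : nat) A (f : 'M[R]_(m, n) -> R) i j :
  smooth_on A f -> smooth_on A (pd i j f).
Proof. by move=> sf s; rewrite -iter_pd_rcons; exact: sf. Qed.

Lemma smooth_subset (m n : nat) A B (f : 'M[R]_(m, n) -> R) :
  B `<=` A -> smooth_on A f -> smooth_on B f.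
Proof. by move=> BA sf s x /BA; exact: sf. Qed.

(** [iter_pd] adds derivatives on the outside, whereas inductions with the product and chain rules
    have to take the innermost derivative first; this recursion exposes it. *)
Fixpoint Ck (m n : nat) (A : set 'M[R]_(m, n)) k (f : 'M[R]_(m, n) -> R) : Prop :=
  (forall x, A x -> differentiable f x) /\
  if k is k'.+1 then forall i j, Ck A k' (pd i j f) else True.

Lemma smoothP (m n : nat) A (f : 'M[R]_(m, n) -> R) :
  smooth_on A f <-> forall k, Ck A k f.
Proof.
split=> [sf k|H s].
  elim: k f sf => [|k IH] f sf.
    by split => // x; exact: smooth_differentiable.
  split=> [x|i j]; first exact: smooth_differentiable.
  by apply: IH; exact: smooth_pd.
have [k] := ubnP (size s); elim: k s f H => // k IH s f H.
case/lastP: s => [_ x|s [i j]]; first by case: (H 0%N) => + _; apply.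
rewrite size_rcons ltnS iter_pd_rcons => sk; apply: IH => // l.
by case: (H l.+1) => _; apply.
Qed.

Lemma CkS (m n : nat) A k (f : 'M[R]_(m, n) -> R) : Ck A k.+1 f -> Ck A k f.
Proof.
elim: k f => [|k IH] f [df H]; split => //.
by move=> i j; apply: IH; exact: H.
Qed.

Lemma pd_eq (m n : nat) (A : set 'M[R]_(m, n)) (f g : 'M[R]_(m, n) -> R) :
  open A -> (forall x, A x -> f x = g x) ->
  forall x, A x -> forall i j, pd i j f x = pd i j g x.
Proof.
move=> oA fg x Ax i j; apply: near_eq_derive.
by near=> y; apply: fg; near: y; exact: open_nbhs_nbhs.
Unshelve. all: by end_near. Qed.

Lemma differentiable_near_eq (V W : normedModType R) (f g : V -> W) x :
  (\forall y \near x, f y = g y) -> differentiable f x -> differentiable g x.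
Proof.
move=> fg df; apply: (@differentiable_bound _ _ _ _ ('d f x)); first exact: diff_continuous.
move=> e e0; have /eqaddoP /(_ e e0) H := diff_locally df.
have fg0 : \forall h \near (0 : V), f (h + x) = g (h + x).
  by move: fg; rewrite (near_shift 0 x) /=; apply: filterS => h; rewrite subr0.
near=> h.
have -> : g (h + x) = f (h + x) by rewrite (near fg0 h).
have <- : f x = g x by exact: (nbhs_singleton fg).
rewrite -addrA -opprD.
by near: h; exact: H.
Unshelve. all: by end_near. Qed.

Lemma Ck_eq (m n : nat) (A : set 'M[R]_(m, n)) k (f g : 'M[R]_(m, n) -> R) :
  open A -> (forall x, A x -> f x = g x) -> Ck A k f -> Ck A k g.
Proof.
move=> oA; elim: k f g => [|k IH] f g fg [df H].
all: have dg x : A x -> differentiable g x.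
1,3: move=> Ax; apply: (differentiable_near_eq _ (df x Ax)).
1,2: by near=> y; apply: fg; near: y; exact: open_nbhs_nbhs.
- by split.
split => // i j; apply: IH (H i j) => x Ax; exact: (pd_eq oA).
Unshelve. all: by end_near. Qed.

Lemma smooth_eq (m n : nat) (A : set 'M[R]_(m, n)) (f g : 'M[R]_(m, n) -> R) :
  open A -> (forall x, A x -> f x = g x) -> smooth_on A f -> smooth_on A g.
Proof. by move=> oA fg /smoothP sf; apply/smoothP => k; exact: (Ck_eq oA fg). Qed.

Lemma Ck_cst (m n : nat) (A : set 'M[R]_(m, n)) k (c : R) : Ck A k (fun=> c).
Proof.
elim: k c => [|k IH] c; split; try by move=> x _; exact: differentiable_cst.
  by [].
move=> i j; rewrite (_ : pd i j _ = fun=> 0) //.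
by apply/funext => x; rewrite /pd derive_cst.
Qed.

Lemma pd_coord (m n : nat) i j k l (x : 'M[R]_(m, n)) :
  pd i j (fun y => y k l) x = ((i == k) && (j == l))%:R.
Proof.
rewrite /pd deriveE; last exact: differentiable_coord.
have lin : linear (fun y : 'M[R]_(m, n) => y k l) by move=> a u v; rewrite !mxE.
pose LM := GRing.isLinear.Build _ _ _ _ _ lin.
pose L : {linear 'M[R]_(m, n) -> R} := HB.pack (fun y : 'M[R]_(m, n) => y k l) LM.
rewrite -[fun y => _]/(L : _ -> _) diff_lin; last exact: coord_continuous.
by rewrite /L /= mxE eq_sym [l == j]eq_sym.
Qed.

Lemma Ck_coord (m n : nat) (A : set 'M[R]_(m, n)) k i j : Ck A k (fun x => x i j).
Proof.
case: k => [|k]; split => //; try by move=> x _; exact: differentiable_coord.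
move=> a b; rewrite (_ : pd a b _ = fun=> ((a == i) && (b == j))%:R).
  exact: Ck_cst.
by apply/funext => x; rewrite pd_coord.
Qed.

Lemma pdD (m n : nat) (f g : 'M[R]_(m, n) -> R) i j x :
  differentiable f x -> differentiable g x ->
  pd i j (fun y => f y + g y) x = pd i j f x + pd i j g x.
Proof. by move=> df dg; rewrite /pd deriveD//; exact: diff_derivable. Qed.

Lemma pdM (m n : nat) (f g : 'M[R]_(m, n) -> R) i j x :
  differentiable f x -> differentiable g x ->
  pd i j (fun y => f y * g y) x = pd i j f x * g x + f x * pd i j g x.
Proof.
move=> df dg; rewrite /pd deriveM; [|exact: diff_derivable..].
by rewrite addrC; congr (_ + _); rewrite /GRing.scale /= mulrC.
Qed.

Lemma pd_sum (m n : nat) (I : Type) (r : seq I) (P : pred I) (f : I -> 'M[R]_(m, n) -> R) i j x :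
  (forall a, differentiable (f a) x) ->
  differentiable (fun y => \sum_(a <- r | P a) f a y) x /\
  pd i j (fun y => \sum_(a <- r | P a) f a y) x = \sum_(a <- r | P a) pd i j (f a) x.
Proof.
move=> df; elim: r => [|a r [dr Er]].
  rewrite big_nil (_ : (fun y => _) = cst 0); last by apply/funext => y; rewrite big_nil.
  by split; [exact: differentiable_cst | rewrite /pd derive_cst].
rewrite big_cons; case: ifP => Pa; last first.
  by under eq_fun do rewrite big_cons Pa.
under eq_fun do rewrite big_cons Pa.
by split; [exact: differentiableD | rewrite pdD // Er].
Qed.

Lemma Ck_add (m n : nat) (A : set 'M[R]_(m, n)) k (f g : 'M[R]_(m, n) -> R) :
  open A -> Ck A k f -> Ck A k g -> Ck A k (fun x => f x + g x).
Proof.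
move=> oA; elim: k f g => [|k IH] f g [df Hf] [dg Hg]; split => //.
1,2: by move=> x Ax; apply: differentiableD; [exact: df|exact: dg].
move=> i j; apply: (Ck_eq oA _ (IH _ _ (Hf i j) (Hg i j))) => x Ax.
by rewrite pdD//; [exact: df | exact: dg].
Qed.

Lemma Ck_mul (m n : nat) (A : set 'M[R]_(m, n)) k (f g : 'M[R]_(m, n) -> R) :
  open A -> Ck A k f -> Ck A k g -> Ck A k (fun x => f x * g x).
Proof.
move=> oA; elim: k f g => [|k IH] f g Cf Cg; case: (Cf) (Cg) => [df Hf] [dg Hg]; split => //.
1,2: by move=> x Ax; apply: differentiableM; [exact: df|exact: dg].
move=> i j; apply: (Ck_eq oA _ (Ck_add oA (IH _ _ (Hf i j) (CkS Cg)) (IH _ _ (CkS Cf) (Hg i j)))).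
by move=> x Ax; rewrite pdM//; [exact: df | exact: dg].
Qed.

Lemma Ck_sum (m n : nat) (A : set 'M[R]_(m, n)) k (I : Type) (r : seq I) (P : pred I)
    (f : I -> 'M[R]_(m, n) -> R) :
  open A -> (forall a, Ck A k (f a)) -> Ck A k (fun x => \sum_(a <- r | P a) f a x).
Proof.
move=> oA H; elim: r => [|a r IH].
  under eq_fun do rewrite big_nil.
  exact: Ck_cst.
case Pa: (P a); last by under eq_fun do rewrite big_cons Pa.
by under eq_fun do rewrite big_cons Pa; exact: Ck_add.
Qed.

Lemma Ck_comp (m n p q : nat) (A : set 'M[R]_(m, n)) (B : set 'M[R]_(p, q)) k
    (f : 'M[R]_(p, q) -> R) (g : 'M[R]_(m, n) -> 'M[R]_(p, q)) :
  open A -> (forall x, A x -> B (g x)) -> Ck B k f ->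
  (forall i j, Ck A k (fun x => g x i j)) -> Ck A k (fun x => f (g x)).
Proof.
move=> oA AB; elim: k f => [|k IH] f Cf Cg.
all: have dg x i j : A x -> differentiable (fun y => g y i j) x by move: x; case: (Cg i j).
all: have df x : A x -> differentiable f (g x) by move=> /AB; move: (g x); case: Cf.
all: have dfg x : A x -> differentiable (fun y => f (g y)) x.
1,3: move=> Ax; apply: (@differentiable_comp _ _ _ _ g f); last exact: df.
1,2: by apply: differentiable_mx => i j; exact: dg.
  by split.
split => // i j.
apply: (@Ck_eq _ _ A k (fun x => \sum_a \sum_b pd a b f (g x) * pd i j (fun y => g y a b) x)) => //.
  by move=> x Ax; rewrite pd_comp//; [exact: df | move=> a b; exact: dg].
apply: Ck_sum => // a; apply: Ck_sum => // b; apply: Ck_mul => //.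
  apply: IH; first by case: Cf => _; exact.
  by move=> c d; apply: CkS.
by case: (Cg a b) => _; exact.
Qed.

Lemma smooth_cst (m n : nat) (A : set 'M[R]_(m, n)) (c : R) : smooth_on A (fun=> c).
Proof. by apply/smoothP => k; exact: Ck_cst. Qed.

Lemma smooth_coord (m n : nat) (A : set 'M[R]_(m, n)) i j : smooth_on A (fun x => x i j).
Proof. by apply/smoothP => k; exact: Ck_coord. Qed.

Lemma smoothD (m n : nat) (A : set 'M[R]_(m, n)) (f g : 'M[R]_(m, n) -> R) :
  open A -> smooth_on A f -> smooth_on A g -> smooth_on A (fun x => f x + g x).
Proof. by move=> oA /smoothP sf /smoothP sg; apply/smoothP => k; exact: Ck_add. Qed.

Lemma smoothM (m n : nat) (A : set 'M[R]_(m, n)) (f g : 'M[R]_(m, n) -> R) :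
  open A -> smooth_on A f -> smooth_on A g -> smooth_on A (fun x => f x * g x).
Proof. by move=> oA /smoothP sf /smoothP sg; apply/smoothP => k; exact: Ck_mul. Qed.

Lemma smoothN (m n : nat) (A : set 'M[R]_(m, n)) (f : 'M[R]_(m, n) -> R) :
  open A -> smooth_on A f -> smooth_on A (fun x => - f x).
Proof.
move=> oA sf; under eq_fun do rewrite -mulN1r.
by apply: smoothM => //; exact: smooth_cst.
Qed.

Lemma smooth_sum (m n : nat) (A : set 'M[R]_(m, n)) (I : Type) (r : seq I) (P : pred I)
    (f : I -> 'M[R]_(m, n) -> R) :
  open A -> (forall a, smooth_on A (f a)) ->
  smooth_on A (fun x => \sum_(a <- r | P a) f a x).
Proof.
move=> oA H; apply/smoothP => k; apply: Ck_sum => // a.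
by move/smoothP: (H a); apply.
Qed.

Lemma smooth_comp (m n p q : nat) (A : set 'M[R]_(m, n)) (B : set 'M[R]_(p, q))
    (f : 'M[R]_(p, q) -> R) (g : 'M[R]_(m, n) -> 'M[R]_(p, q)) :
  open A -> (forall x, A x -> B (g x)) -> smooth_on B f ->
  (forall i j, smooth_on A (fun x => g x i j)) -> smooth_on A (fun x => f (g x)).
Proof.
move=> oA AB /smoothP sf sg; apply/smoothP => k; apply: (Ck_comp oA AB) => //.
by move=> i j; move/smoothP: (sg i j); apply.
Qed.

Lemma open_preimage_mx (m n p q : nat) (A : set 'M[R]_(m, n)) (B : set 'M[R]_(p, q))
    (g : 'M[R]_(m, n) -> 'M[R]_(p, q)) : open A -> open B ->
  (forall i j, smooth_on A (fun x => g x i j)) -> open [set x | A x /\ B (g x)].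
Proof.
move=> oA oB sg; rewrite openE => x /= [Ax Bx].
have : {for x, continuous g}.
  apply: differentiable_continuous; apply: differentiable_mx => i j.
  exact: smooth_differentiable (sg i j) Ax.
move=> /(_ B (open_nbhs_nbhs (conj oB Bx))) H.
by apply: filterI => //; exact: open_nbhs_nbhs.
Qed.

Lemma derive_translate (V W : normedModType R) (f : V -> W) c y v :
  'D_v (fun z => f (c + z)) y = 'D_v f (c + y) /\
  (derivable (fun z => f (c + z)) y v <-> derivable f (c + y) v).
Proof. by apply: derive_transfer => h; rewrite addrCA. Qed.

(** Mean value theorem twice: along v for the difference of f in the direction w, then along w for
    the derivative of f along v. The second difference does not depend on the order of v and w,
    unlike the right-hand side. *)
Lemma second_difference (V : normedModType R) (A : set V) (f : V -> R) (v w x : V) (h : R) :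
  (forall y, A y -> derivable f y v) -> (forall y, A y -> derivable ('D_v f) y w) ->
  (forall s t, 0 <= s <= 1 -> 0 <= t <= 1 -> A (t *: (h *: w) + (s *: (h *: v) + x))) ->
  exists s t, [/\ 0 <= s <= 1, 0 <= t <= 1 &
    f (h *: w + (h *: v + x)) - f (h *: v + x) - (f (h *: w + x) - f x) =
    h * (h * 'D_w ('D_v f) (t *: (h *: w) + (s *: (h *: v) + x)))].
Proof.
move=> df ddf HA.
pose g y := f (h *: w + y) - f y.
have dg (s : R) : 0 <= s <= 1 ->
    is_derive (s *: (h *: v) + x) (h *: v) g
     (h * 'D_v f (h *: w + (s *: (h *: v) + x)) - h * 'D_v f (s *: (h *: v) + x)).
  move=> s01; apply: is_deriveB; last first.
    apply: is_derive_scale; apply: df.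
    by have := HA s 0 s01 ltac:(by rewrite lexx ler01); rewrite scale0r add0r.
  have [E1 E2] := derive_translate f (h *: w) (s *: (h *: v) + x) v.
  rewrite -E1; apply: is_derive_scale; apply/E2; apply: df.
  by have := HA s 1 s01 ltac:(by rewrite lexx ler01); rewrite scale1r.
have [s s01 E] := @MVT_line R _ g x (h *: v) (fun s s01 => @ex_derive _ _ _ _ _ _ _ (dg s s01)).
have [t t01 E'] := @MVT_line R _ ('D_v f) (s *: (h *: v) + x) (h *: w)
  (fun t t01 => @ex_derive _ _ _ _ _ _ _ (is_derive_scale h (ddf _ (HA _ _ s01 t01)))).
exists s, t; split => //; rewrite -/(g _) -/(g _) E.
rewrite (@derive_val _ _ _ _ _ _ _ (dg s s01)) -mulrBr E'; congr (_ * _).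
exact: (@derive_val _ _ _ _ _ _ _ (is_derive_scale h (ddf _ (HA _ _ s01 t01)))).
Qed.

(** One second difference, evaluated in both orders, equates the two mixed derivatives at two points
    close to x; their continuity at x does the rest. *)
Lemma Schwarz (m n : nat) (A : set 'M[R]_(m, n)) (f : 'M[R]_(m, n) -> R) i j k l x :
  open A -> smooth_on A f -> A x -> pd i j (pd k l f) x = pd k l (pd i j f) x.
Proof.
move=> oA sf Ax; apply/eqP; rewrite eq_sym -subr_eq0 -normr_le0; apply/ler_addgt0Pr => e e0.
rewrite add0r.
have cont a b c d : {for x, continuous (pd a b (pd c d f))}.
  apply: differentiable_continuous; apply: smooth_differentiable Ax.
  by apply: smooth_pd; exact: smooth_pd.
have near_cont a b c d : \forall y \near x, `|pd a b (pd c d f) x - pd a b (pd c d f) y| <= e / 2.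
  by move: (cont a b c d) => /cvgrPdist_le; apply; rewrite divr_gt0.
have H : \forall y \near x, [/\ A y,
    `|pd k l (pd i j f) x - pd k l (pd i j f) y| <= e / 2 &
    `|pd i j (pd k l f) x - pd i j (pd k l f) y| <= e / 2].
  have nA : \forall y \near x, A y by exact: open_nbhs_nbhs.
  by apply: filterS3 nA (near_cont k l i j) (near_cont i j k l) => y.
have [d /= d0 Hd] := (nbhs_ballP _ _).1 H.
(* The intermediate points are displaced twice by at most h, so they stay within d / 2 of x. *)
pose h := d / 4.
have h0 : 0 < h by rewrite divr_gt0.
have dn a b : `|delta_mx a b : 'M[R]_(m, n)| <= 1.
  apply: mx_norm_le => // c c'; rewrite mxE; case: (_ && _); rewrite ?normr1 ?normr0//.
have Hb a b c c' s t : 0 <= s <= 1 -> 0 <= t <= 1 ->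
    ball x d (t *: (h *: delta_mx a b) + (s *: (h *: delta_mx c c') + x)).
  move=> /andP[s0 s1] /andP[t0 t1]; rewrite mx_norm_ball /ball_ /= distrC addrA addrK.
  apply: le_lt_trans (ler_normD _ _) _.
  have B r a' b' : 0 <= r -> r <= 1 -> `|r *: (h *: delta_mx a' b' : 'M[R]_(m, n))| <= h.
    move=> r0 r1; rewrite scalerA normrZ normrM (ger0_norm r0) (gtr0_norm h0).
    have := dn a' b'; have := normr_ge0 (delta_mx a' b' : 'M[R]_(m, n)).
    move: `|_| => z z0 z1; apply: (@le_trans _ _ (h * z)).
      by apply: ler_wpM2r => //; rewrite ler_piMl // ltW.
    by rewrite ler_piMr // ltW.
  apply: le_lt_trans (lerD (B _ _ _ t0 t1) (B _ _ _ s0 s1)) _.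
  by rewrite /h; lra.
have SD a b c c' := @second_difference _ A f (delta_mx a b) (delta_mx c c') x h
  (fun y Ay => diff_derivable (smooth_differentiable sf Ay))
  (fun y Ay => diff_derivable (smooth_differentiable (smooth_pd a b sf) Ay)).
have HA a b c c' s t s01 t01 := let: And3 Ay _ _ := Hd _ (Hb a b c c' s t s01 t01) in Ay.
have [s [t [s01 t01 E1]]] := SD i j k l (HA _ _ _ _).
have [s' [t' [s01' t01' E2]]] := SD k l i j (HA _ _ _ _).
have E : pd k l (pd i j f) (t *: (h *: delta_mx k l) + (s *: (h *: delta_mx i j) + x)) =
         pd i j (pd k l f) (t' *: (h *: delta_mx i j) + (s' *: (h *: delta_mx k l) + x)).
  apply: (mulfI (lt0r_neq0 h0)); apply: (mulfI (lt0r_neq0 h0)).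
  apply: etrans (esym E1) (etrans _ E2).
  rewrite [h *: delta_mx k l + (_ + _)]addrCA.
  by rewrite -!addrA; congr (_ + _); rewrite !opprB addrCA [RHS]addrCA [- _ + _]addrC.
have [_ B1 _] := Hd _ (Hb k l i j _ _ s01 t01).
have [_ _ B2] := Hd _ (Hb i j k l _ _ s01' t01').
rewrite -E distrC in B2.
have := lerD B1 B2; rewrite -splitr; apply: le_trans.
have := ler_normD (pd k l (pd i j f) x - pd k l (pd i j f) (t *: (h *: delta_mx k l) + (s *: (h *: delta_mx i j) + x)))
  (pd k l (pd i j f) (t *: (h *: delta_mx k l) + (s *: (h *: delta_mx i j) + x)) - pd i j (pd k l f) x).
by rewrite subrKA.
Qed.

End Smooth.

(** * Families of functions depending on parameters *)

Section Families.
Context {R : realType}.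

Definition pt (n : nat) (s : 'rV[R]_n) (x : R) : 'rV[R]_(n + 1) := row_mx s x%:M.

(* A family F s x with parameters s is identified with the function [unc F] of
   the row (s, x). *)
Definition unc (n : nat) (F : 'rV[R]_n -> R -> R) : 'rV[R]_(n + 1) -> R :=
  fun z => F (lsubmx z) (rsubmx z ord0 ord0).

Definition cyl (n : nat) (S : set 'rV[R]_n) : set 'rV[R]_(n + 1) := [set z | S (lsubmx z)].

Definition sm (n : nat) (S : set 'rV[R]_n) (F : 'rV[R]_n -> R -> R) : Prop :=
  smooth_on (cyl S) (unc F).

Definition dX (n : nat) (F : 'rV[R]_n -> R -> R) : 'rV[R]_n -> R -> R :=
  fun s => derive1 (F s).

Definition dP (n : nat) (k : 'I_n) (F : 'rV[R]_n -> R -> R) : 'rV[R]_n -> R -> R :=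
  fun s x => pd ord0 k (fun t => F t x) s.

Lemma unc_pt n (F : 'rV[R]_n -> R -> R) s x : unc F (pt s x) = F s x.
Proof. by rewrite /unc /pt row_mxKl row_mxKr mxE eqxx. Qed.

Lemma ptK n (z : 'rV[R]_(n + 1)) : pt (lsubmx z) (rsubmx z ord0 ord0) = z.
Proof. by rewrite /pt -[in RHS](hsubmxK z) -mx11_scalar. Qed.

Lemma ptl n (s : 'rV[R]_n) x (k : 'I_n) : pt s x ord0 (lshift 1 k) = s ord0 k.
Proof. exact: row_mxEl. Qed.

Lemma ptr n (s : 'rV[R]_n) x : pt s x ord0 (rshift n ord0) = x.
Proof. by rewrite row_mxEr mxE eqxx. Qed.

Lemma cyl_pt n (S : set 'rV[R]_n) s x : cyl S (pt s x) = S s.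
Proof. by rewrite /cyl /= row_mxKl. Qed.

Lemma pt_ball n (s t : 'rV[R]_n) x y e : ball s e t -> ball x e y -> ball (pt s x) e (pt t y).
Proof.
rewrite !mx_norm_ball /ball_ /= => st xy.
have e0 : 0 < e by apply: le_lt_trans st.
have [st' xy'] := (ltW st, ltW xy).
rewrite (_ : `|_ - _| = `|row_mx (s - t) (x - y)%:M|); last first.
  by rewrite opp_row_mx add_row_mx raddfB.
rewrite [ltLHS]/Num.Def.normr /= mx_normrE; apply: bigmax_lt => // -[i j] _ /=.
case: (split_ordP j) => k ->; rewrite ?row_mxEl ?row_mxEr.
  by apply: le_lt_trans st; exact: mx_entry_le.
by rewrite mxE !ord1 eqxx.
Qed.

Lemma near_pt n (s : 'rV[R]_n) x (P : set 'rV[R]_(n + 1)) : nbhs (pt s x) P ->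
  \forall y \near x & t \near s, P (pt t y).
Proof.
move=> /nbhs_ballP [e /= e0 H].
exists (ball x e, ball s e) => /=; first by split; exact: nbhsx_ballx.
by move=> [y t] /= [yx ts]; apply: H; exact: pt_ball.
Qed.

Lemma open_cyl n (S : set 'rV[R]_n) : open S -> open (cyl S).
Proof.
move=> oS.
have := @open_preimage_mx R 1 (n + 1) 1 n setT S (@lsubmx R 1 n 1) openT oS.
rewrite (_ : [set x | _] = cyl S); last by apply/seteqP; split=> x //= [].
by apply => i j; under eq_fun do rewrite mxE; exact: smooth_coord.
Qed.

Lemma pt_dX n (s : 'rV[R]_n) x h :
  h *: delta_mx ord0 (rshift n ord0) + pt s x = pt s (h + x).
Proof.
apply/rowP => j; rewrite !mxE.
case: (split_ordP j) => k ->; rewrite ?(unsplitK (inl _)) ?(unsplitK (inr _)) ?mxE.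
  by rewrite eq_lrshift mulr0 add0r.
by rewrite !ord1 !eqxx /= mulr1.
Qed.

Lemma pt_dP n (s : 'rV[R]_n) x h k :
  h *: delta_mx ord0 (lshift 1 k) + pt s x = pt (h *: delta_mx ord0 k + s) x.
Proof.
apply/rowP => j; rewrite !mxE.
case: (split_ordP j) => l ->; rewrite ?(unsplitK (inl _)) ?(unsplitK (inr _)) ?mxE.
  by rewrite eq_lshift.
by rewrite eq_rlshift mulr0 add0r.
Qed.

Lemma derive_unc_dX n (F : 'rV[R]_n -> R -> R) s x :
  'D_1 (F s) x = pd ord0 (rshift n ord0) (unc F) (pt s x) /\
  (derivable (F s) x 1 <-> derivable (unc F) (pt s x) (delta_mx ord0 (rshift n ord0))).
Proof. by apply: derive_transfer => h; rewrite pt_dX unc_pt [_%:A]mulr1. Qed.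

Lemma derive_unc_dP n (F : 'rV[R]_n -> R -> R) k s x :
  pd ord0 k (F^~ x) s = pd ord0 (lshift 1 k) (unc F) (pt s x) /\
  (derivable (F^~ x) s (delta_mx ord0 k) <-> derivable (unc F) (pt s x) (delta_mx ord0 (lshift 1 k))).
Proof. by apply: derive_transfer => h; rewrite pt_dP unc_pt. Qed.

Lemma unc_dX n (F : 'rV[R]_n -> R -> R) : unc (dX F) = pd ord0 (rshift n ord0) (unc F).
Proof.
apply/funext => z; rewrite -(ptK z) unc_pt /dX derive1E.
by case: (derive_unc_dX F (lsubmx z) (rsubmx z ord0 ord0)).
Qed.

Lemma unc_dP n k (F : 'rV[R]_n -> R -> R) : unc (dP k F) = pd ord0 (lshift 1 k) (unc F).
Proof.
apply/funext => z; rewrite -(ptK z) unc_pt /dP.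
by case: (derive_unc_dP F k (lsubmx z) (rsubmx z ord0 ord0)).
Qed.

Lemma dXE n (F : 'rV[R]_n -> R -> R) s x : dX F s x = pd ord0 (rshift n ord0) (unc F) (pt s x).
Proof. by rewrite -unc_dX unc_pt. Qed.

Lemma dPE n k (F : 'rV[R]_n -> R -> R) s x : dP k F s x = pd ord0 (lshift 1 k) (unc F) (pt s x).
Proof. by rewrite -unc_dP unc_pt. Qed.

Lemma smX n (S : set 'rV[R]_n) F : sm S F -> sm S (dX F).
Proof. by rewrite /sm unc_dX; exact: smooth_pd. Qed.

Lemma smP n (S : set 'rV[R]_n) k F : sm S F -> sm S (dP k F).
Proof. by rewrite /sm unc_dP; exact: smooth_pd. Qed.

Lemma sm_diff n (S : set 'rV[R]_n) F s x : sm S F -> S s -> differentiable (unc F) (pt s x).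
Proof. by move=> sF Ss; apply: smooth_differentiable sF _; rewrite cyl_pt. Qed.

Lemma sm_dX n (S : set 'rV[R]_n) F s (x : R) : sm S F -> S s -> is_derive x 1 (F s) (dX F s x).
Proof.
move=> sF Ss; rewrite /dX derive1E; apply: DeriveDef => //.
by case: (derive_unc_dX F s x) => _ [_]; apply; exact/diff_derivable/(sm_diff _ sF).
Qed.

Lemma dPdX n (S : set 'rV[R]_n) F k s x : open S -> sm S F -> S s ->
  dP k (dX F) s x = dX (dP k F) s x.
Proof.
move=> oS sF Ss; rewrite dPE dXE unc_dX unc_dP.
by apply: (Schwarz _ _ _ _ (open_cyl oS) sF); rewrite cyl_pt.
Qed.

Lemma sm_eq n (S : set 'rV[R]_n) F G : open S -> (forall s x, S s -> F s x = G s x) ->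
  sm S F -> sm S G.
Proof.
move=> oS FG; apply: smooth_eq; first exact: open_cyl.
by move=> z Sz; exact: FG.
Qed.

Lemma smooth_sm n (S : set 'rV[R]_n) f : open S -> smooth_on S f -> sm S (fun s _ => f s).
Proof.
move=> oS sf; apply: (@smooth_comp _ _ _ _ _ (cyl S) S f (fun z => lsubmx z)) => //.
  exact: open_cyl.
by move=> i j; under eq_fun do rewrite mxE; exact: smooth_coord.
Qed.

(* Restriction of a family to a smooth set of points, e.g. to x = a(s). *)
Lemma sm_smooth n p (S : set 'rV[R]_n) (S' : set 'rV[R]_p) F (h : 'rV[R]_p -> 'rV[R]_n) (a : 'rV[R]_p -> R) :
  open S' -> sm S F -> (forall s, S' s -> S (h s)) ->
  (forall k, smooth_on S' (fun s => h s ord0 k)) -> smooth_on S' a ->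
  smooth_on S' (fun s => F (h s) (a s)).
Proof.
move=> oS' sF SS sh sa; under eq_fun do rewrite -unc_pt.
apply: (@smooth_comp _ _ _ _ _ S' (cyl S) (unc F) (fun s => pt (h s) (a s))) => //.
  by move=> s /SS; rewrite cyl_pt.
move=> i j; case: (split_ordP j) => k ->; rewrite !ord1.
  by under eq_fun do rewrite ptl; exact: sh.
by under eq_fun do rewrite ptr.
Qed.

Lemma sm_smooth_at n (S : set 'rV[R]_n) F (a : R) : open S -> sm S F -> smooth_on S (F ^~ a).
Proof.
move=> oS sF; apply: (@sm_smooth _ _ S S F id (fun=> a)) => //.
  by move=> k; exact: smooth_coord.
exact: smooth_cst.
Qed.

Lemma sm_comp_pt n p (S : set 'rV[R]_n) (S' : set 'rV[R]_p) F (h : 'rV[R]_p -> 'rV[R]_n) :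
  open S' -> sm S F -> (forall s, S' s -> S (h s)) ->
  (forall k, smooth_on S' (fun s => h s ord0 k)) -> sm S' (fun s => F (h s)).
Proof.
move=> oS' sF SS sh.
apply: (@sm_smooth _ _ S (cyl S') F (fun z => h (lsubmx z)) (fun z => rsubmx z ord0 ord0)) => //.
- exact: open_cyl.
- by move=> z; exact: SS.
- by move=> k; exact: (smooth_sm oS' (sh k)).
- by under eq_fun do rewrite mxE; exact: smooth_coord.
Qed.

Lemma sm_cst n (S : set 'rV[R]_n) (c : R) : sm S (fun _ _ => c).
Proof. exact: smooth_cst. Qed.

Lemma sm_x n (S : set 'rV[R]_n) : sm S (fun _ x => x).
Proof. by rewrite /sm /unc; under eq_fun do rewrite mxE; exact: smooth_coord. Qed.

Lemma smD n (S : set 'rV[R]_n) F G : open S -> sm S F -> sm S G -> sm S (fun s x => F s x + G s x).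
Proof. by move=> /open_cyl oS; exact: smoothD. Qed.

Lemma smN n (S : set 'rV[R]_n) F : open S -> sm S F -> sm S (fun s x => - F s x).
Proof. by move=> /open_cyl oS; exact: smoothN. Qed.

Lemma smM n (S : set 'rV[R]_n) F G : open S -> sm S F -> sm S G -> sm S (fun s x => F s x * G s x).
Proof. by move=> /open_cyl oS; exact: smoothM. Qed.

Lemma sm_sum n (S : set 'rV[R]_n) (I : Type) (r : seq I) (P : pred I) F : open S ->
  (forall a, sm S (F a)) -> sm S (fun s x => \sum_(a <- r | P a) F a s x).
Proof. by move=> /open_cyl oS; exact: smooth_sum. Qed.

Lemma smC n N (S : set 'rV[R]_n) (U : set 'rV[R]_N) f (p : 'rV[R]_n -> R -> 'rV[R]_N) :
  open S -> smooth_on U f -> (forall i, sm S (fun s x => p s x ord0 i)) ->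
  (forall s x, S s -> U (p s x)) -> sm S (fun s x => f (p s x)).
Proof.
move=> oS sf sp SU.
apply: (@smooth_comp _ _ _ _ _ (cyl S) U f (fun z => p (lsubmx z) (rsubmx z ord0 ord0))) => //.
- exact: open_cyl.
- by move=> z; exact: SU.
- by move=> i j; rewrite !ord1; exact: sp.
Qed.

Lemma dP_eq n (S : set 'rV[R]_n) F G k s x : open S -> S s ->
  (forall s x, S s -> F s x = G s x) -> dP k F s x = dP k G s x.
Proof. by move=> oS Ss FG; apply: (pd_eq oS) => // t St; exact: FG. Qed.

Lemma dPD n (S : set 'rV[R]_n) F G k s x : sm S F -> sm S G -> S s ->
  dP k (fun s x => F s x + G s x) s x = dP k F s x + dP k G s x.
Proof. by move=> sF sG Ss; rewrite !dPE pdD//; exact: sm_diff Ss. Qed.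

Lemma dXM n (S : set 'rV[R]_n) F G s x : sm S F -> sm S G -> S s ->
  dX (fun s x => F s x * G s x) s x = dX F s x * G s x + F s x * dX G s x.
Proof. by move=> sF sG Ss; rewrite !dXE -(unc_pt F) -(unc_pt G) -pdM //; [exact: (sm_diff _ sF Ss)|exact: (sm_diff _ sG Ss)]. Qed.

Lemma dPM n (S : set 'rV[R]_n) F G k s x : sm S F -> sm S G -> S s ->
  dP k (fun s x => F s x * G s x) s x = dP k F s x * G s x + F s x * dP k G s x.
Proof. by move=> sF sG Ss; rewrite !dPE -(unc_pt F) -(unc_pt G) -pdM //; [exact: (sm_diff _ sF Ss)|exact: (sm_diff _ sG Ss)]. Qed.

Lemma dP_sum n (S : set 'rV[R]_n) (I : Type) (r : seq I) (P : pred I) F k s x :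
  (forall a, sm S (F a)) -> S s ->
  dP k (fun s x => \sum_(a <- r | P a) F a s x) s x = \sum_(a <- r | P a) dP k (F a) s x.
Proof.
move=> sF Ss; rewrite dPE.
have [|_ ->] := @pd_sum R _ _ I r P (fun a => unc (F a)) ord0 (lshift 1 k) (pt s x).
  by move=> a; exact: sm_diff Ss.
by apply: eq_bigr => a _; rewrite dPE.
Qed.

Lemma pd_unc_comp n N (S : set 'rV[R]_n) (U : set 'rV[R]_N) f (p : 'rV[R]_n -> R -> 'rV[R]_N) j s x :
  smooth_on U f -> (forall i, sm S (fun s x => p s x ord0 i)) ->
  (forall s x, S s -> U (p s x)) -> S s ->
  pd ord0 j (unc (fun s x => f (p s x))) (pt s x) =
  \sum_i d_ i f (p s x) * pd ord0 j (unc (fun s x => p s x ord0 i)) (pt s x).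
Proof.
move=> sf sp SU Ss.
have := @pd_comp R _ _ _ _ f (fun z => p (lsubmx z) (rsubmx z ord0 ord0)) (pt s x) ord0 j.
rewrite big_ord1 => ->.
- by apply: eq_bigr => i _; rewrite {1}/pt row_mxKl row_mxKr mxE eqxx.
- by rewrite {1}/pt row_mxKl row_mxKr mxE eqxx; apply: smooth_differentiable sf _; exact: SU.
- by move=> i k; rewrite !ord1; exact: (sm_diff _ (sp k) Ss).
Qed.

End Families.

(** * Integrals of families *)

Section ParametricIntegral.
Context {R : realType}.
Notation mu := (@lebesgue_measure R).
Implicit Types (t e h a b : R).

Lemma integrable_segment (f : R -> R) a b : {within `[a, b], continuous f} ->
  mu.-integrable `[a, b] (EFin \o f).
Proof. by move=> cf; apply: continuous_compact_integrable => //; exact: segment_compact. Qed.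

Lemma Rintegral_FTC2 (H h : R -> R) (a b : R) : a < b ->
  (forall t, a <= t <= b -> is_derive t 1 H (h t)) -> {within `[a, b], continuous h} ->
  \int[mu]_(t in `[a, b]) h t = H b - H a.
Proof.
move=> ab dH ch.
have cH t : a <= t <= b -> {for t, continuous H}.
  move=> /dH [/derivable1_diffP dt _]; exact: differentiable_continuous.
rewrite /Rintegral (@continuous_FTC2 _ h H a b ab ch) //.
- split.
  + by move=> t tab; have [] := dH t ltac:(by rewrite !ltW ?(itvP tab)).
  + by apply: cvg_at_right_filter; apply: cH; rewrite lexx ltW.
  + by apply: cvg_at_left_filter; apply: cH; rewrite lexx ltW.
- move=> t tab; rewrite derive1E.
  by have [_ ->] := dH t ltac:(by rewrite !ltW ?(itvP tab)).
Qed.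

Lemma Rintegral01_le (f : R -> R) e : {within `[0, 1], continuous f} ->
  (forall t, 0 <= t <= 1 -> `|f t| <= e) -> `|\int[mu]_(t in `[0, 1]) f t| <= e.
Proof.
move=> cf fe; apply: le_trans (le_normr_Rintegral _ (integrable_segment cf)) _ => //.
have ca : {within `[0, 1], continuous (fun t => `|f t|)}.
  by move=> t; apply: (continuous_comp (cf t)); exact: norm_continuous.
apply: (@le_trans _ _ (\int[mu]_(t in `[(0 : R), 1]) e)).
  apply: le_Rintegral => //.
  exact: integrable_segment.
    by apply: integrable_segment; apply: continuous_subspaceT => t; exact: cvg_cst.
by rewrite Rintegral_cst//= lebesgue_measure_itv /= lte_fin ltr01 -EFinB subr0 mulr1.
Qed.

Lemma continuous_dist (T : topologicalType) (f : T -> R) z :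
  (forall e, 0 < e -> \forall y \near z, `|f z - f y| <= e) -> {for z, continuous f}.
Proof. by move=> H; exact: (iffRL (@cvgrPdist_le _ _ _ _ _ f (f z)) H). Qed.

Lemma near_eq_continuous (T : topologicalType) (f g : T -> R) z :
  (\forall y \near z, f y = g y) -> {for z, continuous f} -> {for z, continuous g}.
Proof.
move=> fg cf; apply: continuous_dist => e e0.
have fe : \forall y \near z, `|f z - f y| <= e by exact: (iffLR (cvgrPdist_le _ _) cf).
have fz := nbhs_singleton fg.
by apply: filterS2 fg fe => y <-; rewrite fz.
Qed.

(** Integrals with parameters are reduced to this one, over a fixed compact interval, where
    estimates can be made uniform in t. *)
Definition I01 (n : nat) (K : 'rV[R]_n -> R -> R) : 'rV[R]_n -> R :=
  fun z => \int[mu]_(t in `[0, 1]) K z t.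

(** Each t yields a neighbourhood of z that works for all nearby t; compactness of [0, 1], in the
    form of near coverings, merges them into one. *)
Lemma uniform_section n (Q : 'rV[R]_n -> R -> R) z e :
  (forall t, 0 <= t <= 1 -> {for pt z t, continuous (unc Q)}) -> 0 < e ->
  \forall y \near z, forall t, 0 <= t <= 1 -> `|Q y t - Q z t| <= e.
Proof.
move=> cQ e0.
have cpt : compact (`[0, 1] : set R) := @segment_compact R 0 1.
have := (compact_near_coveringP (`[0, 1] : set R)).1 cpt _ (nbhs z)
  (fun y t => `|Q y t - Q z t| <= e) _ _.
have H : forall x : R, `[0, 1]%classic x ->
  \forall x' \near x & i \near z, `|Q i x' - Q z x'| <= e.
  move=> t /= tI; rewrite in_itv /= in tI.
  have /cvgrPdist_le /(_ (e / 2)) := cQ t tI.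
  rewrite divr_gt0// => /(_ isT) /near_pt.
  rewrite unc_pt => [[[A B]]] /= [At Bz] AB.
  exists (A, B) => //= -[t' y] /= [At' By].
  have := AB (t', y) (conj At' By); rewrite /= unc_pt => H1.
  have := AB (t', z) (conj At' (nbhs_singleton Bz)); rewrite /= unc_pt => H2.
  rewrite -(subrKA (Q z t)) [e]splitr (le_trans (ler_normD _ _))// lerD//.
  by rewrite distrC.
move=> /(_ _ H); apply: filterS => y Hy t tI; apply: Hy => /=; rewrite in_itv.
exact: tI.
Qed.

Lemma within01_continuous n (Q : 'rV[R]_n -> R -> R) z :
  (forall t, 0 <= t <= 1 -> {for pt z t, continuous (unc Q)}) ->
  {within `[0, 1], continuous (Q z)}.
Proof.
move=> cQ; apply: continuous_in_subspaceT => t; rewrite inE /= in_itv /= => /cQ.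
move=> H; apply/cvgrPdist_le => e e0.
have /cvgrPdist_le /(_ e e0) /near_pt := H; case=> -[A B] /= [At Bz] AB.
apply: filterS At => t' At'; rewrite -!unc_pt.
by apply: (AB (t', z)) => /=; split => //; exact: nbhs_singleton.
Qed.

Lemma continuous_I01 n (K : 'rV[R]_n -> R -> R) (A : set 'rV[R]_n) z : open A -> A z ->
  (forall y t, A y -> 0 <= t <= 1 -> {for pt y t, continuous (unc K)}) ->
  {for z, continuous (I01 K)}.
Proof.
move=> oA Az cK. apply: continuous_dist => e e0.
have nA : \forall y \near z, A y by exact: open_nbhs_nbhs.
have U := uniform_section (fun t => cK z t Az) e0.
apply: filterS2 nA U => y Ay H; rewrite /I01.
have cy := within01_continuous (fun t => cK y t Ay).
have cz := within01_continuous (fun t => cK z t Az).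
rewrite -RintegralB //; [|exact: integrable_segment..].
apply: Rintegral01_le; last by move=> t /H; rewrite distrC.
by move=> t; apply: continuousB; [exact: cz|exact: cy].
Qed.

(** By the mean value theorem the difference quotient of the integrand is [dP k K] at an
    intermediate parameter, hence uniformly close to its value at z. *)
Lemma is_derive_I01 n (K : 'rV[R]_n -> R -> R) (A : set 'rV[R]_n) z k : open A -> A z ->
  (forall y t, A y -> 0 <= t <= 1 -> differentiable (unc K) (pt y t)) ->
  (forall y t, A y -> 0 <= t <= 1 -> {for pt y t, continuous (unc (dP k K))}) ->
  is_derive z (delta_mx ord0 k) (I01 K) (I01 (dP k K) z).
Proof.
move=> oA Az dK cdK.
have cK y t : A y -> 0 <= t <= 1 -> {for pt y t, continuous (unc K)}.
  by move=> Ay t01; apply: differentiable_continuous; exact: dK.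
suff L : h^-1 *: (I01 K (h *: delta_mx ord0 k + z) - I01 K z) @[h --> 0^'] --> I01 (dP k K) z.
  by apply: DeriveDef; [exact: (cvgP _ L) | exact: (cvg_lim _ L)].
apply/cvgrPdist_le => e e0.
have nA : \forall y \near z, A y by exact: open_nbhs_nbhs.
have U := uniform_section (fun t => cdK z t Az) e0.
have [d /= d0 Hd] := (nbhs_ballP _ _).1 (filterI nA U).
have nd : \forall h \near (0 : R)^', `|h| < d by exact: dnbhs0_lt.
near=> h.
have hd : `|h| < d by near: h.
have h0 : h != 0 by near: h; exact: nbhs_dnbhs_neq.
have Hb (s : R) : 0 <= s <= 1 -> ball z d (s *: (h *: delta_mx ord0 k) + z).
  move=> /andP[s0 s1]; rewrite mx_norm_ball /ball_ /= distrC addrK scalerA normrZ.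
  apply: le_lt_trans hd; rewrite -[leRHS]mulr1; apply: ler_pM => //.
    by rewrite normrM (ger0_norm s0) ler_piMl.
  by apply: mx_norm_le => // a b; rewrite mxE; case: (_ && _); rewrite ?normr1 ?normr0.
have Ah : A (h *: delta_mx ord0 k + z).
  by have := Hd _ (Hb 1 ltac:(by rewrite lexx ler01)); rewrite scale1r => -[].
have ch := within01_continuous (fun t => cK _ t Ah).
have cz := within01_continuous (fun t => cK z t Az).
have cd := within01_continuous (fun t => cdK z t Az).
have cD : {within `[0, 1], continuous (fun t : R => K (h *: delta_mx ord0 k + z) t - K z t)}.
  by move=> t; apply: continuousB; [exact: ch|exact: cz].
have cQ : {within `[0, 1], continuous (fun t : R => h^-1 * (K (h *: delta_mx ord0 k + z) t - K z t))}.
  by move=> t; exact: (cvgM (cvg_cst _) (cD t)).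
rewrite /I01 -RintegralB //; [|exact: integrable_segment..].
rewrite /GRing.scale /= -RintegralZl //; last exact: integrable_segment.
rewrite -RintegralB //; [|exact: integrable_segment..].
apply: Rintegral01_le; first by move=> t; apply: continuousB; [exact: cd|exact: cQ].
move=> t t01.
have dv (s : R) : 0 <= s <= 1 -> is_derive (s *: (h *: delta_mx ord0 k) + z) (h *: delta_mx ord0 k) (K ^~ t)
    (h * dP k K (s *: (h *: delta_mx ord0 k) + z) t).
  move=> s01; apply: is_derive_scale.
  have [_ E] := derive_unc_dP K k (s *: (h *: delta_mx ord0 k) + z) t.
  by apply/E; apply: diff_derivable; apply: dK => //; case: (Hd _ (Hb s s01)).
have [s s01 ->] := @MVT_line R _ (K ^~ t) z (h *: delta_mx ord0 k)
  (fun s s01 => @ex_derive _ _ _ _ _ _ _ (dv s s01)).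
rewrite (@derive_val _ _ _ _ _ _ _ (dv s s01)) mulKf // distrC.
by have [_ ] := Hd _ (Hb s s01); apply.
Unshelve. all: by end_near. Qed.

(** The derivatives of the integral are integrals of the same kind, hence continuous, and the
    induction on the order goes on. [W] admits integrands that are smooth only for some t, as in the
    Poincare lemma, where the line through p and u may leave the domain for t outside [0, 1]. *)
Lemma smooth_I01 n (W : set 'rV[R]_(n + 1)) (A : set 'rV[R]_n) (K : 'rV[R]_n -> R -> R) :
  open A -> (forall z t, A z -> 0 <= t <= 1 -> W (pt z t)) ->
  smooth_on W (unc K) ->
  smooth_on A (I01 K) /\
  forall z k, A z -> pd ord0 k (I01 K) z = I01 (dP k K) z.
Proof.
move=> oA AW.
have main L : smooth_on W (unc L) -> forall z k, A z ->
    is_derive z (delta_mx ord0 k) (I01 L) (I01 (dP k L) z).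
  move=> sL z k Az; apply: (is_derive_I01 oA Az).
    by move=> y t Ay t01; apply: smooth_differentiable sL _; exact: AW.
  move=> y t Ay t01; apply: differentiable_continuous; rewrite unc_dP.
  by apply: smooth_differentiable (smooth_pd _ _ sL) _; exact: AW.
have cont L z : smooth_on W (unc L) -> A z -> {for z, continuous (I01 L)}.
  move=> sL Az; apply: (continuous_I01 oA Az) => y t Ay t01.
  by apply: differentiable_continuous; apply: smooth_differentiable sL _; exact: AW.
move=> sK; split; last by move=> z k Az; have [_] := main K sK z k Az.
apply/smoothP => m; elim: m K sK => [|m IH] K sK.
all: have dfK z : A z -> differentiable (I01 K) z.
1,3: move=> Az; have nA : \forall y \near z, A y by exact: open_nbhs_nbhs.
1,2: apply: continuous_pd_differentiable => i k; rewrite (ord1 i : i = ord0).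
1,3: by apply: filterS nA => y Ay; have [] := main K sK y k Ay.
1,2: have E : {near z, I01 (dP k K) =1 pd ord0 k (I01 K)}.
1,3: by apply: filterS nA => y Ay; have [_] := main K sK y k Ay; rewrite /pd => ->.
1,2: have c : {for z, continuous (I01 (dP k K))}.
1,3: by apply: cont => //; rewrite unc_dP; exact: smooth_pd.
1,2: exact: near_eq_continuous E c.
  by split.
split => // i k; rewrite (ord1 i : i = ord0).
apply: (Ck_eq oA _ (IH (dP k K) _)); last by rewrite unc_dP; exact: smooth_pd.
by move=> y Ay; have [_] := main K sK y k Ay.
Qed.

End ParametricIntegral.

(** * Integrals and antiderivatives of functions with bounded support *)

Section CompactSupport.
Context {R : realType}.
Notation mu := (@lebesgue_measure R).
Implicit Types (x y a b e A : R) (f H : R -> R).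

Lemma derivable_continuous1 f x df : is_derive x 1 f df -> {for x, continuous f}.
Proof. by move=> [/derivable1_diffP dx _]; exact: differentiable_continuous. Qed.

Lemma derive0_const_itv f a b : a <= b -> (forall x, a <= x <= b -> is_derive x 1 f 0) -> f a = f b.
Proof.
move=> ab df; have [||c _ E] := @MVT_segment R f (fun=> 0) a b ab.
- by move=> x xI; apply: df; rewrite !ltW ?(itvP xI).
- by apply: derivable_within_continuous => x xI; have [] := df x ltac:(by rewrite !(itvP xI)).
by apply/eqP; rewrite eq_sym -subr_eq0 E mul0r.
Qed.

Section Primitive.
Variables (f H : R -> R) (A : R).
Hypotheses (A0 : 0 < A) (fA : forall x, A <= `|x| -> f x = 0).
Hypothesis cf : continuous f.
Hypothesis dH : forall x, is_derive x 1 H (f x).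

Lemma primitive_right x : A <= x -> H x = H A.
Proof.
move=> Ax; symmetry; apply: derive0_const_itv => // y /andP[Ay _].
by rewrite -(fA (le_trans Ay (ler_norm y))).
Qed.

Lemma primitive_left x : x <= - A -> H x = H (- A).
Proof.
move=> xA; apply: derive0_const_itv => // y /andP[_ yA].
by rewrite -[0](fA (x := y)) // -normrN (le_trans _ (ler_norm _))// lerNr.
Qed.

Lemma Rintegral_itv a b : a < b -> \int[mu]_(y in `[a, b]) f y = H b - H a.
Proof.
move=> ab; apply: Rintegral_FTC2 => //.
exact: continuous_subspaceT.
Qed.

Lemma Rintegral_suppE (D : set R) a b :
  (forall x, f x != 0 -> D x <-> `[a, b]%classic x) ->
  \int[mu]_(y in D) f y = \int[mu]_(y in `[a, b]) f y.
Proof.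
move=> DE; rewrite Rintegral_mkcond [RHS]Rintegral_mkcond; congr Rintegral.
apply/funext => x; rewrite !patchE; have [->|fx] := eqVneq (f x) 0; first by rewrite !if_same.
by congr (if _ then _ else _); apply/idP/idP; rewrite !inE; apply DE.
Qed.

Let outside x : f x != 0 -> - A < x < A.
Proof. by move=> fx; rewrite -ltr_norml ltNge; apply: contra fx => /fA ->. Qed.

Lemma Rintegral_suppT : \int[mu]_y f y = H A - H (- A).
Proof.
rewrite -(Rintegral_itv (a := - A)); last by rewrite (lt_trans _ A0)// oppr_lt0.
apply: Rintegral_suppE => x /outside /andP[x1 x2]; split => // _ /=.
by rewrite in_itv /= !ltW.
Qed.

Lemma Rintegral_supp_left x : \int[mu]_(y in `]-oo, x]) f y = H x - H (- A).
Proof.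
(* The point -B lies to the left of x and of the support, so the half-line may be replaced by the
   segment from -B to x. *)
pose B := `|x| + A + 1.
have B1 : A < B by rewrite /B ltr_pwDr // lerDr.
have B2 : - B < x.
  by rewrite ltrNl (le_lt_trans (ler_norm _))// normrN /B -addrA ltrDl addr_gt0.
rewrite -(primitive_left (x := - B)); last by rewrite lerN2 ltW.
rewrite -(Rintegral_itv B2); apply: Rintegral_suppE => y /outside /andP[y1 y2] /=.
rewrite !in_itv /=; split=> [->|/andP[]//]; rewrite andbT ltW// (lt_trans _ y1)//.
by rewrite ltrN2.
Qed.

Lemma Rintegral_supp_right x : \int[mu]_(y in `[x, +oo[) f y = H A - H x.
Proof.
pose B := `|x| + A + 1.
have B1 : A < B by rewrite /B ltr_pwDr // lerDr.
have B2 : x < B.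
  by rewrite (le_lt_trans (ler_norm _))// /B -addrA ltrDl addr_gt0.
rewrite -(primitive_right (ltW B1)).
rewrite -(Rintegral_itv B2); apply: Rintegral_suppE => y /outside /andP[y1 y2] /=.
rewrite !in_itv /=; split=> [|/andP[->]//]; rewrite andbT => ->.
by rewrite ltW// (lt_trans y2).
Qed.

(** Half the difference of the two half-line integrals is a primitive minus the mean of its end
    values; the values at the two ends are therefore opposite. *)
Lemma ddx_invE x : ddx_inv f x = H x - (H A + H (- A)) / 2.
Proof.
by rewrite /ddx_inv Rintegral_supp_left Rintegral_supp_right; field.
Qed.

End Primitive.

Definition cs f : Prop := continuous f /\ exists A, forall x, A <= `|x| -> f x = 0.

Lemma cs_integrable f : cs f -> mu.-integrable setT (EFin \o f).
Proof.
move=> [cf [A fA]].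
have -> : f = f \_ `[- A, A].
  apply/funext => x; rewrite patchE; case: ifPn => //.
  rewrite notin_setE /= in_itv /= -ler_norml => /negP; rewrite -ltNge => /ltW.
  exact: fA.
rewrite -restrict_EFin; apply/(integrable_mkcond _ _).1; first exact: measurable_itv.
by apply: integrable_segment; exact: continuous_subspaceT.
Qed.

Lemma csD f g : cs f -> cs g -> cs (fun x => f x + g x).
Proof.
move=> [cf [A fA]] [cg [B gB]]; split; first by move=> x; apply: continuousD; [exact: cf|exact: cg].
exists (Num.max A B) => x; rewrite ge_max => /andP[? ?].
by rewrite fA // gB // addr0.
Qed.

Lemma csN f : cs f -> cs (fun x => - f x).
Proof.
move=> [cf [A fA]]; split; first by move=> x; apply: continuousN; exact: cf.
by exists A => x /fA ->; rewrite oppr0.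
Qed.

Lemma csM f g : cs f -> continuous g -> cs (fun x => f x * g x).
Proof.
move=> [cf [A fA]] cg; split; first by move=> x; apply: continuousM; [exact: cf|exact: cg].
by exists A => x /fA ->; rewrite mul0r.
Qed.

Lemma cs0 : cs (fun=> 0).
Proof. by split; [move=> x; exact: cvg_cst | exists 0]. Qed.

Lemma cs_sum (I : Type) (r : seq I) (P : pred I) (f : I -> R -> R) :
  (forall i, cs (f i)) -> cs (fun x => \sum_(i <- r | P i) f i x).
Proof.
move=> H; elim: r => [|i r IH].
  by under eq_fun do rewrite big_nil; exact: cs0.
case Pi: (P i); last by under eq_fun do rewrite big_cons Pi.
by under eq_fun do rewrite big_cons Pi; exact: csD.
Qed.

Lemma int_csD f g : cs f -> cs g -> \int[mu]_x (f x + g x) = \int[mu]_x f x + \int[mu]_x g x.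
Proof. by move=> cf cg; rewrite RintegralD //; exact: cs_integrable. Qed.

Lemma int_csB f g : cs f -> cs g -> \int[mu]_x (f x - g x) = \int[mu]_x f x - \int[mu]_x g x.
Proof. by move=> cf cg; rewrite RintegralB //; exact: cs_integrable. Qed.

(** The condition on f compares the two ends with each other, so the boundary values cancel. This is
    how exact terms disappear from the integrals below. *)
Lemma int_derive0 f df : continuous df -> (forall x, is_derive x 1 f (df x)) ->
  (exists A, forall x y, A <= `|x| -> A <= `|y| -> f x = f y) ->
  cs df /\ \int[mu]_x df x = 0.
Proof.
move=> cdf dff [A fA].
(* The margin 1 leaves, around each point beyond B, a neighbourhood on which f is constant; it also
   makes B positive. *)
pose B := `|A| + 1.
have B0 : 0 < B by rewrite /B ltr_wpDl.
have AB : A < B by rewrite /B (le_lt_trans (ler_norm A))// ltrDl.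
have dfB x : B <= `|x| -> df x = 0.
  move=> Bx; have [_ <-] := dff x.
  have nfx : \forall y \near x, f y = cst (f x) y.
    have nx : \forall y \near x, A <= `|y|.
      apply: (@cvgr_ge R _ (nbhs x) _ (fun y : R => `|y|) `|x|); first exact: norm_continuous.
      exact: lt_le_trans Bx.
    by apply: filterS nx => y Ay; apply: fA => //; exact: le_trans (ltW AB) Bx.
  by rewrite (near_eq_derive _ nfx) derive_cst.
split; first by split => //; exists B.
rewrite (Rintegral_suppT B0 dfB cdf dff) (fA _ (- B)) ?subrr// ?normrN gtr0_norm // ltW.
Unshelve. all: by end_near. Qed.

End CompactSupport.

Section Primitives.
Context {R : realType}.
Notation mu := (@lebesgue_measure R).
Implicit Types (x y a b e A t h : R).

Lemma sm_continuous n (S : set 'rV[R]_n) F s : sm S F -> S s -> continuous (F s).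
Proof. by move=> sF Ss x; exact: derivable_continuous1 (sm_dX x sF Ss). Qed.

Lemma smooth_local (m n : nat) (S : set 'M[R]_(m, n)) f :
  (forall s, S s -> exists S', [/\ open S', S' s, S' `<=` S & smooth_on S' f]) -> smooth_on S f.
Proof. by move=> H l s /H [S' [_ S's _ sf]]; exact: sf. Qed.

Lemma sm_local n (S : set 'rV[R]_n) F :
  (forall s, S s -> exists S', [/\ open S', S' s, S' `<=` S & sm S' F]) -> sm S F.
Proof. by move=> H l z /H [S' [_ S's _ sf]]; exact: sf. Qed.

Lemma sm_subset n (S S' : set 'rV[R]_n) F : S' `<=` S -> sm S F -> sm S' F.
Proof. by move=> SS; apply: smooth_subset => z; exact: SS. Qed.

(* int_a^x F s y dy, on a fixed interval of integration *)
Definition prim n a (F : 'rV[R]_n -> R -> R) : 'rV[R]_n -> R -> R := fun s x =>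
  (x - a) * I01 (fun (z : 'rV[R]_(n + 1)) t =>
     F (lsubmx z) (a + t * (rsubmx z ord0 ord0 - a))) (pt s x).

Lemma prim_a n a (F : 'rV[R]_n -> R -> R) s : prim a F s a = 0.
Proof. by rewrite /prim subrr mul0r. Qed.

Section Prim.
Variables (n : nat) (S : set 'rV[R]_n) (F : 'rV[R]_n -> R -> R) (a : R).
Hypotheses (oS : open S) (sF : sm S F).

Let K (z : 'rV[R]_(n + 1)) t := F (lsubmx z) (a + t * (rsubmx z ord0 ord0 - a)).

Let sK : sm (cyl S) K.
Proof.
have oC : open (cyl (cyl S)) by apply: open_cyl; exact: open_cyl.
apply: (@sm_smooth _ _ _ S (cyl (cyl S)) F (fun w => lsubmx (lsubmx w))
   (fun w => a + rsubmx w ord0 ord0 * (rsubmx (lsubmx w) ord0 ord0 - a))) => //.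
  by move=> k; under eq_fun do rewrite !mxE; exact: smooth_coord.
apply: smoothD => //; first exact: smooth_cst.
apply: smoothM => //; first by under eq_fun do rewrite mxE; exact: smooth_coord.
apply: smoothD => //; last exact: smooth_cst.
by under eq_fun do rewrite !mxE; exact: smooth_coord.
Qed.

Let KI := @smooth_I01 R (n + 1) (cyl (cyl S)) (cyl S) K (open_cyl oS)
  (fun z t Sz _ => eq_ind_r id Sz (cyl_pt (cyl S) z t)) sK.

Let uncJ : unc (fun s x => I01 K (pt s x)) = I01 K.
Proof. by apply/funext => z; rewrite /unc ptK. Qed.

Let sJ : sm S (fun s x => I01 K (pt s x)).
Proof. by rewrite /sm uncJ; case: KI. Qed.

Let s1 : sm S (fun (_ : 'rV[R]_n) x => x - a).
Proof.
by apply: (smD (F := fun _ x => x) (G := fun _ _ => - a) oS); [exact: sm_x|exact: sm_cst].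
Qed.

Lemma sm_prim : sm S (prim a F).
Proof. exact: (smM (F := fun _ x => x - a) (G := fun s x => I01 K (pt s x)) oS s1 sJ). Qed.

(** The derivative of (x - a) int_0^1 F(a + t (x - a)) dt is again an integral over [0, 1]; its
    integrand is the t-derivative of t F(a + t (x - a)), and only the value F(x) at t = 1
    survives. *)
Lemma dX_prim s x : S s -> dX (prim a F) s x = F s x.
Proof.
move=> Ss.
rewrite (dXM (F := fun _ x => x - a) (G := fun s x => I01 K (pt s x)) x s1 sJ Ss).
have -> : dX (fun (_ : 'rV[R]_n) x => x - a) s x = 1.
  by rewrite /dX derive1E derive_val subr0.
rewrite mul1r dXE uncJ; case: KI => _ ->; last by rewrite cyl_pt.
pose c t := a + t * (x - a).
have cE t : is_derive t 1 c (x - a).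
  by apply: is_derive_eq; rewrite add0r scaler0 mul1r add0r [_%:A]mulr1.
have KE t : K (pt s x) t = F s (c t) by rewrite /K row_mxKl row_mxKr mxE eqxx.
have dKE t : dP (rshift n ord0) K (pt s x) t = t * dX F s (c t).
  rewrite /dP /pd.
  have [-> _] := @derive_transfer R _ _ _ (K ^~ t) (fun y => F s (a + t * (y - a))) (pt s x)
    (delta_mx ord0 (rshift n ord0)) x 1
    (fun h => ltac:(by rewrite pt_dX /K row_mxKl row_mxKr mxE eqxx [_%:A]mulr1)).
  have d1 : is_derive x 1 (fun y => a + t * (y - a)) t.
    by apply: is_derive_eq; rewrite add0r mul1r subr0 [_%:A]mulr1.
  have d2 := sm_dX (c t) sF Ss.
  by have [_ ->] := @is_derive1_comp R (F s) (fun y => a + t * (y - a)) x _ _ d2 d1; rewrite mulrC.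
pose H t := t * F s (c t).
have dFc t : is_derive t 1 (F s \o c) (dX F s (c t) * (x - a)).
  exact: (@is_derive1_comp R _ _ _ _ _ (sm_dX (c t) sF Ss) (cE t)).
have dFc' t : is_derive t 1 (dX F s \o c) (dX (dX F) s (c t) * (x - a)).
  exact: (@is_derive1_comp R _ _ _ _ _ (sm_dX (c t) (smX sF) Ss) (cE t)).
have cF : continuous (F s \o c) by move=> t; exact: derivable_continuous1 (dFc t).
have cF' : continuous (fun t => t * dX F s (c t)).
  by move=> t; apply: cvgM; [exact: cvg_id | exact: derivable_continuous1 (dFc' t)].
have cF'' : continuous (fun t => (x - a) * (t * dX F s (c t))).
  by move=> t; apply: cvgM; [exact: cvg_cst | exact: cF'].
have dH t : is_derive t 1 H (F s (c t) + (x - a) * (t * dX F s (c t))).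
  have := @is_deriveM _ _ id (F s \o c) t 1 _ _ (is_derive_id t 1) (dFc t).
  suff -> : F s (c t) + (x - a) * (t * dX F s (c t)) = t *: (dX F s (c t) * (x - a)) + (F s \o c) t *: (1 : R) by [].
  by rewrite /GRing.scale /=; ring.
have ii f : continuous f -> mu.-integrable `[0, 1] (EFin \o f).
  by move=> cf; apply: integrable_segment; exact: continuous_subspaceT.
have := @Rintegral_FTC2 R H _ 0 1 ltr01 (fun t _ => dH t)
  (continuous_subspaceT (fun t => cvgD (cF t) (cF'' t))).
rewrite RintegralD //; [|exact: ii..].
rewrite RintegralZl //; last exact: ii.
have H1 : H 1 = F s x by rewrite /H mul1r /c mul1r addrC subrK.
have H0 : H 0 = 0 by rewrite /H mul0r.
rewrite H1 H0 subr0 => <-.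
congr (_ + _ * _); apply: eq_Rintegral => t _; [exact: KE | exact: dKE].
Qed.

End Prim.

End Primitives.

(** * Families with bounded support and differentiation under the integral over the line *)

Section CompactFamilies.
Context {R : realType}.
Notation mu := (@lebesgue_measure R).
Implicit Types (x y a b e A : R).

(** The bound is locally uniform in the parameters, which is what lets derivatives in s pass through
    the integral over x. *)
Definition supp0 n (S : set 'rV[R]_n) (F : 'rV[R]_n -> R -> R) : Prop :=
  forall s, S s -> exists A, \forall t \near s, forall x, A <= `|x| -> F t x = 0.

(** Turns a bound valid near s into one valid on an open set of parameters, on which derivatives in
    s can be compared with A kept fixed. *)
Lemma near_open n (S : set 'rV[R]_n) (P : R -> 'rV[R]_n -> Prop) s : open S -> S s ->
  (forall A B t, A <= B -> P A t -> P B t) ->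
  (exists A, \forall t \near s, P A t) ->
  exists A S', [/\ 0 < A, open S', S' s, S' `<=` S & forall t, S' t -> P A t].
Proof.
move=> oS Ss Pm [A nP]; exists (`|A| + 1), (interior [set t | S t /\ P A t]); split.
- by rewrite ltr_wpDl.
- exact: open_interior.
- by apply: filterI nP; exact: open_nbhs_nbhs.
- by move=> t /interior_subset [].
- by move=> t /interior_subset [_]; apply: Pm; rewrite (le_trans (ler_norm A))// lerDl.
Qed.

Lemma supp0_open n (S : set 'rV[R]_n) F s : open S -> supp0 S F -> S s ->
  exists A S', [/\ 0 < A, open S', S' s, S' `<=` S &
    forall t, S' t -> forall x, A <= `|x| -> F t x = 0].
Proof.
move=> oS zF Ss; apply: (near_open oS Ss (P := fun A t => forall x, A <= `|x| -> F t x = 0)).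
  by move=> A B t AB H x Bx; apply: H; exact: le_trans Bx.
exact: zF.
Qed.

Lemma supp0_cs n (S : set 'rV[R]_n) F s : sm S F -> supp0 S F -> S s -> cs (F s).
Proof.
move=> sF zF Ss; split; first exact: (sm_continuous sF).
by have [A /nbhs_singleton H] := zF s Ss; exists A.
Qed.

Lemma supp0D n (S : set 'rV[R]_n) F G : supp0 S F -> supp0 S G -> supp0 S (fun s x => F s x + G s x).
Proof.
move=> zF zG s Ss; have [A H] := zF s Ss; have [B H'] := zG s Ss.
exists (Num.max A B); apply: filterS2 H H' => t H H' x; rewrite ge_max => /andP[? ?].
by rewrite H // H' // addr0.
Qed.

Lemma supp0Ml n (S : set 'rV[R]_n) F G : supp0 S F -> supp0 S (fun s x => F s x * G s x).
Proof.
move=> zF s Ss; have [A H] := zF s Ss; exists A; apply: filterS H => t H x Ax.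
by rewrite H // mul0r.
Qed.

Lemma supp0Mr n (S : set 'rV[R]_n) F G : supp0 S G -> supp0 S (fun s x => F s x * G s x).
Proof.
move=> zF s Ss; have [A H] := zF s Ss; exists A; apply: filterS H => t H x Ax.
by rewrite H // mulr0.
Qed.

Lemma supp0_0 n (S : set 'rV[R]_n) : supp0 S (fun _ _ => 0).
Proof. by move=> s _; exists 0; near=> t. Unshelve. all: by end_near. Qed.

Lemma supp0_sum n (S : set 'rV[R]_n) (I : Type) (r : seq I) (P : pred I) F :
  (forall i, supp0 S (F i)) -> supp0 S (fun s x => \sum_(i <- r | P i) F i s x).
Proof.
move=> H; elim: r => [|i r IH].
  by under eq_fun do under eq_fun do rewrite big_nil; exact: supp0_0.
case Pi: (P i); last by under eq_fun do under eq_fun do rewrite big_cons Pi.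
by under eq_fun do under eq_fun do rewrite big_cons Pi; exact: supp0D.
Qed.

(* The common value at both ends may depend on the parameters. *)
Definition cst_end n (S : set 'rV[R]_n) (F : 'rV[R]_n -> R -> R) : Prop :=
  forall s, S s -> exists A, \forall t \near s,
    forall x y, A <= `|x| -> A <= `|y| -> F t x = F t y.

Lemma cst_end_open n (S : set 'rV[R]_n) F s : open S -> cst_end S F -> S s ->
  exists A S', [/\ 0 < A, open S', S' s, S' `<=` S &
    forall t, S' t -> forall x y, A <= `|x| -> A <= `|y| -> F t x = F t y].
Proof.
move=> oS zF Ss; apply: (near_open oS Ss (P := fun A t => forall x y, A <= `|x| -> A <= `|y| -> F t x = F t y)).
  by move=> A B t AB H x y Bx By; apply: H; [exact: le_trans Bx|exact: le_trans By].
exact: zF.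
Qed.

Lemma supp0_cst_end n (S : set 'rV[R]_n) F : supp0 S F -> cst_end S F.
Proof.
move=> zF s /zF [A H]; exists A; apply: filterS H => t H x y Ax Ay.
by rewrite !H.
Qed.

Lemma cst_endD n (S : set 'rV[R]_n) F G :
  cst_end S F -> cst_end S G -> cst_end S (fun s x => F s x + G s x).
Proof.
move=> zF zG s Ss; have [A H] := zF s Ss; have [B H'] := zG s Ss.
exists (Num.max A B); apply: filterS2 H H' => t H H' x y.
by rewrite !ge_max => /andP[? ?] /andP[? ?]; congr (_ + _); [exact: H|exact: H'].
Qed.

Lemma cst_endM n (S : set 'rV[R]_n) F G :
  cst_end S F -> cst_end S G -> cst_end S (fun s x => F s x * G s x).
Proof.
move=> zF zG s Ss; have [A H] := zF s Ss; have [B H'] := zG s Ss.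
exists (Num.max A B); apply: filterS2 H H' => t H H' x y.
by rewrite !ge_max => /andP[? ?] /andP[? ?]; congr (_ * _); [exact: H|exact: H'].
Qed.

Lemma cst_end_cst n (S : set 'rV[R]_n) (c : R) : cst_end S (fun _ _ => c).
Proof. by move=> s _; exists 0; near=> t. Unshelve. all: by end_near. Qed.

Lemma cst_end_sum n (S : set 'rV[R]_n) (I : Type) (r : seq I) (P : pred I) F :
  (forall i, cst_end S (F i)) -> cst_end S (fun s x => \sum_(i <- r | P i) F i s x).
Proof.
move=> H; elim: r => [|i r IH].
  by under eq_fun do under eq_fun do rewrite big_nil; exact: cst_end_cst.
case Pi: (P i); last by under eq_fun do under eq_fun do rewrite big_cons Pi.
by under eq_fun do under eq_fun do rewrite big_cons Pi; exact: cst_endD.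
Qed.

Lemma supp0_dX n (S : set 'rV[R]_n) F : open S -> sm S F -> cst_end S F -> supp0 S (dX F).
Proof.
move=> oS sF zF s Ss; have [A [S' [A0 oS' S's SS H]]] := cst_end_open oS zF Ss.
exists (A + 1); have nS : \forall t \near s, S' t by exact: open_nbhs_nbhs.
apply: filterS nS => t S't x Ax.
have Ax' : A < `|x| by apply: lt_le_trans Ax; rewrite ltrDl.
have nx : \forall y \near x, A <= `|y|.
  by apply: (@cvgr_ge R _ (nbhs x) _ (fun y : R => `|y|) `|x|) => //; exact: norm_continuous.
have nfx : \forall y \near x, F t y = cst (F t x) y.
  by apply: filterS nx => y Ay; apply: H => //; exact: ltW.
by rewrite /dX derive1E (near_eq_derive _ nfx) derive_cst.
Qed.

Lemma int_dX n (S : set 'rV[R]_n) F s : sm S F -> cst_end S F -> S s ->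
  cs (dX F s) /\ \int[mu]_x dX F s x = 0.
Proof.
move=> sF zF Ss; apply: int_derive0 => [|x|]; first exact: (sm_continuous (smX sF)).
  exact: (sm_dX x sF Ss).
by have [A /nbhs_singleton H] := zF s Ss; exists A.
Qed.

Lemma cst_end_dP n (S : set 'rV[R]_n) F k : open S -> cst_end S F -> cst_end S (dP k F).
Proof.
move=> oS zF s Ss; have [A [S' [A0 oS' S's SS H]]] := cst_end_open oS zF Ss.
exists A; have nS : \forall t \near s, S' t by exact: open_nbhs_nbhs.
by apply: filterS nS => t S't x y Ax Ay; apply: (pd_eq oS') => // r S'r; exact: H.
Qed.

Lemma supp0_dP n (S : set 'rV[R]_n) F k : open S -> supp0 S F -> supp0 S (dP k F).
Proof.
move=> oS zF s Ss; have [A [S' [A0 oS' S's SS H]]] := supp0_open oS zF Ss.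
exists A; have nS : \forall t \near s, S' t by exact: open_nbhs_nbhs.
apply: filterS nS => t S't x Ax.
have -> : dP k F t x = pd ord0 k (cst 0) t by apply: (pd_eq oS') => // r S'r; exact: H.
by rewrite /pd derive_cst.
Qed.

Section Ddx.
Variables (n : nat) (S : set 'rV[R]_n) (F : 'rV[R]_n -> R -> R).
Hypotheses (oS : open S) (sF : sm S F) (zF : supp0 S F).

(** Locally in the parameters one base point -A lies to the left of all supports. The integral and
    [ddx_inv] are then expressed by the single smooth family [prim (- A) F] and inherit its
    smoothness. *)
Lemma supp_primE s : S s -> exists A S', [/\ 0 < A, open S', S' s, S' `<=` S &
  forall t, S' t ->
  [/\ \int[mu]_x F t x = prim (- A) F t A,
      forall x, ddx_inv (F t) x = prim (- A) F t x - (prim (- A) F t A) / 2,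
      forall x, A <= x -> prim (- A) F t x = prim (- A) F t A,
      forall x, A <= `|x| -> F t x = 0 &
      forall x, x <= - A -> prim (- A) F t x = 0]].
Proof.
move=> Ss; have [A [S' [A0 oS' S's SS H]]] := supp0_open oS zF Ss.
exists A, S'; split => // t S't; have St := SS _ S't.
have dH x : is_derive x 1 (prim (- A) F t) (F t x).
  by rewrite -(dX_prim (-A) oS sF x St); exact: (sm_dX x (sm_prim (- A) oS sF) St).
have cF := sm_continuous sF St.
split.
- by rewrite (Rintegral_suppT A0 (H t S't) cF dH) prim_a subr0.
- by move=> x; rewrite (ddx_invE A0 (H t S't) cF dH) prim_a addr0.
- by move=> x; exact: (primitive_right (H t S't) dH).
- exact: H.
- by move=> x xA; rewrite (primitive_left (H t S't) dH xA) prim_a.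
Qed.

Lemma sm_ddx : sm S (fun s => ddx_inv (F s)).
Proof.
apply: sm_local => s /supp_primE [A [S' [A0 oS' S's SS H]]]; exists S'; split => //.
have sp := sm_subset SS (sm_prim (- A) oS sF).
apply: (sm_eq (F := fun t x => prim (- A) F t x - prim (- A) F t A / 2) oS').
  by move=> t x /H [].
apply: smD => //; apply: smN => //; apply: smM => //; last exact: sm_cst.
apply: smooth_sm => //; exact: sm_smooth_at.
Qed.

Lemma dX_ddx s x : S s -> dX (fun s => ddx_inv (F s)) s x = F s x.
Proof.
move=> Ss; have [A [S' [A0 oS' S's SS H]]] := supp_primE Ss.
rewrite -(dX_prim (- A) oS sF x Ss) /dX !derive1E.
rewrite (_ : ddx_inv (F s) = prim (- A) F s + cst (- (prim (- A) F s A / 2))); last first.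
  by apply/funext => y; case: (H s S's).
rewrite deriveD ?derive_cst ?addr0 //.
by have [] := sm_dX x (sm_prim (- A) oS sF) Ss.
Qed.

Lemma smooth_int : smooth_on S (fun s => \int[mu]_x F s x).
Proof.
apply: smooth_local => s /supp_primE [A [S' [A0 oS' S's SS H]]]; exists S'; split => //.
have sp := sm_subset SS (sm_prim (- A) oS sF).
apply: (smooth_eq (f := prim (- A) F ^~ A) oS').
  by move=> t /H [].
exact: sm_smooth_at.
Qed.

Lemma ddx_ends s : S s -> exists A, \forall t \near s,
  (forall x, A <= x -> ddx_inv (F t) x = (\int[mu]_x F t x) / 2) /\
  (forall x, x <= - A -> ddx_inv (F t) x = - (\int[mu]_x F t x) / 2).
Proof.
move=> /supp_primE [A [S' [A0 oS' S's SS H]]]; exists A.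
have nS : \forall t \near s, S' t by exact: open_nbhs_nbhs.
apply: filterS nS => t /H [-> E H1 _ H2]; split => x xA; rewrite E.
  by rewrite H1 //; field.
by rewrite H2 //; field.
Qed.

End Ddx.

(** The integral is [prim (- A) F] at A, and by the symmetry of second derivatives the parameter
    derivative of this primitive is a primitive of [dP k F]. *)
Lemma pd_int n (S : set 'rV[R]_n) F k s : open S -> sm S F -> supp0 S F -> S s ->
  pd ord0 k (fun s => \int[mu]_x F s x) s = \int[mu]_x dP k F s x.
Proof.
move=> oS sF zF Ss; have [A [S' [A0 oS' S's SS H]]] := supp_primE oS sF zF Ss.
rewrite (pd_eq oS' (g := prim (- A) F ^~ A)) => //; last by move=> t /H [].
have sp := sm_prim (- A) oS sF.
have dH x : is_derive x 1 (dP k (prim (- A) F) s) (dP k F s x).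
  have -> : dP k F s x = dX (dP k (prim (- A) F)) s x.
    rewrite -(dPdX _ _ oS sp Ss).
    by apply: (dP_eq _ _ oS Ss) => t y St; rewrite (dX_prim _ oS sF).
  exact: (sm_dX x (smP k sp) Ss).
have vF x : A <= `|x| -> dP k F s x = 0.
  move=> Ax; have -> : dP k F s x = pd ord0 k (cst 0) s.
    by apply: (pd_eq oS') => // t /H [_ _ _ Z _]; exact: Z.
  by rewrite /pd derive_cst.
rewrite (Rintegral_suppT A0 vF (sm_continuous (smP k sF) Ss) dH).
have -> : dP k (prim (- A) F) s (- A) = 0.
  rewrite /dP (_ : (fun t => _) = cst 0) ?/pd ?derive_cst//.
  by apply/funext => t; rewrite prim_a.
by rewrite subr0.
Qed.

End CompactFamilies.

(** * First variation of the bracket *)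

Section Algebra.
Context {R : comPzRingType} {N : nat}.
Implicit Types (c : 'I_N -> 'I_N -> 'I_N -> R) (a b d e v w : 'I_N -> R) (eta : 'M[R]_N).

Definition up eta v : 'I_N -> R := fun i => \sum_j eta i j * v j.

Definition tri c a b d : R := \sum_i \sum_j \sum_k c i j k * a i * b j * d k.

(* the covector tri c a - d *)
Definition cl c a d : 'I_N -> R := fun j => \sum_i \sum_k c i j k * a i * d k.

Lemma sum_up eta v w : eta^T = eta -> \sum_i w i * up eta v i = \sum_i up eta w i * v i.
Proof.
move=> es; rewrite /up; under eq_bigr do rewrite big_distrr.
rewrite exchange_big; apply: eq_bigr => i _ /=; rewrite big_distrl /=.
by apply: eq_bigr => j _; rewrite -[eta in RHS]es mxE mulrA [w j * _]mulrC.
Qed.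

Lemma sum_cl c a b d : \sum_j b j * cl c a d j = tri c a b d.
Proof.
rewrite /tri exchange_big /=; apply: eq_bigr => j _; rewrite /cl big_distrr /=.
apply: eq_bigr => i _; rewrite big_distrr; apply: eq_bigr => k _ /=.
by rewrite [RHS]mulrAC mulrC.
Qed.

Lemma tri_ext c a a' b b' d d' : a =1 a' -> b =1 b' -> d =1 d' -> tri c a b d = tri c a' b' d'.
Proof.
move=> ea eb ed; do 3! (apply: eq_bigr => ? _).
by rewrite ea eb ed.
Qed.

Lemma tri_lin3 c a b d d' r s : tri c a b (fun k => r * d k + s * d' k) = r * tri c a b d + s * tri c a b d'.
Proof.
rewrite /tri !big_distrr -big_split; apply: eq_bigr => i _ /=.
rewrite !big_distrr -big_split; apply: eq_bigr => j _ /=.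
rewrite !big_distrr -big_split; apply: eq_bigr => k _ /=.
by rewrite mulrDr mulrCA [_ * (s * _)]mulrCA.
Qed.

Section Symmetric.
Variable c : 'I_N -> 'I_N -> 'I_N -> R.
Hypotheses (c12 : forall i j k, c i j k = c j i k) (c23 : forall i j k, c i j k = c i k j).

Lemma tri12 a b d : tri c a b d = tri c b a d.
Proof.
rewrite /tri exchange_big; apply: eq_bigr => i _; apply: eq_bigr => j _.
by apply: eq_bigr => k _; rewrite c12 -!mulrA [a j * _]mulrCA.
Qed.

Lemma tri23 a b d : tri c a b d = tri c a d b.
Proof.
rewrite /tri; apply: eq_bigr => i _; rewrite exchange_big; apply: eq_bigr => j _.
by apply: eq_bigr => k _; rewrite c23 -!mulrA [b k * _]mulrC.
Qed.

Lemma tri13 a b d : tri c a b d = tri c d b a.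
Proof. by rewrite tri12 tri23 tri12. Qed.

(** Write x.y for the product [up eta (cl c x y)]. Associativity is used below in the form c(a, e,
    b.d) = c(b, e, a.d): a vector inside the product trades places with one outside it. *)
Lemma tri_assoc eta a b d e :
  (forall i j m n, \sum_k \sum_l c i j k * eta k l * c l m n = \sum_k \sum_l c i m k * eta k l * c l j n) ->
  tri c a e (up eta (cl c b d)) = tri c b e (up eta (cl c a d)).
Proof.
move=> assoc.
have E x y : tri c x e (up eta (cl c y d)) =
   \sum_j \sum_m \sum_i \sum_n x j * y m * e i * d n * \sum_k \sum_l c i j k * eta k l * c l m n.
  rewrite /tri; apply: eq_bigr => j _; rewrite exchange_big /=.
  transitivity (\sum_k \sum_i \sum_l \sum_m \sum_n x j * y m * e i * d n * (c i j k * eta k l * c l m n)).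
    apply: eq_bigr => k _; apply: eq_bigr => i _; rewrite /up big_distrr; apply: eq_bigr => l _ /=.
    rewrite /cl !big_distrr; apply: eq_bigr => m _ /=; rewrite !big_distrr; apply: eq_bigr => n _ /=.
    by rewrite [c m l n]c12 [c j i k]c12; ring.
  rewrite exchange_big /=; under eq_bigr do under eq_bigr do rewrite exchange_big /=.
  under eq_bigr do rewrite exchange_big /=.
  rewrite exchange_big /=; apply: eq_bigr => m _; apply: eq_bigr => i _.
  under eq_bigr do rewrite exchange_big /=.
  rewrite exchange_big /=; apply: eq_bigr => n _; rewrite big_distrr; apply: eq_bigr => k _ /=.
  by rewrite big_distrr.
rewrite !E exchange_big; apply: eq_bigr => m _; apply: eq_bigr => j _.
apply: eq_bigr => i _; apply: eq_bigr => n _; rewrite assoc.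
by rewrite [b m * _]mulrC.
Qed.

End Symmetric.

End Algebra.

Section Derivations.
Context {R : realType} {n : nat}.
Implicit Types (S : set 'rV[R]_n) (F G : 'rV[R]_n -> R -> R).

(** Since x is the last of n + 1 variables, one derivation covers both [dX] and [dP], and each rule
    of differentiation is needed only once. *)
Definition DD (j : 'I_(n + 1)) F : 'rV[R]_n -> R -> R := fun s x => pd ord0 j (unc F) (pt s x).

Lemma dX_DD : @dX R n = DD (rshift n ord0).
Proof. by apply/funext => F; apply/funext => s; apply/funext => x; exact: dXE. Qed.

Lemma dP_DD k : @dP R n k = DD (lshift 1 k).
Proof. by apply/funext => F; apply/funext => s; apply/funext => x; exact: dPE. Qed.

Lemma unc_DD j F : unc (DD j F) = pd ord0 j (unc F).
Proof. by apply/funext => z; rewrite /unc /DD ptK. Qed.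

Lemma sm_DD S j F : sm S F -> sm S (DD j F).
Proof. by move=> sF; rewrite /sm unc_DD; exact: smooth_pd. Qed.

Lemma DD_eq S j F G s x : open S -> S s -> (forall s x, S s -> F s x = G s x) ->
  DD j F s x = DD j G s x.
Proof.
move=> oS Ss FG; apply: (pd_eq (open_cyl oS)); last by rewrite cyl_pt.
by move=> z Sz; exact: FG.
Qed.

Lemma DDD S F G j s x : sm S F -> sm S G -> S s ->
  DD j (fun s x => F s x + G s x) s x = DD j F s x + DD j G s x.
Proof. by move=> sF sG Ss; rewrite /DD -pdD//; exact: sm_diff Ss. Qed.

Lemma DDM S F G j s x : sm S F -> sm S G -> S s ->
  DD j (fun s x => F s x * G s x) s x = DD j F s x * G s x + F s x * DD j G s x.
Proof.
move=> sF sG Ss; rewrite /DD -(unc_pt F) -(unc_pt G) -pdM //.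
  exact: (sm_diff _ sF Ss).
exact: (sm_diff _ sG Ss).
Qed.

Lemma DD_cst (c : R) j s x : DD j (fun _ _ => c) s x = 0.
Proof. by rewrite /DD /pd derive_cst. Qed.

Lemma DDZ S (c : R) F j s x : sm S F -> S s -> DD j (fun s x => c * F s x) s x = c * DD j F s x.
Proof.
move=> sF Ss.
by rewrite (DDM (F := fun _ _ => c) j x (@sm_cst R n S c) sF Ss) DD_cst mul0r add0r.
Qed.

Lemma DDN S F j s x : sm S F -> S s -> DD j (fun s x => - F s x) s x = - DD j F s x.
Proof.
move=> sF Ss; rewrite -mulN1r -(DDZ _ _ _ sF Ss); congr (DD j _ s x).
by apply/funext => t; apply/funext => y; rewrite mulN1r.
Qed.

Lemma DD_sum S (I : Type) (r : seq I) (P : pred I) (F : I -> 'rV[R]_n -> R -> R) j s x :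
  (forall a, sm S (F a)) -> S s ->
  DD j (fun s x => \sum_(a <- r | P a) F a s x) s x = \sum_(a <- r | P a) DD j (F a) s x.
Proof.
move=> sF Ss; rewrite /DD.
have [|_ ->] // := @pd_sum R _ _ I r P (fun a => unc (F a)) ord0 j (pt s x).
by move=> a; exact: sm_diff Ss.
Qed.

Lemma famP N S (p : 'rV[R]_n -> R -> 'rV[R]_N) : smooth_family S p ->
  forall i, sm S (fun s x => p s x ord0 i).
Proof. by []. Qed.

Lemma DDC N S (U : set 'rV[R]_N) f (p : 'rV[R]_n -> R -> 'rV[R]_N) j s x :
  smooth_on U f -> smooth_family S p -> (forall s x, S s -> U (p s x)) -> S s ->
  DD j (fun s x => f (p s x)) s x =
  \sum_i d_ i f (p s x) * DD j (fun s x => p s x ord0 i) s x.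
Proof. by move=> sf sp SU Ss; exact: (pd_unc_comp _ _ sf (famP sp) SU Ss). Qed.

Lemma DD_comm S i j F s x : open S -> sm S F -> S s -> DD i (DD j F) s x = DD j (DD i F) s x.
Proof.
move=> oS sF Ss; rewrite /DD !unc_DD.
by apply: (Schwarz _ _ _ _ (open_cyl oS) sF); rewrite cyl_pt.
Qed.

Lemma derive1_coord N S (p : 'rV[R]_n -> R -> 'rV[R]_N) s x i : smooth_family S p -> S s ->
  derive1 (p s) x ord0 i = DD (rshift n ord0) (fun s x => p s x ord0 i) s x.
Proof.
move=> sp Ss; rewrite -dX_DD /dX !derive1E.
have dp : derivable (p s) x 1.
  apply/derivable_mxP => a j; rewrite (ord1 a : a = ord0).
  by have [] := sm_dX x (famP sp j) Ss.
by rewrite (derive_mx dp) mxE.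
Qed.

Lemma supp0_eq S F G : open S -> (forall s x, S s -> F s x = G s x) -> supp0 S F -> supp0 S G.
Proof.
move=> oS FG zF s Ss; have [A H] := zF s Ss; exists A.
have nS : \forall t \near s, S t by exact: open_nbhs_nbhs.
by apply: filterS2 nS H => t St H x Ax; rewrite -FG // H.
Qed.

Lemma cst_end_eq S F G : open S -> (forall s x, S s -> F s x = G s x) -> cst_end S F -> cst_end S G.
Proof.
move=> oS FG zF s Ss; have [A H] := zF s Ss; exists A.
have nS : \forall t \near s, S t by exact: open_nbhs_nbhs.
by apply: filterS2 nS H => t St H x y Ax Ay; rewrite -!FG //; exact: H.
Qed.

End Derivations.

Section ThirdDerivatives.
Context {R : realType} {N : nat}.
Variables (U : set 'rV[R]_N) (Phi : 'rV[R]_N -> R).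
Hypotheses (oU : open U) (sPhi : smooth_on U Phi).

Lemma smooth_d3 i j k : smooth_on U (d3 Phi i j k).
Proof. by do 3! apply: smooth_pd. Qed.

Lemma d_comm f i j u : smooth_on U f -> U u -> d_ i (d_ j f) u = d_ j (d_ i f) u.
Proof. by move=> sf Uu; exact: (@Schwarz _ _ _ U f ord0 i ord0 j u oU sf Uu). Qed.

Lemma d_eq f g i u : (forall w, U w -> f w = g w) -> U u -> d_ i f u = d_ i g u.
Proof. by move=> fg Uu; exact: (@pd_eq _ _ _ U f g oU fg u Uu ord0 i). Qed.

Lemma d3_12 i j k u : U u -> d3 Phi i j k u = d3 Phi j i k u.
Proof. by apply: d_comm; exact: smooth_pd. Qed.

Lemma d3_23 i j k u : U u -> d3 Phi i j k u = d3 Phi i k j u.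
Proof. by apply: d_eq => w; exact: d_comm. Qed.

Lemma d4_swap l i j k u : U u -> d_ l (d3 Phi i j k) u = d_ k (d3 Phi i j l) u.
Proof.
move=> Uu.
have rot a b c w : U w -> d3 Phi a b c w = d3 Phi c a b w.
  by move=> Uw; exact (eq_trans (d3_23 a b c Uw) (d3_12 a c b Uw)).
apply: etrans (d_eq l (rot i j k) Uu) _.
apply: etrans (esym (d_eq k (rot i j l) Uu)).
by apply: (@d_comm (d_ i (d_ j Phi)) l k u) => //; do 2! apply: smooth_pd.
Qed.

End ThirdDerivatives.

(** The linear algebra of [variation_identity] for L01. X1 is the varied density c(xi, phi_ze, u_x);
    X2, X3 and X9 are the x-derivatives of the three terms of the primitive. X6, the variation of
    c(ze, phi_xi, u_x), is expanded in two ways, which determines the term Q that it shares with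
    X9. *)
Lemma bookkeeping (K : comPzRingType) (X1 C A1 M1 V1 X2 C' A2 M2 V1' X3 D' Z2 N2 W' X6 D Z1 N1 W Q N1' X9
    a1 a2 b1 b2 : K) :
  X1 = C + A1 + M1 + V1 -> X2 = C' + A2 + M2 + V1' -> X3 = D' + Z2 + N2 + W' ->
  X6 = D + Z1 + N1 + W -> X6 = N1' + Q -> N1' = N1 -> X9 = M1 + Q -> M2 = N2 ->
  V1 = V1' -> W = W' -> C = C' -> D = D' -> A1 = a1 -> Z1 = a2 -> Z2 = b1 -> A2 = b2 ->
  X1 = a1 - a2 + (b1 - b2) + (X2 - X3 + X9).
Proof.
move=> -> -> -> e1 e4 e5 -> -> -> e6 -> e2 -> e3 -> ->.
have -> : Q = D + Z1 + N1 + W - N1 by rewrite -e1 e4 e5; ring.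
by rewrite e2 e3 e6; ring.
Qed.

(** Adds to the L01 part, with weight r1, the L10 part with weight r2, where a single integration by
    parts is enough. *)
Lemma bookkeeping2 (K : comPzRingType) (r1 r2 X X1 Y1 d1 d2 a1 a2 b1 b2 B Xb Y2 T m m' e : K) :
  X = r1 * X1 + r2 * Y1 -> d1 = r1 * a1 + r2 * b1 -> d2 = r1 * a2 + r2 * b2 ->
  B = r1 * Xb + r2 * Y2 -> X1 = a1 - a2 + T + Xb -> Y1 = b1 + m -> Y2 = e + m' -> m = m' ->
  e = b2 -> X = d1 - d2 + r1 * T + B.
Proof. by move=> -> -> -> -> -> -> -> -> ->; ring. Qed.

Section FirstVariation.
Context {R : realType} {N : nat}.
Variables (U : set 'rV[R]_N) (Phi : 'rV[R]_N -> R) (eta : 'M[R]_N).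
Hypotheses (oU : open U) (sPhi : smooth_on U Phi) (eta_sym : eta^T = eta).
Hypothesis assoc : associativity U eta Phi.
Variables (n : nat) (S : set 'rV[R]_n) (p : 'rV[R]_n -> R -> 'rV[R]_N).
Hypotheses (oS : open S) (sp : smooth_family S p) (SU : forall s x, S s -> U (p s x)).
Notation fam := ('I_N -> 'rV[R]_n -> R -> R).
Implicit Types (a b d : fam).

Let x_ : 'I_(n + 1) := rshift n ord0.

Definition c3 s x i j k : R := d3 Phi i j k (p s x).
Definition TRI a b d : 'rV[R]_n -> R -> R := fun s x =>
  tri (c3 s x) (fun i => a i s x) (fun j => b j s x) (fun k => d k s x).
Definition UP a : fam := fun i s x => up eta (fun j => a j s x) i.
Definition CL a d : fam := fun j s x => cl (c3 s x) (fun i => a i s x) (fun k => d k s x) j.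
(** The derivative of the form c along e, evaluated at a, b, d: the term in which fourth derivatives
    of Phi occur. *)
Definition C4 e a b d : 'rV[R]_n -> R -> R := fun s x => \sum_i \sum_j \sum_k
  (\sum_l d_ l (d3 Phi i j k) (p s x) * e l s x) * a i s x * b j s x * d k s x.

Definition crd (q : 'rV[R]_n -> R -> 'rV[R]_N) : fam := fun i s x => q s x ord0 i.
Definition D_ j a : fam := fun i => DD j (a i).

Definition smf a := forall i, sm S (a i).
Definition z0 a := forall i, supp0 S (a i).

Let sc i j k : sm S (fun s x => c3 s x i j k).
Proof. by apply: (smC oS (smooth_d3 sPhi i j k) _ SU) => l; exact: sp. Qed.

Lemma sm_TRI a b d : smf a -> smf b -> smf d -> sm S (TRI a b d).
Proof.
move=> sa sb sd; do 3! (apply: sm_sum => // ?).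
by do 3! (apply: smM => //).
Qed.

Lemma sm_CL a d : smf a -> smf d -> smf (CL a d).
Proof. by move=> sa sd j; do 2! (apply: sm_sum => // ?); do 2! apply: smM => //. Qed.

Lemma sm_UP a : smf a -> smf (UP a).
Proof. by move=> sa j; apply: sm_sum => // k; apply: smM => //; exact: sm_cst. Qed.

Lemma smf_D j a : smf a -> smf (D_ j a).
Proof. by move=> sa i; exact: sm_DD. Qed.

Lemma DD_TRI j a b d s x : smf a -> smf b -> smf d -> S s ->
  DD j (TRI a b d) s x = C4 (D_ j (crd p)) a b d s x + TRI (D_ j a) b d s x
    + TRI a (D_ j b) d s x + TRI a b (D_ j d) s x.
Proof.
move=> sa sb sd Ss; rewrite /TRI /tri /C4.
have s1 i k l : sm S (fun s x => c3 s x i k l * a i s x) by exact: smM.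
have s2 i k l : sm S (fun s x => c3 s x i k l * a i s x * b k s x) by exact: smM.
have s3 i k l : sm S (fun s x => c3 s x i k l * a i s x * b k s x * d l s x) by exact: smM.
have s4 i k : sm S (fun s x => \sum_l c3 s x i k l * a i s x * b k s x * d l s x) by exact: sm_sum.
have s5 i : sm S (fun s x => \sum_k \sum_l c3 s x i k l * a i s x * b k s x * d l s x) by exact: sm_sum.
rewrite (DD_sum _ _ _ _ s5 Ss) -!big_split; apply: eq_bigr => i _ /=.
rewrite (DD_sum _ _ _ _ (s4 i) Ss) -!big_split; apply: eq_bigr => k _ /=.
rewrite (DD_sum _ _ _ _ (s3 i k) Ss) -!big_split; apply: eq_bigr => l _ /=.
rewrite (DDM _ _ (s2 i k l) (sd l) Ss) (DDM _ _ (s1 i k l) (sb k) Ss) (DDM _ _ (sc i k l) (sa i) Ss).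
rewrite (DDC _ _ (smooth_d3 sPhi i k l) sp SU Ss) /D_ /crd /c3.
ring.
Qed.

Lemma DD_UP j a i s x : smf a -> S s -> DD j (UP a i) s x = UP (D_ j a) i s x.
Proof.
move=> sa Ss; rewrite /UP /up (DD_sum (F := fun l s x => eta i l * a l s x) _ _ _ _ _ Ss).
  by apply: eq_bigr => k _; rewrite (DDZ _ _ _ (sa k)).
by move=> k; apply: smM => //; exact: sm_cst.
Qed.

Lemma C4_swap e a b d s x : S s -> C4 e a b d s x = C4 d a b e s x.
Proof.
move=> Ss; rewrite /C4; apply: eq_bigr => i _; apply: eq_bigr => j _.
under eq_bigr do rewrite !big_distrl /=.
under [RHS]eq_bigr do rewrite !big_distrl /=.
rewrite exchange_big /=; apply: eq_bigr => l _; apply: eq_bigr => k _.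
rewrite (d4_swap oU sPhi); last exact: SU.
by ring.
Qed.

Let c12 s x : S s -> forall i j k, c3 s x i j k = c3 s x j i k.
Proof. by move=> Ss i j k; apply: (d3_12 oU sPhi); exact: SU. Qed.

Let c23 s x : S s -> forall i j k, c3 s x i j k = c3 s x i k j.
Proof. by move=> Ss i j k; apply: (d3_23 oU sPhi); exact: SU. Qed.

Let cassoc s x : S s -> forall i j m l,
  \sum_k \sum_q c3 s x i j k * eta k q * c3 s x q m l =
  \sum_k \sum_q c3 s x i m k * eta k q * c3 s x q j l.
Proof. by move=> Ss i j m l; apply: assoc; exact: SU. Qed.

Section Argument.
Variable xi : 'rV[R]_n -> R -> 'rV[R]_N.
Hypotheses (sxi : smooth_family S xi).

Notation u' := (D_ x_ (crd p)).

Definition phi : fam := fun i s => ddx_inv (L01_arg eta Phi (p s) (xi s) i).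

Lemma L01_argE s x i : S s ->
  L01_arg eta Phi (p s) (xi s) i x = CL (UP (crd xi)) u' i s x.
Proof.
move=> Ss; rewrite /L01_arg exchange_big /=; apply: eq_bigr => r _.
rewrite exchange_big /=; apply: eq_bigr => k _.
rewrite /UP /up big_distrr big_distrl; apply: eq_bigr => j _ /=.
rewrite /ux (derive1_coord _ _ sp Ss) -[in LHS]eta_sym mxE /D_ /crd /c3.
by rewrite -/x_; ring.
Qed.

Lemma L01_outE s x f i : S s ->
  L01_out eta Phi (p s) f x ord0 i =
  up eta (cl (c3 s x) (up eta (fun m => f m x)) (fun k => u' k s x)) i.
Proof.
move=> Ss; rewrite mxE.
under eq_bigr do rewrite exchange_big /=.
rewrite exchange_big /= /up; apply: eq_bigr => l _.
rewrite /cl big_distrr; apply: eq_bigr => m _ /=.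
rewrite exchange_big big_distrr; apply: eq_bigr => k _ /=.
rewrite !big_distrr !big_distrl !big_distrr; apply: eq_bigr => j _ /=.
rewrite /ux (derive1_coord _ _ sp Ss) (c12 _ Ss m) /D_ /crd /c3 -/x_.
ring.
Qed.

Lemma L01E s x i : S s -> L01 eta Phi (p s) (xi s) x ord0 i = UP (CL (UP phi) u') i s x.
Proof. by move=> Ss; rewrite /L01 L01_outE. Qed.

Lemma L10E s x i : S s -> L10 eta (p s) (xi s) x ord0 i = UP (D_ x_ (crd xi)) i s x.
Proof. by move=> Ss; rewrite mxE; apply: eq_bigr => j _; rewrite (derive1_coord _ _ sxi Ss). Qed.

Hypothesis zu : z0 u'.

Let su : smf u'. Proof. exact: smf_D. Qed.

Lemma sm_arg i : sm S (fun s => L01_arg eta Phi (p s) (xi s) i).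
Proof.
apply: (sm_eq oS (F := CL (UP (crd xi)) u' i)); first by move=> s x Ss; rewrite L01_argE.
by apply: sm_CL => //; exact: sm_UP.
Qed.

Lemma supp0_CL a : z0 (CL a u').
Proof.
by move=> j; do 2! (apply: supp0_sum => ?); apply: supp0Mr.
Qed.

Lemma supp0_arg i : supp0 S (fun s => L01_arg eta Phi (p s) (xi s) i).
Proof.
apply: (supp0_eq oS (F := CL (UP (crd xi)) u' i)); first by move=> s x Ss; rewrite L01_argE.
exact: supp0_CL.
Qed.

Lemma sm_phi : smf phi.
Proof. by move=> i; apply: sm_ddx => //; [exact: sm_arg | exact: supp0_arg]. Qed.

Lemma D_phi i s x : S s -> D_ x_ phi i s x = CL (UP (crd xi)) u' i s x.
Proof.
move=> Ss; change (DD (rshift n ord0) (phi i) s x = CL (UP (crd xi)) u' i s x).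
rewrite -dX_DD (dX_ddx oS (sm_arg i) (supp0_arg i) x Ss).
exact: L01_argE.
Qed.

End Argument.

Definition DOT a b : 'rV[R]_n -> R -> R := fun s x => \sum_i a i s x * b i s x.

Lemma sm_DOT a b : smf a -> smf b -> sm S (DOT a b).
Proof. by move=> sa sb; apply: sm_sum => // i; exact: smM. Qed.

Lemma DD_DOT j a b s x : smf a -> smf b -> S s ->
  DD j (DOT a b) s x = DOT (D_ j a) b s x + DOT a (D_ j b) s x.
Proof.
move=> sa sb Ss.
rewrite /DOT (DD_sum (F := fun i s x => a i s x * b i s x) _ _ _ _ _ Ss); last first.
  by move=> i; exact: smM.
by rewrite -big_split; apply: eq_bigr => i _ /=; rewrite (DDM _ _ (sa i) (sb i) Ss).
Qed.

Lemma DOT_UP a b s x : DOT a (UP b) s x = DOT (UP a) b s x.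
Proof. exact: (sum_up (fun i => b i s x) (fun i => a i s x) eta_sym). Qed.

Lemma DOT_CL a b d s x : DOT b (CL a d) s x = TRI a b d s x.
Proof. exact: sum_cl. Qed.

Lemma DOTC a b s x : DOT a b s x = DOT b a s x.
Proof. by apply: eq_bigr => i _; rewrite mulrC. Qed.

Lemma DOT_ext a a' b b' s x : (forall i, a i s x = a' i s x) -> (forall i, b i s x = b' i s x) ->
  DOT a b s x = DOT a' b' s x.
Proof. by move=> ea eb; apply: eq_bigr => i _; rewrite ea eb. Qed.

Lemma TRI_ext a a' b b' d d' s x : (forall i, a i s x = a' i s x) ->
  (forall i, b i s x = b' i s x) -> (forall i, d i s x = d' i s x) ->
  TRI a b d s x = TRI a' b' d' s x.
Proof. exact: tri_ext. Qed.

Lemma TRI_assoc a b d e s x : S s -> TRI a (UP (CL b d)) e s x = TRI b (UP (CL a d)) e s x.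
Proof.
move=> Ss; rewrite /TRI (tri23 (c23 _ Ss)) [RHS](tri23 (c23 _ Ss)).
exact: (tri_assoc (c12 x Ss) _ _ _ _ (cassoc x Ss)).
Qed.

Section TwoArguments.
Variables xi ze : 'rV[R]_n -> R -> 'rV[R]_N.
Hypotheses (sxi : smooth_family S xi) (sze : smooth_family S ze).
Variables (k : 'I_n) (r1 r2 : R).

Let k_ : 'I_(n + 1) := lshift 1 k.
Notation u' := (D_ x_ (crd p)).
Notation v := (D_ k_ (crd p)).
Hypothesis zu : z0 u'.

(* the components of (r1 L01 + r2 L10) q *)
Definition WF (q : 'rV[R]_n -> R -> 'rV[R]_N) : fam := fun i s x =>
  r1 * UP (CL (UP (phi q)) u') i s x + r2 * UP (D_ x_ (crd q)) i s x.

Definition TT (q r : 'rV[R]_n -> R -> 'rV[R]_N) (w : fam) : 'rV[R]_n -> R -> R := fun s x =>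
  TRI (UP (D_ x_ (crd r))) (UP (phi q)) w s x - TRI (UP (D_ x_ (crd q))) (UP (phi r)) w s x.

(* the primitive of the exact terms in the first variation *)
Definition BB : 'rV[R]_n -> R -> R := fun s x =>
  r1 * (TRI (UP (crd xi)) (UP (phi ze)) v s x - TRI (UP (crd ze)) (UP (phi xi)) v s x
        + DOT (phi xi) (D_ k_ (UP (phi ze))) s x)
  + r2 * DOT (crd xi) (UP (D_ k_ (crd ze))) s x.

Lemma DOT_UPCL a b d s x : S s -> DOT a (UP (CL b d)) s x = TRI (UP a) b d s x.
Proof. by move=> Ss; rewrite DOT_UP DOT_CL /TRI (tri12 (c12 _ Ss)). Qed.

Lemma DOT_WF a q s x : S s -> DOT a (WF q) s x =
  r1 * TRI (UP a) (UP (phi q)) u' s x + r2 * DOT a (UP (D_ x_ (crd q))) s x.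
Proof.
move=> Ss; rewrite -DOT_UPCL // /DOT !big_distrr -big_split; apply: eq_bigr => i _ /=.
by rewrite /WF; ring.
Qed.

(** Two terms have to be transformed: v_x, from the variation of u_x, and the variation of [phi ze],
    which is nonlocal in v. The former is integrated by parts directly. The latter is paired with
    c(xi, u_x), the x-derivative of [phi xi], so that integration by parts replaces it by the
    variation of c(ze, u_x), which is local. *)
Lemma variation_identity s x : S s ->
  DD k_ (DOT (crd xi) (WF ze)) s x =
  DOT (D_ k_ (crd xi)) (WF ze) s x - DOT (D_ k_ (crd ze)) (WF xi) s x
  + r1 * TT xi ze v s x + DD x_ BB s x.
Proof.
move=> Ss.
have sx : smf (crd xi) := sxi.
have sz : smf (crd ze) := sze.
have su : smf u' by exact: smf_D.
have sv : smf v by exact: smf_D.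
have sfx : smf (UP (phi xi)) by apply: sm_UP; exact: sm_phi.
have sfz : smf (UP (phi ze)) by apply: sm_UP; exact: sm_phi.
have sA : smf (UP (crd xi)) by exact: sm_UP.
have sZ : smf (UP (crd ze)) by exact: sm_UP.
have Dku i t y : S t -> D_ k_ u' i t y = D_ x_ v i t y.
  by move=> St; apply: (DD_comm _ _ _ oS _ St); exact: sp.
have Dfx i t y : S t -> D_ x_ (UP (phi xi)) i t y = UP (CL (UP (crd xi)) u') i t y.
  move=> St; rewrite {1}/D_ (DD_UP _ _ _ (sm_phi sxi zu) St) /UP /up.
  by apply: eq_bigr => j _; rewrite (D_phi sxi zu).
have Dfz i t y : S t -> D_ x_ (UP (phi ze)) i t y = UP (CL (UP (crd ze)) u') i t y.
  move=> St; rewrite {1}/D_ (DD_UP _ _ _ (sm_phi sze zu) St) /UP /up.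
  by apply: eq_bigr => j _; rewrite (D_phi sze zu).
have E0 : DD k_ (DOT (crd xi) (WF ze)) s x =
   r1 * DD k_ (TRI (UP (crd xi)) (UP (phi ze)) u') s x
   + r2 * DD k_ (DOT (crd xi) (UP (D_ x_ (crd ze)))) s x.
  rewrite (DD_eq _ _ oS Ss (fun t y St => DOT_WF (crd xi) ze y St)).
  have s1 : sm S (TRI (UP (crd xi)) (UP (phi ze)) u') by exact: sm_TRI.
  have s2 : sm S (DOT (crd xi) (UP (D_ x_ (crd ze)))).
    by apply: sm_DOT => //; apply: sm_UP; exact: smf_D.
  have s3 : sm S (fun s x => r1 * TRI (UP (crd xi)) (UP (phi ze)) u' s x).
    by apply: smM => //; exact: sm_cst.
  have s4 : sm S (fun s x => r2 * DOT (crd xi) (UP (D_ x_ (crd ze))) s x).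
    by apply: smM => //; exact: sm_cst.
  by rewrite (DDD _ _ s3 s4 Ss) (DDZ _ _ _ s1 Ss) (DDZ _ _ _ s2 Ss).
have sB1 : sm S (TRI (UP (crd xi)) (UP (phi ze)) v) by exact: sm_TRI.
have sB2 : sm S (TRI (UP (crd ze)) (UP (phi xi)) v) by exact: sm_TRI.
have sB3 : sm S (DOT (phi xi) (D_ k_ (UP (phi ze)))).
  by apply: sm_DOT; [exact: sm_phi | exact: smf_D].
have sB4 : sm S (DOT (crd xi) (UP (D_ k_ (crd ze)))).
  by apply: sm_DOT => //; apply: sm_UP; exact: smf_D.
have EB : DD x_ BB s x =
   r1 * (DD x_ (TRI (UP (crd xi)) (UP (phi ze)) v) s x - DD x_ (TRI (UP (crd ze)) (UP (phi xi)) v) s x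
     + DD x_ (DOT (phi xi) (D_ k_ (UP (phi ze)))) s x)
   + r2 * DD x_ (DOT (crd xi) (UP (D_ k_ (crd ze)))) s x.
  rewrite /BB.
  move: sB1 sB2 sB3 sB4.
  move: (TRI (UP (crd xi)) (UP (phi ze)) v) (TRI (UP (crd ze)) (UP (phi xi)) v).
  move: (DOT (phi xi) (D_ k_ (UP (phi ze)))) (DOT (crd xi) (UP (D_ k_ (crd ze)))).
  move=> F3 F4 F1 F2 s1 s2 s3 s4.
  have sN : sm S (fun s x => - F2 s x) by exact: smN.
  have s12 : sm S (fun s x => F1 s x - F2 s x) by exact: (smD oS s1 sN).
  have s123 : sm S (fun s x => F1 s x - F2 s x + F3 s x) by exact: (smD oS s12 s3).
  have s5 : sm S (fun s x => r1 * (F1 s x - F2 s x + F3 s x)) by apply: smM => //; exact: sm_cst.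
  have s6 : sm S (fun s x => r2 * F4 s x) by apply: smM => //; exact: sm_cst.
  rewrite (DDD x_ x s5 s6 Ss) (DDZ r1 x_ x s123 Ss) (DDZ r2 x_ x s4 Ss).
  by rewrite (DDD x_ x s12 s3 Ss) (DDD x_ x s1 sN Ss) (DDN x_ x s2 Ss).
have h1 := DD_TRI k_ x sA sfz su Ss.
have h2 := DD_TRI x_ x sA sfz sv Ss.
have h3 := DD_TRI x_ x sZ sfx sv Ss.
have h6 := DD_TRI k_ x sZ sfx su Ss.
have h7 : DD k_ (TRI (UP (crd ze)) (UP (phi xi)) u') s x =
   DOT (D_ k_ (UP (phi xi))) (CL (UP (crd ze)) u') s x
   + DOT (UP (phi xi)) (D_ k_ (CL (UP (crd ze)) u')) s x.
  rewrite -(DD_DOT k_ x sfx (sm_CL sZ su) Ss); apply: (DD_eq _ _ oS Ss) => t y _.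
  by rewrite DOT_CL.
have h8 := DOT_CL (UP (crd ze)) (D_ k_ (UP (phi xi))) u' s x.
(* Integration by parts of the nonlocal term: differentiated in x, the variation of [phi ze] becomes
   the variation of c(ze, u_x). *)
have h9 : DD x_ (DOT (phi xi) (D_ k_ (UP (phi ze)))) s x =
   TRI (UP (crd xi)) (D_ k_ (UP (phi ze))) u' s x
   + DOT (UP (phi xi)) (D_ k_ (CL (UP (crd ze)) u')) s x.
  rewrite (DD_DOT x_ x (sm_phi sxi zu) (smf_D k_ sfz) Ss); congr (_ + _).
    rewrite -DOT_CL DOTC; apply: DOT_ext => // i; exact: (D_phi sxi zu).
  rewrite -DOT_UP; apply: DOT_ext => // i.
  rewrite {1}/D_ (DD_comm _ _ _ oS (sfz i) Ss) (DD_eq _ _ oS Ss (Dfz i)).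
  by rewrite (DD_UP k_ i x (sm_CL sZ su) Ss).
(* With the product of [tri_assoc] the two sides are c(xi, ze.u_x, v) and c(ze, xi.u_x, v); this is
   where the first variation uses associativity. *)
have h10 : TRI (UP (crd xi)) (D_ x_ (UP (phi ze))) v s x = TRI (UP (crd ze)) (D_ x_ (UP (phi xi))) v s x.
  rewrite (TRI_ext (b' := UP (CL (UP (crd ze)) u')) (fun=> erefl) (fun i => Dfz i s x Ss) (fun=> erefl)).
  rewrite [RHS](TRI_ext (b' := UP (CL (UP (crd xi)) u')) (fun=> erefl) (fun i => Dfx i s x Ss) (fun=> erefl)).
  exact: TRI_assoc.
have h4 a b : TRI a b (D_ k_ u') s x = TRI a b (D_ x_ v) s x.
  exact: (TRI_ext (fun=> erefl) (fun=> erefl) (fun i => Dku i s x Ss)).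
have h5 a b : C4 v a b u' s x = C4 u' a b v s x by exact: C4_swap.
have DU (j : 'I_(n + 1)) q i (sq : smooth_family S q) : D_ j (UP (crd q)) i s x = UP (D_ j (crd q)) i s x.
  exact: (DD_UP j i x (sq : smf (crd q)) Ss).
have g1 := DD_DOT k_ x sx (sm_UP (smf_D x_ sz)) Ss.
have g2 := DD_DOT x_ x sx (sm_UP (smf_D k_ sz)) Ss.
have g3 : DOT (crd xi) (D_ k_ (UP (D_ x_ (crd ze)))) s x = DOT (crd xi) (D_ x_ (UP (D_ k_ (crd ze)))) s x.
  have e i : D_ k_ (UP (D_ x_ (crd ze))) i s x = D_ x_ (UP (D_ k_ (crd ze))) i s x.
    have e1 := DD_UP k_ i x (smf_D x_ sz) Ss.
    have e2 := DD_UP x_ i x (smf_D k_ sz) Ss.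
    rewrite /D_ in e1 e2 *; rewrite e1 e2; apply: eq_bigr => j _.
    by rewrite (DD_comm k_ x_ x oS (sz j) Ss).
  exact: (DOT_ext (fun=> erefl) e).
have g4 : DOT (D_ x_ (crd xi)) (UP (D_ k_ (crd ze))) s x = DOT (D_ k_ (crd ze)) (UP (D_ x_ (crd xi))) s x.
  by rewrite DOT_UP DOTC.
have t1 a b q (sq : smooth_family S q) j : TRI (D_ j (UP (crd q))) a b s x = TRI (UP (D_ j (crd q))) a b s x.
  exact: (TRI_ext (fun i => DU j q i sq) (fun=> erefl) (fun=> erefl)).
have hX := bookkeeping h1 h2 h3 h6 h7 h8 h9 h10 (h4 _ _) (h4 _ _) (h5 _ _) (h5 _ _)
  (t1 (UP (phi ze)) u' xi sxi k_) (t1 (UP (phi xi)) u' ze sze k_)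
  (t1 (UP (phi xi)) v ze sze x_) (t1 (UP (phi ze)) v xi sxi x_).
exact: (bookkeeping2 E0 (DOT_WF (D_ k_ (crd xi)) ze x Ss) (DOT_WF (D_ k_ (crd ze)) xi x Ss) EB hX g1 g2 g3 g4).
Qed.

End TwoArguments.

End FirstVariation.

(** * Variations of fields and Hessians *)

Section AntiEnd.
Context {R : realType} {n : nat}.
Implicit Types (S : set 'rV[R]_n) (F G : 'rV[R]_n -> R -> R).

(** The boundary behaviour of [ddx_inv]: constant near each end, with opposite values, locally
    uniformly in s. A product of two such families satisfies [cst_end], so its x-derivative
    integrates to 0. *)
Definition anti_end S F : Prop := forall s, S s -> exists A : R, \forall t \near s,
  forall x y, A <= x -> A <= y -> F t x = F t y /\ F t (- x) = - F t y.

Lemma anti_endD S F G : anti_end S F -> anti_end S G -> anti_end S (fun s x => F s x + G s x).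
Proof.
move=> zF zG s Ss; have [A H] := zF s Ss; have [B H'] := zG s Ss.
exists (Num.max A B); apply: filterS2 H H' => t H H' x y.
rewrite !ge_max => /andP[Ax Bx] /andP[Ay By].
have [e1 e2] := H x y Ax Ay; have [e3 e4] := H' x y Bx By.
by rewrite e1 e2 e3 e4 opprD.
Qed.

Lemma anti_endZ S (c : R) F : anti_end S F -> anti_end S (fun s x => c * F s x).
Proof.
move=> zF s Ss; have [A H] := zF s Ss; exists A; apply: filterS H => t H x y Ax Ay.
by have [e1 e2] := H x y Ax Ay; rewrite e1 e2 mulrN.
Qed.

Lemma anti_end0 S : anti_end S (fun _ _ => 0).
Proof. by move=> s _; exists 0; near=> t; move=> x y _ _; rewrite oppr0. Unshelve. all: by end_near. Qed.

Lemma anti_end_sum S (I : Type) (r : seq I) (P : pred I) (F : I -> 'rV[R]_n -> R -> R) :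
  (forall i, anti_end S (F i)) -> anti_end S (fun s x => \sum_(i <- r | P i) F i s x).
Proof.
move=> H; elim: r => [|i r IH].
  by under eq_fun do under eq_fun do rewrite big_nil; exact: anti_end0.
case Pi: (P i); last by under eq_fun do under eq_fun do rewrite big_cons Pi.
by under eq_fun do under eq_fun do rewrite big_cons Pi; exact: anti_endD.
Qed.

Lemma anti_endM S F G : anti_end S F -> anti_end S G -> cst_end S (fun s x => F s x * G s x).
Proof.
move=> zF zG s Ss; have [A H] := zF s Ss; have [B H'] := zG s Ss.
exists (Num.max A B); apply: filterS2 H H' => t H H'.
suff E x : Num.max A B <= `|x| -> F t x * G t x = F t (Num.max A B) * G t (Num.max A B).
  by move=> x y /E -> /E ->.
rewrite ge_max => /andP[Ax Bx].
have [mA mB] : A <= Num.max A B /\ B <= Num.max A B by rewrite !le_max !lexx orbT.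
have [e1 e2] := H _ _ Ax mA; have [e3 e4] := H' _ _ Bx mB.
have [x0|x0] := leP 0 x; first by rewrite (ger0_norm x0) in e1 e3; rewrite e1 e3.
by rewrite (ltr0_norm x0) opprK in e2 e4; rewrite e2 e4 mulrNN.
Qed.

Lemma anti_end_dP S F k : open S -> sm S F -> anti_end S F -> anti_end S (dP k F).
Proof.
move=> oS sF zF s Ss.
have [|A [S' [A0 oS' S's SS H]]] := near_open oS Ss
  (P := fun A t => forall x y, A <= x -> A <= y -> F t x = F t y /\ F t (- x) = - F t y) _ (zF s Ss).
  by move=> A B t AB H x y Bx By; apply: H; [exact: le_trans Bx|exact: le_trans By].
exists A; have nS : \forall t \near s, S' t by exact: open_nbhs_nbhs.
apply: filterS nS => t S't x y Ax Ay; split.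
  by apply: (pd_eq oS') => // r S'r; case: (H r S'r x y Ax Ay).
rewrite dP_DD -(DDN _ _ sF (SS _ S't)) -dP_DD.
have -> : dP k F t (- x) = pd ord0 k (fun t => - F t y) t.
  by apply: (pd_eq oS') => // r S'r; case: (H r S'r x y Ax Ay).
by [].
Qed.

Lemma anti_end_ddx S F : open S -> sm S F -> supp0 S F -> anti_end S (fun s => ddx_inv (F s)).
Proof.
move=> oS sF zF s Ss; have [A H] := ddx_ends oS sF zF Ss; exists A.
apply: filterS H => t [H1 H2] x y Ax Ay; rewrite (H1 x Ax) (H1 y Ay) (H2 (- x)) ?lerN2 //.
by rewrite mulNr.
Qed.

End AntiEnd.

Section Variations.
Context {R : realType} {N : nat}.
Variables (U : set 'rV[R]_N) (u0 : 'rV[R]_N).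
Hypotheses (oU : open U) (Uu0 : U u0).

Lemma variation_cst_end n (S : set 'rV[R]_n) p i : smooth_variation U u0 S p ->
  cst_end S (crd p i).
Proof.
case=> oS sp SU zp s Ss; have [A H] := zp s Ss; exists A.
by apply: filterS H => t H x y Ax Ay; rewrite /crd !H.
Qed.

Lemma variation_supp0X n (S : set 'rV[R]_n) p i : smooth_variation U u0 S p ->
  supp0 S (DD (rshift n ord0) (crd p i)).
Proof.
move=> vp; case: (vp) => oS sp SU zp; rewrite -dX_DD.
by apply: (supp0_dX oS (sp i)); exact: variation_cst_end.
Qed.

Lemma variation_supp0P n (S : set 'rV[R]_n) p i k : smooth_variation U u0 S p ->
  supp0 S (DD (lshift 1 k) (crd p i)).
Proof.
move=> vp; case: (vp) => oS sp SU zp; rewrite -dP_DD.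
have sN : sm S (fun _ _ => - u0 ord0 i) by exact: sm_cst.
(* The field itself does not vanish near infinity, but p - u0 does, and it has the same parameter
   derivatives. *)
apply: (supp0_eq oS (F := dP k (fun s x => crd p i s x + - u0 ord0 i))).
  move=> s x Ss; rewrite !dP_DD (DDD _ _ (sp i : sm S (crd p i)) sN Ss).
  by rewrite DD_cst addr0.
apply: supp0_dP => // s Ss; have [A H] := zp s Ss; exists A.
by apply: filterS H => t H x Ax; rewrite /crd H // subrr.
Qed.

Lemma pt_smooth n (S : set 'rV[R]_n) (e : R) k : smooth_on S (fun s => pt s e ord0 k).
Proof.
case: (split_ordP k) => l ->.
  by under eq_fun do rewrite ptl; exact: smooth_coord.
by rewrite !ord1; under eq_fun do rewrite ptr; exact: smooth_cst.
Qed.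

Section Extension.
Variables (n : nat) (S : set 'rV[R]_n) (p : 'rV[R]_n -> @field R N) (w : 'rV[R]_n -> R -> 'rV[R]_N).
Hypotheses (vp : smooth_variation U u0 S p) (sw : smooth_family S w).
Hypothesis zw : forall i, supp0 S (crd w i).

(** Adds one parameter e that moves the fields in the direction w. Second variations of a functional
    are mixed derivatives along the enlarged family. *)
Definition ext (z : 'rV[R]_(n + 1)) : @field R N := fun x =>
  p (lsubmx z) x + rsubmx z ord0 ord0 *: w (lsubmx z) x.

(** The values of e for which the moved field stays in U depend on s; the interior provides the open
    set of parameters that a variation requires. *)
Definition ext_dom : set 'rV[R]_(n + 1) :=
  interior [set z | cyl S z /\ forall x, U (ext z x)].

Lemma ext_pt s e : ext (pt s e) = fun x => p s x + e *: w s x.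
Proof. by rewrite /ext row_mxKl row_mxKr mxE eqxx. Qed.

Lemma ext_pt0 s : ext (pt s 0) = p s.
Proof. by rewrite ext_pt; apply/funext => x; rewrite scale0r addr0. Qed.

Lemma ext_dom_cyl : ext_dom `<=` cyl S.
Proof. by move=> z /interior_subset []. Qed.

Lemma sm_ext i : sm (cyl S) (crd ext i).
Proof.
case: vp => oS sp _ _; have oC := open_cyl oS.
have l1 k : smooth_on (cyl S) (fun z : 'rV[R]_(n + 1) => lsubmx z ord0 k).
  by under eq_fun do rewrite mxE; exact: smooth_coord.
apply: (sm_eq (F := fun z x => crd p i (lsubmx z) x + rsubmx z ord0 ord0 * crd w i (lsubmx z) x) oC).
  by move=> z x _; rewrite /crd !mxE.
apply: smD => //; first exact: (sm_comp_pt oC (sp i)).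
apply: smM => //; last exact: (sm_comp_pt oC (sw i)).
by apply: smooth_sm => //; under eq_fun do rewrite mxE; exact: smooth_coord.
Qed.

Lemma near_lsubmx s (P : set 'rV[R]_n) : (\forall t \near s, P t) ->
  forall e, \forall z \near pt s e, P (lsubmx z).
Proof.
move=> nP e; have : {for pt s e, continuous (@lsubmx R 1 n 1)}.
  apply: differentiable_continuous; apply: differentiable_mx => i j.
  by under eq_fun do rewrite mxE; exact: differentiable_coord.
by move=> /(_ P); rewrite row_mxKl; apply.
Qed.

Lemma near_pt_at s e (P : set 'rV[R]_(n + 1)) : (\forall z \near pt s e, P z) ->
  \forall t \near s, P (pt t e).
Proof.
move=> /near_pt [[A B]] /= [Ae Bs] AB.
by apply: filterS Bs => t Bt; apply: (AB (e, t)); split => //; exact: nbhs_singleton.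
Qed.

Lemma ext_supp s : S s -> exists A, \forall t \near s, forall e x, A <= `|x| -> ext (pt t e) x = u0.
Proof.
case: vp => oS sp SU zp Ss; have [A HA] := zp s Ss.
have zw' i := zw i Ss.
have [B HB] : exists B, \forall t \near s, forall i x, B <= `|x| -> crd w i t x = 0.
  pose B i := sval (cid (zw' i)).
  exists (\big[Num.max/0]_i B i).
  have nB : \forall t \near s, forall i : 'I_N, forall x, B i <= `|x| -> crd w i t x = 0.
    apply: (@filter_forall _ _ (fun i t => forall x, B i <= `|x| -> crd w i t x = 0) (nbhs s) _).
    by move=> i; exact: (svalP (cid (zw' i))).
  apply: filterS nB => t H i x Bx; apply: H; apply: le_trans Bx.
  exact: (le_bigmax _ B i).
exists (Num.max A B); apply: filterS2 HA HB => t H1 H2 e x.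
rewrite ge_max => /andP[Ax Bx]; rewrite ext_pt H1 //.
have -> : w t x = 0 by apply/rowP => i; rewrite mxE -[LHS]/(crd w i t x) H2.
by rewrite scaler0 addr0.
Qed.

(** Outside a bounded interval the moved fields equal u0, for every e; on the interval they stay in
    the open set U for small displacements by compactness. *)
Lemma ext_dom_pt0 s : S s -> ext_dom (pt s 0).
Proof.
move=> Ss; case: (vp) => oS sp SU zp.
have [A H] := ext_supp Ss.
have nS : \forall t \near s, S t by exact: open_nbhs_nbhs.
have nSH : \forall t \near s, S t /\ forall e x, A <= `|x| -> ext (pt t e) x = u0.
  exact: filterI.
have nA := near_lsubmx nSH 0.
have cpt : compact (`[- A, A] : set R) := @segment_compact R (- A) A.
have cov : forall x : R, `[- A, A]%classic x ->
    \forall y \near x & z \near pt s 0, U (ext z y).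
  move=> x _.
  have c : {for pt (pt s 0) x, continuous (fun w => \row_i unc (crd ext i) w : 'rV[R]_N)}.
    apply: differentiable_continuous; apply: differentiable_mx => a i.
    under eq_fun do rewrite mxE; apply: (sm_diff _ (sm_ext i)).
    by rewrite cyl_pt.
  have Ex z y : \row_i unc (crd ext i) (pt z y) = ext z y.
    by apply/rowP => i; rewrite mxE unc_pt.
  have := c U; rewrite /= Ex ext_pt0 => /(_ (open_nbhs_nbhs (conj oU (SU s x Ss)))) /near_pt.
  by move=> [[P Q]] /= PQ HPQ; exists (P, Q) => // -[y z] PQyz; rewrite -Ex; exact: HPQ.
have := (compact_near_coveringP (`[- A, A] : set R)).1 cpt _ (nbhs (pt s 0))
  (fun z y => U (ext z y)) _ cov.
move=> /(_ (nbhs_filter _)) nC; change (nbhs (pt s 0) [set z | cyl S z /\ forall x, U (ext z x)]).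
apply: filterS2 nA nC => z [Sz Hz] Hc; split => // x.
have [Ax|xA] := leP A `|x|.
  by rewrite -(ptK z) Hz.
by apply: Hc => /=; rewrite in_itv /= -ler_norml ltW.
Qed.

Lemma variation_ext : smooth_variation U u0 ext_dom ext.
Proof.
have oE : open ext_dom by exact: open_interior.
split => //.
- by move=> i; exact: (sm_subset (F := crd ext i) ext_dom_cyl (sm_ext i)).
- by move=> z x /interior_subset [_]; apply.
- move=> z /ext_dom_cyl Sz; have [A H] := ext_supp Sz; exists A.
  have := near_lsubmx H (rsubmx z ord0 ord0); rewrite ptK; apply: filterS => z' H' x Ax.
  by rewrite -(ptK z') H'.
Qed.

Lemma dP_ext_r i z x : cyl S z -> dP (rshift n ord0) (crd ext i) z x = crd w i (lsubmx z) x.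
Proof.
move=> Sz; rewrite /dP /pd -{1}(ptK z).
move: (lsubmx z) (rsubmx z ord0 ord0) => s e.
have [-> _] := @derive_transfer R _ _ _ (fun t => crd ext i t x)
  (fun e : R => crd p i s x + e * crd w i s x) (pt s e) (delta_mx ord0 (rshift n ord0)) e 1
  (fun h => ltac:(by rewrite pt_dX /crd ext_pt !mxE [_%:A]mulr1)).
by rewrite derive_val add0r mul1r scaler0 add0r [_%:A]mulr1.
Qed.

End Extension.

End Variations.

(** * Second variations of functionals *)

Section Hessian.
Context {R : realType} {N : nat}.
Variables (U : set 'rV[R]_N) (u0 : 'rV[R]_N).
Hypotheses (oU : open U) (Uu0 : U u0).
Notation mu := (@lebesgue_measure R).

Lemma functional_family I dI n (S : set 'rV[R]_n) p : functional U u0 I dI ->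
  smooth_variation U u0 S p ->
  smooth_family S (fun s => dI (p s)) /\ forall i, cst_end S (crd (fun s => dI (p s)) i).
Proof.
move=> fI /fI [_ sdI cdI _]; split => // i s Ss; have [A H] := cdI s Ss; exists A.
by apply: filterS H => t H x y Ax Ay; rewrite /crd (H x y).
Qed.

(** The Hessian of the functional at u applied to w: the derivative of its variational derivative
    along w. *)
Definition var_grad (dI : @field R N -> R -> 'rV[R]_N) (u w : @field R N) : R -> 'rV[R]_N :=
  fun x => \row_r derive1 (fun e : R => dI (fun y => u y + e *: w y) x ord0 r) 0.

Lemma cyl_lsub_smooth n (S : set 'rV[R]_(n + 1)) k :
  smooth_on S (fun z : 'rV[R]_(n + 1) => lsubmx z ord0 k).
Proof. by under eq_fun do rewrite mxE; exact: smooth_coord. Qed.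

Lemma sm_lsubmx n (S : set 'rV[R]_n) (E : set 'rV[R]_(n + 1)) F : open E -> E `<=` cyl S ->
  sm S F -> sm E (fun z => F (lsubmx z)).
Proof. by move=> oE ES sF; apply: (sm_comp_pt oE sF) => // k; exact: cyl_lsub_smooth. Qed.

Lemma supp0_lsubmx n (S : set 'rV[R]_n) (E : set 'rV[R]_(n + 1)) F : E `<=` cyl S ->
  supp0 S F -> supp0 E (fun z => F (lsubmx z)).
Proof.
move=> ES zF z /ES Sz; have [A H] := zF _ Sz; exists A.
have := near_lsubmx H (rsubmx z ord0 ord0); by rewrite ptK.
Qed.

Section Extend.
Variables (n : nat) (S : set 'rV[R]_n) (p : 'rV[R]_n -> @field R N) (w : 'rV[R]_n -> R -> 'rV[R]_N).
Hypotheses (vp : smooth_variation U u0 S p) (sw : smooth_family S w).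
Hypothesis zw : forall i, supp0 S (crd w i).
Variables (I : @field R N -> R) (dI : @field R N -> R -> 'rV[R]_N).
Hypothesis fI : functional U u0 I dI.

Let E := ext_dom U S p w.
Let vE : smooth_variation U u0 E (ext p w) := variation_ext vp sw zw.
Let X z := dI (ext p w z).

Lemma var_gradE s x r : var_grad dI (p s) (w s) x ord0 r = dP (rshift n ord0) (crd X r) (pt s 0) x.
Proof.
rewrite mxE derive1E /dP /pd.
have [-> _] // := @derive_transfer R _ _ _ (fun e : R => dI (fun y => p s y + e *: w s y) x ord0 r)
  (fun z => crd X r z x) 0 1 (pt s 0) (delta_mx ord0 (rshift n ord0))
  (fun h => ltac:(by rewrite pt_dX /crd /X ext_pt [_%:A]mulr1)).
Qed.

Lemma dP_X_l s x r k : S s ->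
  dP (lshift 1 k) (crd X r) (pt s 0) x = dP k (crd (fun s => dI (p s)) r) s x.
Proof.
move=> Ss; rewrite /dP /pd.
have [-> _] // := @derive_transfer R _ _ _ (fun z => crd X r z x)
  (fun s => crd (fun s => dI (p s)) r s x) (pt s 0) (delta_mx ord0 (lshift 1 k)) s (delta_mx ord0 k)
  (fun h => ltac:(by rewrite pt_dP /crd /X ext_pt0)).
Qed.

Lemma var_grad_family : smooth_family S (fun s => var_grad dI (p s) (w s)) /\
  forall i, cst_end S (crd (fun s => var_grad dI (p s) (w s)) i).
Proof.
have [oE _ _ _] := vE; have [oS _ _ _] := vp.
have [sX cX] := functional_family fI vE.
split=> i.
  change (sm S (crd (fun s => var_grad dI (p s) (w s)) i)).
  apply: (sm_eq (F := fun s => dP (rshift n ord0) (crd X i) (pt s 0)) oS).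
    by move=> s x _; rewrite /crd var_gradE.
  apply: (sm_comp_pt (h := fun s => pt s 0) oS (smP (rshift n ord0) (sX i : sm E (crd X i)))).
    by move=> s Ss; exact: (ext_dom_pt0 oU Uu0 vp sw zw Ss).
  by move=> k; exact: pt_smooth.
move=> s Ss; have := cst_end_dP (rshift n ord0) oE (cX i).
move=> /(_ (pt s 0) (ext_dom_pt0 oU Uu0 vp sw zw Ss)) [A H]; exists A.
have := near_pt_at H; apply: filterS => t Ht x y Ax Ay.
by rewrite /crd !var_gradE; exact: Ht.
Qed.

End Extend.

(** Symmetry of the mixed derivatives of I(p(s) + e w) at e = 0. The direction w is independent of
    s: otherwise the mixed derivative would also contain the derivative of w. *)
Lemma Hessian_symmetric n (S : set 'rV[R]_n) (p : 'rV[R]_n -> @field R N) (w : R -> 'rV[R]_N) I dI s k :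
  smooth_variation U u0 S p -> smooth_family S (fun=> w) -> (forall i, supp0 S (crd (fun=> w) i)) ->
  functional U u0 I dI -> S s ->
  \int[mu]_x \sum_i dP k (crd (fun s => dI (p s)) i) s x * w x ord0 i =
  \int[mu]_x \sum_i var_grad dI (p s) w x ord0 i * dP k (crd p i) s x.
Proof.
move=> vp sw zw fI Ss.
pose W := fun _ : 'rV[R]_n => w.
pose E := ext_dom U S p W; pose X z := dI (ext p W z).
have vE : smooth_variation U u0 E (ext p W) := variation_ext vp sw zw.
have [oE _ _ _] := vE; have [oS sp SU _] := vp.
have [sX cX] := functional_family fI vE.
have [sJ _ _ dJ] := fI _ _ _ vE.
have Es : E (pt s 0) := ext_dom_pt0 oU Uu0 vp sw zw Ss.
have EC : E `<=` cyl S by exact: ext_dom_cyl.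
pose J z := I (ext p W z).
have := @Schwarz R _ _ E J ord0 (lshift 1 k) ord0 (rshift n ord0) (pt s 0) oE sJ Es.
pose P i (z : 'rV[R]_(n + 1)) := dP k (crd p i) (lsubmx z).
have dPx j i z x : E z -> dP (lshift 1 j) (crd (ext p W) i) z x = dP j (crd p i) (lsubmx z) x.
  move=> /EC; rewrite -{2}(ptK z) /cyl /=; move: (lsubmx z) (rsubmx z ord0 ord0) => t e St.
  have := dPD (F := crd p i) (G := fun _ _ => e * w x ord0 i) j x (sp i : sm S (crd p i)) (@sm_cst R n S _) St.
  rewrite [X in _ + X](_ : _ = 0) ?addr0 => [<-|]; last by rewrite /dP /pd derive_cst.
  rewrite /dP /pd.
  have [-> _] // := @derive_transfer R _ _ _ (fun z => crd (ext p W) i z x)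
    (fun t => crd p i t x + e * w x ord0 i) (pt t e) (delta_mx ord0 (lshift 1 j)) t (delta_mx ord0 j)
    (fun h => ltac:(by rewrite pt_dP /crd ext_pt !mxE)).
have eJ z : E z -> pd ord0 (rshift n ord0) J z = \int[mu]_x \sum_i crd X i z x * w x ord0 i.
  move=> Ez; rewrite (dJ _ _ Ez); apply: eq_Rintegral => x _; apply: eq_bigr => i _; congr (_ * _).
  by have := dP_ext_r p W i x (EC _ Ez).
have kJ z : E z -> pd ord0 (lshift 1 k) J z = \int[mu]_x \sum_i crd X i z x * P i z x.
  move=> Ez; rewrite (dJ _ _ Ez); apply: eq_Rintegral => x _; apply: eq_bigr => i _; congr (_ * _).
  exact (dPx k i z x Ez).
have sXi i : sm E (crd X i) := sX i.
have sWi i : sm E (fun _ x => w x ord0 i) := sm_lsubmx oE EC (sw i : sm S (fun _ x => w x ord0 i)).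
have zWi i : supp0 E (fun _ x => w x ord0 i) := supp0_lsubmx EC (zw i).
have sPi i : sm E (P i) := sm_lsubmx oE EC (smP k (sp i : sm S (crd p i))).
have zPi i : supp0 E (P i).
  by apply: (supp0_lsubmx EC); rewrite dP_DD; exact: variation_supp0P vp.
rewrite (pd_eq oE eJ Es) (pd_eq oE kJ Es).
have s1 i : sm E (fun z x => crd X i z x * w x ord0 i) by exact: smM.
have s2 i : sm E (fun z x => crd X i z x * P i z x) by exact: smM.
rewrite (pd_int _ oE (sm_sum _ _ oE s1)) //; last by apply: supp0_sum => i; apply: supp0Mr.
rewrite (pd_int _ oE (sm_sum _ _ oE s2)) //; last by apply: supp0_sum => i; apply: supp0Mr.
move=> e; transitivity (\int[mu]_x dP (lshift 1 k) (fun z x => \sum_i crd X i z x * w x ord0 i) (pt s 0) x).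
  apply: eq_Rintegral => x _; rewrite (dP_sum _ _ _ _ s1 Es); apply: eq_bigr => i _.
  rewrite (dPM _ _ (sXi i) (sWi i) Es) (dP_X_l p W dI x i k Ss).
  by rewrite [X in _ + _ * X](_ : _ = 0) ?mulr0 ?addr0// /dP /pd derive_cst.
rewrite e; apply: eq_Rintegral => x _; rewrite (dP_sum _ _ _ _ s2 Es); apply: eq_bigr => i _.
rewrite (dPM _ _ (sXi i) (sPi i) Es) -(var_gradE p W dI).
have -> : dP (rshift n ord0) (P i) (pt s 0) x = 0.
  rewrite /dP /pd.
  have [-> _] := @derive_transfer R _ _ _ (fun z => P i z x) (cst (dP k (crd p i) s x)) (pt s 0)
    (delta_mx ord0 (rshift n ord0)) 0 (1 : R) (fun h => ltac:(by rewrite pt_dX /P row_mxKl)).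
  by rewrite derive_cst.
by rewrite mulr0 addr0 /P row_mxKl.
Qed.

End Hessian.

(** * The Poisson bracket *)

Section PhaseSpace.
Context {R : realType}.

Lemma sm_derivable n (S : set 'rV[R]_n) (g : R -> R) :
  (forall k x, derivable (derive1n k g) x 1) -> sm S (fun=> g).
Proof.
move=> dg; apply/smoothP => k; elim: k g dg => [|k IH] g dg.
all: have df z : differentiable (unc (fun _ : 'rV[R]_n => g)) z.
1,3: have c : differentiable (fun z : 'rV[R]_(n + 1) => rsubmx z ord0 ord0) z.
1,3: by under eq_fun do rewrite mxE; exact: differentiable_coord.
1,2: apply: (@differentiable_comp _ _ _ _ (fun z : 'rV[R]_(n + 1) => rsubmx z ord0 ord0) g) => //.
1,2: by apply/derivable1_diffP; exact: (dg 0%N).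
  by split.
split => // i j; rewrite (ord1 i : i = ord0); case: (split_ordP j) => l ->.
  rewrite -unc_dP (_ : unc _ = fun=> 0); first exact: Ck_cst.
  by apply/funext => z; rewrite /unc /dP /pd derive_cst.
rewrite !ord1 -unc_dX; apply: IH => m x.
by rewrite -derive1Sn; exact: dg.
Qed.

Lemma derive1n_coord N (u : R -> 'rV[R]_N) i k :
  (forall k x, derivable (derive1n k u) x 1) ->
  derive1n k (fun x => u x ord0 i) = fun x => derive1n k u x ord0 i.
Proof.
move=> du; elim: k => [//|k IH]; rewrite derive1nS IH; apply/funext => x.
by rewrite derive1nS !derive1E (derive_mx (du k x)) mxE.
Qed.

(** A single field is a family that does not depend on its parameters; in this way results on
    variations apply at points of the phase space. *)
Lemma phase_space_variation N (U : set 'rV[R]_N) u0 u n (S : set 'rV[R]_n) : open S ->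
  phase_space U u0 u -> smooth_variation U u0 S (fun=> u).
Proof.
move=> oS [du [Uu [A uA]]]; split => //.
- move=> i; apply: (sm_derivable (g := fun x => u x ord0 i)) => k x.
  rewrite derive1n_coord //; exact: (derivable_mxP _ _ _).1.
- by move=> s _; exists A; near=> t.
Unshelve. all: by end_near. Qed.

End PhaseSpace.

Section Bracket.
Context {R : realType} {N : nat}.
Variables (U : set 'rV[R]_N) (u0 : 'rV[R]_N) (Phi : 'rV[R]_N -> R) (eta : 'M[R]_N).
Hypotheses (oU : open U) (Uu0 : U u0) (sPhi : smooth_on U Phi) (eta_sym : eta^T = eta).
Hypothesis assoc : associativity U eta Phi.
Variables r1 r2 : R.
Notation mu := (@lebesgue_measure R).

Definition Mop : @operator R N := fun u xi x => r1 *: L01 eta Phi u xi x + r2 *: L10 eta u xi x.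

Lemma cs_Z c (f : R -> R) : cs f -> cs (fun x => c * f x).
Proof.
move=> [cf [A fA]]; split; first by move=> x; exact: (cvgM (cvg_cst c) (cf x)).
by exists A => x /fA ->; rewrite mulr0.
Qed.

Lemma int_csZ c (f : R -> R) : cs f -> \int[mu]_x (c * f x) = c * \int[mu]_x f x.
Proof. by move=> cf; rewrite RintegralZl //; exact: cs_integrable. Qed.

Section OneVariation.
Variables (n : nat) (S : set 'rV[R]_n) (p : 'rV[R]_n -> @field R N).
Hypothesis vp : smooth_variation U u0 S p.

Let oS : open S. Proof. by case: vp. Qed.
Let sp : smooth_family S p. Proof. by case: vp. Qed.
Let SU s x : S s -> U (p s x). Proof. by case: vp => _ _ H _; exact: H. Qed.
Let SU' : forall s x, S s -> U (p s x). Proof. exact: SU. Qed.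

Notation u' := (D_ (rshift n ord0) (crd p)).
Notation W := (WF Phi eta p r1 r2).
Notation UPP := (UP eta).
Notation phip := (phi Phi eta p).

Let zu : z0 S u'. Proof. by move=> i; exact: variation_supp0X vp. Qed.
Let su : smf S u'. Proof. exact: smf_D. Qed.

Lemma Mop_WF q s x i : smooth_family S q -> S s -> Mop (p s) (q s) x ord0 i = W q i s x.
Proof.
move=> sq Ss; rewrite mxE [X in X + _]mxE [X in _ + X]mxE.
by rewrite (L01E eta oU sPhi sp SU' q x i Ss) (L10E eta p sq x i Ss).
Qed.

Lemma z0_UP a : z0 S a -> z0 S (UPP a).
Proof. by move=> za i; apply: supp0_sum => j; apply: supp0Mr. Qed.

Section OneArgument.
Variable q : 'rV[R]_n -> R -> 'rV[R]_N.
Hypotheses (sq : smooth_family S q) (cq : forall i, cst_end S (crd q i)).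

Let sqc : smf S (crd q) := sq.

Lemma z0_Dx : z0 S (D_ (rshift n ord0) (crd q)).
Proof. by move=> i; rewrite /D_ -dX_DD; exact: (supp0_dX oS (sqc i)). Qed.

Lemma smf_UPphi : smf S (UPP (phip q)).
Proof. exact: (sm_UP eta oS (sm_phi sPhi eta_sym oS sp SU' sq zu)). Qed.

Lemma smf_UPDx : smf S (UPP (D_ (rshift n ord0) (crd q))).
Proof. exact: (sm_UP eta oS (smf_D _ sqc)). Qed.

Lemma smf_WF : smf S (W q).
Proof.
move=> i; rewrite /WF.
have s1 : smf S (UPP (CL Phi p (UPP (phip q)) u')).
  exact: (sm_UP eta oS (sm_CL sPhi oS sp SU' smf_UPphi su)).
have s2 := smf_UPDx.
by apply: (smD oS); apply: (smM oS) => //; exact: sm_cst.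
Qed.

Lemma z0_WF : z0 S (W q).
Proof.
move=> i; rewrite /WF; apply: supp0D; apply: supp0Mr.
  exact: (z0_UP (supp0_CL Phi zu _)).
exact: (z0_UP z0_Dx).
Qed.

Lemma Mop_family : smooth_family S (fun s => Mop (p s) (q s)).
Proof.
move=> i; change (sm S (crd (fun s => Mop (p s) (q s)) i)).
by apply: (sm_eq oS _ (smf_WF i)) => s x Ss; rewrite /crd Mop_WF.
Qed.

Lemma Mop_supp0 i : supp0 S (crd (fun s => Mop (p s) (q s)) i).
Proof. by apply: (supp0_eq oS _ (z0_WF i)) => s x Ss; rewrite /crd Mop_WF. Qed.

Lemma anti_UPphi i : anti_end S (UPP (phip q) i).
Proof.
apply: anti_end_sum => j; apply: anti_endZ; apply: (anti_end_ddx oS).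
  exact: (sm_arg sPhi eta_sym oS sp SU' sq).
exact: (supp0_arg Phi eta_sym oS sp q zu).
Qed.

Lemma anti_phi i : anti_end S (phip q i).
Proof.
apply: (anti_end_ddx oS); first exact: (sm_arg sPhi eta_sym oS sp SU' sq).
exact: (supp0_arg Phi eta_sym oS sp q zu).
Qed.

Lemma sm_DOT_WF a : smf S a -> sm S (DOT a (W q)).
Proof. by move=> sa; exact: (sm_DOT oS sa smf_WF). Qed.

Lemma supp0_DOT_WF a : supp0 S (DOT a (W q)).
Proof. by apply: supp0_sum => i; apply: supp0Mr; exact: z0_WF. Qed.

Lemma cs_DOT_WF a s : smf S a -> S s -> cs (DOT a (W q) s).
Proof. by move=> sa Ss; exact: (supp0_cs (sm_DOT_WF sa) (supp0_DOT_WF a) Ss). Qed.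

End OneArgument.

Section TwoArguments.
Variables xi ze : 'rV[R]_n -> R -> 'rV[R]_N.
Hypotheses (sxi : smooth_family S xi) (cxi : forall i, cst_end S (crd xi i)).
Hypotheses (sze : smooth_family S ze) (cze : forall i, cst_end S (crd ze i)).

Let sx : smf S (crd xi) := sxi.
Let sz : smf S (crd ze) := sze.

(** The sum of the two densities is the x-derivative of r1 times the eta-product of [phi xi] and
    [phi ze] plus r2 times that of xi and ze. The first product has equal end values because both
    factors change sign, the second because xi and ze are constant near infinity. *)
Lemma skew_DOT_WF s : S s ->
  \int[mu]_x DOT (crd xi) (W ze) s x = - \int[mu]_x DOT (crd ze) (W xi) s x.
Proof.
move=> Ss; apply/eqP; rewrite -addr_eq0; apply/eqP.
rewrite -int_csD; [|exact: cs_DOT_WF..].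
pose B s x := r1 * DOT (phip xi) (UPP (phip ze)) s x + r2 * DOT (crd xi) (UPP (crd ze)) s x.
have s1 : sm S (DOT (phip xi) (UPP (phip ze))).
  exact: (sm_DOT oS (sm_phi sPhi eta_sym oS sp SU' sxi zu) (smf_UPphi sze)).
have s2 : sm S (DOT (crd xi) (UPP (crd ze))) by exact: (sm_DOT oS sx (sm_UP eta oS sz)).
have s3 : sm S (fun s x => r1 * DOT (phip xi) (UPP (phip ze)) s x) by apply: (smM oS) => //; exact: sm_cst.
have s4 : sm S (fun s x => r2 * DOT (crd xi) (UPP (crd ze)) s x) by apply: (smM oS) => //; exact: sm_cst.
have sB : sm S B by exact: (smD oS s3 s4).
have cB : cst_end S B.
  have c1 : cst_end S (DOT (phip xi) (UPP (phip ze))).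
    apply: cst_end_sum => i; apply: (anti_endM (@anti_phi xi sxi i)); exact: anti_UPphi.
  have c2 : cst_end S (DOT (crd xi) (UPP (crd ze))).
    apply: cst_end_sum => i; apply: (cst_endM (cxi i)); apply: cst_end_sum => j.
    by apply: cst_endM => //; exact: cst_end_cst.
  by apply: cst_endD; apply: cst_endM => //; exact: cst_end_cst.
have [_ E] := int_dX sB cB Ss.
transitivity (\int[mu]_x dX B s x) => //; apply: eq_Rintegral => x _.
rewrite dX_DD (DDD _ _ s3 s4 Ss) (DDZ _ _ _ s1 Ss) (DDZ _ _ _ s2 Ss).
rewrite (DOT_WF oU sPhi eta_sym SU' r1 r2 (crd xi) ze x Ss).
rewrite (DOT_WF oU sPhi eta_sym SU' r1 r2 (crd ze) xi x Ss).
have e1 := DD_DOT oS (rshift n ord0) x (sm_phi sPhi eta_sym oS sp SU' sxi zu) (smf_UPphi sze) Ss.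
have e2 := DD_DOT oS (rshift n ord0) x sx (sm_UP eta oS sz) Ss.
have e3 : DOT (D_ (rshift n ord0) (phip xi)) (UPP (phip ze)) s x = TRI Phi p (UPP (crd xi)) (UPP (phip ze)) u' s x.
  rewrite DOTC -DOT_CL; apply: (DOT_ext (fun=> erefl)) => i.
  exact: (D_phi sPhi eta_sym oS sp SU' sxi zu i x Ss).
have e4 : DOT (phip xi) (D_ (rshift n ord0) (UPP (phip ze))) s x = TRI Phi p (UPP (crd ze)) (UPP (phip xi)) u' s x.
  transitivity (DOT (phip xi) (UPP (D_ (rshift n ord0) (phip ze))) s x).
    apply: (DOT_ext (fun=> erefl)) => i.
    exact: (DD_UP eta oS (rshift n ord0) i x (sm_phi sPhi eta_sym oS sp SU' sze zu) Ss).
  rewrite DOT_UP // -DOT_CL; apply: (DOT_ext (fun=> erefl)) => i.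
  exact: (D_phi sPhi eta_sym oS sp SU' sze zu i x Ss).
have e5 : DOT (D_ (rshift n ord0) (crd xi)) (UPP (crd ze)) s x = DOT (crd ze) (UPP (D_ (rshift n ord0) (crd xi))) s x.
  by rewrite DOT_UP // DOTC.
have e6 : DOT (crd xi) (D_ (rshift n ord0) (UPP (crd ze))) s x = DOT (crd xi) (UPP (D_ (rshift n ord0) (crd ze))) s x.
  apply: (DOT_ext (fun=> erefl)) => i.
  exact: (DD_UP eta oS (rshift n ord0) i x sz Ss).
rewrite e1 e2 e3 e4 e5 e6.
move: (TRI _ _ _ _ _ s x) (TRI _ _ _ _ _ s x) (DOT _ _ s x) (DOT _ _ s x) => *; ring.
Qed.

Variable k : 'I_n.
Notation v := (D_ (lshift 1 k) (crd p)).

Let zv : z0 S v. Proof. by move=> i; exact: variation_supp0P vp. Qed.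
Let sv : smf S v. Proof. exact: smf_D. Qed.

Notation Dk a := (D_ (lshift 1 k) a).
Notation B := (BB Phi eta p xi ze k r1 r2).

Let sf q (sq : smooth_family S q) : smf S (UPP (phip q)) := smf_UPphi sq.

Lemma sm_BB : sm S B.
Proof.
have s1 := sm_TRI sPhi oS sp SU' (sm_UP eta oS sx) (sf sze) sv.
have s2 := sm_TRI sPhi oS sp SU' (sm_UP eta oS sz) (sf sxi) sv.
have s3 : sm S (DOT (phip xi) (Dk (UPP (phip ze)))).
  exact: (sm_DOT oS (sm_phi sPhi eta_sym oS sp SU' sxi zu) (smf_D _ (sf sze))).
have s4 : sm S (DOT (crd xi) (UPP (Dk (crd ze)))).
  exact: (sm_DOT oS sx (sm_UP eta oS (smf_D _ sz))).
apply: (smD oS); apply: (smM oS); [exact: sm_cst| |exact: sm_cst|exact: s4].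
apply: (smD oS); [|exact: s3].
by apply: (smD oS s1); exact: (smN oS s2).
Qed.

Lemma supp0_TRI a b d : z0 S d -> supp0 S (TRI Phi p a b d).
Proof. by move=> zd; do 3 apply: supp0_sum => ?; apply: supp0Mr. Qed.

Lemma cst_end_BB : cst_end S B.
Proof.
have cN F : cst_end S F -> cst_end S (fun s x => - F s x).
  move=> cF s Ss; have [A H] := cF s Ss; exists A; apply: filterS H => t H x y Ax Ay.
  by rewrite (H x y).
have c4 : cst_end S (DOT (crd xi) (UPP (Dk (crd ze)))).
  apply: cst_end_sum => i; apply: (cst_endM (cxi i)); apply: cst_end_sum => j.
  apply: cst_endM; first exact: cst_end_cst.
  by rewrite /D_ -dP_DD; exact: cst_end_dP.
have c3 : cst_end S (DOT (phip xi) (Dk (UPP (phip ze)))).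
  apply: cst_end_sum => i; apply: (anti_endM (@anti_phi xi sxi i)).
  rewrite /D_ -dP_DD; apply: (anti_end_dP _ oS (sf sze i)); exact: anti_UPphi.
apply: cst_endD; apply: cst_endM; [exact: cst_end_cst| |exact: cst_end_cst|exact: c4].
apply: cst_endD; [|exact: c3].
apply: cst_endD; [|apply: cN]; apply: supp0_cst_end; exact: supp0_TRI.
Qed.

Lemma cs_TT s : S s -> cs (TT Phi eta p xi ze v s).
Proof.
move=> Ss.
have s1 := sm_TRI sPhi oS sp SU' (smf_UPDx sze) (sf sxi) sv.
have s2 := sm_TRI sPhi oS sp SU' (smf_UPDx sxi) (sf sze) sv.
have c1 := supp0_cs s1 (supp0_TRI _ _ zv) Ss.
have c2 := supp0_cs s2 (supp0_TRI _ _ zv) Ss.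
exact: (csD c1 (csN c2)).
Qed.

Lemma first_variation s : S s ->
  pd ord0 k (fun s => \int[mu]_x DOT (crd xi) (W ze) s x) s =
  \int[mu]_x DOT (Dk (crd xi)) (W ze) s x - \int[mu]_x DOT (Dk (crd ze)) (W xi) s x
  + r1 * \int[mu]_x TT Phi eta p xi ze v s x.
Proof.
move=> Ss; rewrite (pd_int k oS (sm_DOT_WF sze sx) (supp0_DOT_WF sze cze _) Ss).
rewrite dP_DD.
have [cB iB] := int_dX sm_BB cst_end_BB Ss.
have c1 := cs_DOT_WF sze cze (smf_D (lshift 1 k) sx) Ss.
have c2 := cs_DOT_WF sxi cxi (smf_D (lshift 1 k) sz) Ss.
have c3 := cs_TT Ss.
have c12 := csD c1 (csN c2).
have c3' := cs_Z r1 c3.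
have c123 := csD c12 c3'.
transitivity (\int[mu]_x (DOT (Dk (crd xi)) (W ze) s x - DOT (Dk (crd ze)) (W xi) s x
  + r1 * TT Phi eta p xi ze v s x + dX B s x)).
  apply: eq_Rintegral => x _; rewrite dX_DD.
  exact (variation_identity oU sPhi eta_sym assoc oS sp SU' sxi sze k r1 r2 zu x Ss).
by rewrite (int_csD c123 cB) iB addr0 (int_csD c12 c3') (int_csZ r1 c3) (int_csB c1 c2).
Qed.

End TwoArguments.

End OneVariation.

End Bracket.

(** Primed and unprimed letters are equal terms of opposite sign in the cyclic sum; they are paired
    by associativity for r1 and by the symmetry of c for r2. *)
Lemma cyclic_cancel (K : comPzRingType) (r1 r2 a1 a1' a2 a2' a3 a3' b1 b1' b2 b2' b3 b3' : K) :
  a1 = a1' -> a2 = a2' -> a3 = a3' -> b1 = b1' -> b2 = b2' -> b3 = b3' ->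
  r1 * a1 + r2 * b1 - (r1 * a2 + r2 * b2) + (r1 * a3 + r2 * b2' - (r1 * a1' + r2 * b3'))
  + (r1 * a2' + r2 * b3 - (r1 * a3' + r2 * b1')) = 0.
Proof. by move=> -> -> -> -> -> ->; ring. Qed.

Section Hamiltonian.
Context {R : realType} {N : nat}.
Variables (U : set 'rV[R]_N) (u0 : 'rV[R]_N) (Phi : 'rV[R]_N -> R) (eta : 'M[R]_N).
Hypotheses (oU : open U) (Uu0 : U u0) (sPhi : smooth_on U Phi) (eta_sym : eta^T = eta).
Hypothesis assoc : associativity U eta Phi.
Variables r1 r2 : R.
Notation mu := (@lebesgue_measure R).
Notation M := (Mop Phi eta r1 r2).

(* the part of delta{I,J} / delta u due to the dependence of L_{0,1} on u *)
Definition torsion (u : @field R N) (xi ze : R -> 'rV[R]_N) : R -> 'rV[R]_N := fun x =>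
  \row_r \sum_i \sum_j d3 Phi i j r (u x) *
   (L10 eta u ze x ord0 i * up eta (fun m => ddx_inv (L01_arg eta Phi u xi m) x) j
    - L10 eta u xi x ord0 i * up eta (fun m => ddx_inv (L01_arg eta Phi u ze m) x) j).

(** The minus sign arises when the variation of dJ, on which M acts in the density, is freed from M
    by integration by parts. *)
Definition dbracket (dI dJ : @field R N -> R -> 'rV[R]_N) (u : @field R N) : R -> 'rV[R]_N := fun x =>
  var_grad dI u (M u (dJ u)) x - var_grad dJ u (M u (dI u)) x + r1 *: torsion u (dI u) (dJ u) x.

Lemma dbracketE dI dJ u x i : dbracket dI dJ u x ord0 i =
  var_grad dI u (M u (dJ u)) x ord0 i - var_grad dJ u (M u (dI u)) x ord0 i + r1 * torsion u (dI u) (dJ u) x ord0 i.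
Proof.
have aux (A B C : 'rV[R]_N) r : (A - B + r *: C) ord0 i = A ord0 i - B ord0 i + r * C ord0 i.
  by rewrite !mxE.
exact (aux _ _ _ _).
Qed.

Section Variation.
Variables (n : nat) (S : set 'rV[R]_n) (p : 'rV[R]_n -> @field R N).
Hypothesis vp : smooth_variation U u0 S p.

Let oS : open S. Proof. by case: vp. Qed.
Let sp : smooth_family S p. Proof. by case: vp. Qed.
Let SU : forall s x, S s -> U (p s x). Proof. by case: vp. Qed.

Notation Dx a := (D_ (rshift n ord0) a).

Lemma torsionE xi ze s x r : smooth_family S xi -> smooth_family S ze -> S s ->
  torsion (p s) (xi s) (ze s) x ord0 r = \sum_i \sum_j d3 Phi i j r (p s x) *
   (UP eta (Dx (crd ze)) i s x * UP eta (phi Phi eta p xi) j s x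
    - UP eta (Dx (crd xi)) i s x * UP eta (phi Phi eta p ze) j s x).
Proof.
move=> sx sz Ss; rewrite mxE; apply: eq_bigr => i _; apply: eq_bigr => j _.
by rewrite (L10E eta p sz x i Ss) (L10E eta p sx x i Ss).
Qed.

Lemma TTE xi ze (w : 'I_N -> 'rV[R]_n -> R -> R) s x : smooth_family S xi -> smooth_family S ze -> S s ->
  TT Phi eta p xi ze w s x = \sum_r torsion (p s) (xi s) (ze s) x ord0 r * w r s x.
Proof.
move=> sx sz Ss.
have aux (c a b a' b' d : R) : c * a * b * d - c * a' * b' * d = c * (a * b - a' * b') * d by ring.
under eq_bigr do rewrite (torsionE x _ sx sz Ss) big_distrl /=.
rewrite exchange_big /TT /TRI /tri -sumrB; apply: eq_bigr => i _.
under eq_bigr do rewrite big_distrl /=.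
rewrite [RHS]exchange_big -sumrB; apply: eq_bigr => j _; rewrite -sumrB; apply: eq_bigr => r _.
exact (aux _ _ _ _ _ _).
Qed.

Lemma torsion_family xi ze : smooth_family S xi -> (forall i, cst_end S (crd xi i)) ->
  smooth_family S ze -> (forall i, cst_end S (crd ze i)) ->
  smooth_family S (fun s => torsion (p s) (xi s) (ze s)) /\
  forall i, supp0 S (crd (fun s => torsion (p s) (xi s) (ze s)) i).
Proof.
move=> sx cx sz cz.
have sax := smf_UPphi sPhi eta_sym vp sx.
have saz := smf_UPphi sPhi eta_sym vp sz.
have sbx := smf_UPDx eta vp sx.
have sbz := smf_UPDx eta vp sz.
have zbx := z0_UP eta (z0_Dx vp sx cx).
have zbz := z0_UP eta (z0_Dx vp sz cz).
split=> r.
  change (sm S (crd (fun s => torsion (p s) (xi s) (ze s)) r)).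
  apply: (sm_eq oS (fun s x Ss => esym (torsionE x r sx sz Ss))).
  apply: (sm_sum _ _ oS) => i; apply: (sm_sum _ _ oS) => j; apply: (smM oS).
    exact: (smC oS (smooth_d3 sPhi i j r) (famP sp) SU).
  by apply: (smD oS); [|apply: (smN oS)]; apply: (smM oS).
apply: (supp0_eq oS (fun s x Ss => esym (torsionE x r sx sz Ss))).
apply: supp0_sum => i; apply: supp0_sum => j; apply: supp0Mr; apply: supp0D; first exact: supp0Ml.
have := @supp0Ml R n S (UP eta (Dx (crd xi)) i) (fun s x => - UP eta (phi Phi eta p ze) j s x) (zbx i).
by under eq_fun do under eq_fun do rewrite mulrN.
Qed.

Section HessianTerm.
Variables (I : @field R N -> R) (dI : @field R N -> R -> 'rV[R]_N).
Hypothesis (fI : functional U u0 I dI).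
Variable ze : 'rV[R]_n -> R -> 'rV[R]_N.
Hypotheses (sze : smooth_family S ze) (cze : forall i, cst_end S (crd ze i)).

Let xi s := dI (p s).

(** The variation of dI is the Hessian applied to the variation of p. Its symmetry transfers it to
    the direction [M (p s) (ze s)], frozen at s, and leaves the variation of p as a bare factor, as
    the defining formula of a variational derivative requires. *)
Lemma Hessian_term s k : S s ->
  \int[mu]_x DOT (D_ (lshift 1 k) (crd xi)) (WF Phi eta p r1 r2 ze) s x =
  \int[mu]_x \sum_i var_grad dI (p s) (M (p s) (ze s)) x ord0 i * dP k (crd p i) s x.
Proof.
move=> Ss; pose w := M (p s) (ze s).
have sM := Mop_family oU sPhi eta_sym r1 r2 vp sze.
have zM := Mop_supp0 eta oU sPhi r1 r2 vp sze cze.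
have sw : smooth_family S (fun=> w).
  move=> i; change (sm S (fun _ : 'rV[R]_n => crd (fun s => M (p s) (ze s)) i s)).
  apply: (sm_comp_pt (h := fun=> s) oS (sM i : sm S (crd (fun s => M (p s) (ze s)) i))) => //.
  by move=> j; exact: smooth_cst.
have zw i : supp0 S (crd (fun=> w) i).
  move=> t _; have [A /nbhs_singleton H] := zM i s Ss; exists A.
  by apply: filterE => t'; exact: H.
rewrite -(Hessian_symmetric oU Uu0 k vp sw zw fI Ss).
apply: eq_Rintegral => x _; apply: eq_bigr => i _.
by rewrite /w (Mop_WF eta oU sPhi r1 r2 vp x i sze Ss) /D_ dP_DD.
Qed.

End HessianTerm.

Section Functionals.
Variables (I : @field R N -> R) (dI : @field R N -> R -> 'rV[R]_N).
Variables (J : @field R N -> R) (dJ : @field R N -> R -> 'rV[R]_N).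
Hypotheses (fI : functional U u0 I dI) (fJ : functional U u0 J dJ).

Let xi s := dI (p s).
Let ze s := dJ (p s).
Let sxi : smooth_family S xi. Proof. by case: (functional_family fI vp). Qed.
Let sze : smooth_family S ze. Proof. by case: (functional_family fJ vp). Qed.
Let cxi : forall i, cst_end S (crd xi i). Proof. by case: (functional_family fI vp). Qed.
Let cze : forall i, cst_end S (crd ze i). Proof. by case: (functional_family fJ vp). Qed.

Lemma bracketE s : S s ->
  bracket M dI dJ (p s) = \int[mu]_x DOT (crd xi) (WF Phi eta p r1 r2 ze) s x.
Proof.
move=> Ss; apply: eq_Rintegral => x _; apply: eq_bigr => i _.
by rewrite (Mop_WF eta oU sPhi r1 r2 vp x i sze Ss).
Qed.

Let w1 s := M (p s) (ze s).
Let w2 s := M (p s) (xi s).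

Definition dense1 k s x := \sum_i var_grad dI (p s) (w1 s) x ord0 i * dP k (crd p i) s x.
Definition dense2 k s x := \sum_i var_grad dJ (p s) (w2 s) x ord0 i * dP k (crd p i) s x.
Definition dense3 k s x := \sum_i torsion (p s) (xi s) (ze s) x ord0 i * dP k (crd p i) s x.

Lemma bracket_pd k s : S s -> pd ord0 k (fun t => bracket M dI dJ (p t)) s =
  \int[mu]_x dense1 k s x - \int[mu]_x dense2 k s x + r1 * \int[mu]_x dense3 k s x.
Proof.
move=> Ss; rewrite (pd_eq oS bracketE Ss).
rewrite (first_variation oU sPhi eta_sym assoc r1 r2 vp sxi cxi sze cze k Ss).
rewrite (Hessian_term fI sze cze k Ss) (Hessian_term fJ sxi cxi k Ss).
congr (_ + _ * _); apply: eq_Rintegral => x _.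
by rewrite (TTE _ x sxi sze Ss) /dense3 dP_DD.
Qed.

Let sw1 : smooth_family S w1. Proof. exact: (Mop_family oU sPhi eta_sym r1 r2 vp sze). Qed.
Let sw2 : smooth_family S w2. Proof. exact: (Mop_family oU sPhi eta_sym r1 r2 vp sxi). Qed.
Let zw1 : forall i, supp0 S (crd w1 i). Proof. exact: (Mop_supp0 eta oU sPhi r1 r2 vp sze cze). Qed.
Let zw2 : forall i, supp0 S (crd w2 i). Proof. exact: (Mop_supp0 eta oU sPhi r1 r2 vp sxi cxi). Qed.

Lemma dbracket_family : smooth_family S (fun s => dbracket dI dJ (p s)) /\
  forall i, cst_end S (crd (fun s => dbracket dI dJ (p s)) i).
Proof.
have [s1 c1] := var_grad_family oU Uu0 vp sw1 zw1 fI.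
have [s2 c2] := var_grad_family oU Uu0 vp sw2 zw2 fJ.
have [s3 c3] := torsion_family sxi cxi sze cze.
have E i s x : crd (fun s => var_grad dI (p s) (w1 s)) i s x - crd (fun s => var_grad dJ (p s) (w2 s)) i s x
   + r1 * crd (fun s => torsion (p s) (xi s) (ze s)) i s x = crd (fun s => dbracket dI dJ (p s)) i s x.
  exact (esym (dbracketE dI dJ (p s) x i)).
split=> i.
  change (sm S (crd (fun s => dbracket dI dJ (p s)) i)).
  apply: (sm_eq oS (fun s x _ => E i s x)).
  apply: (smD oS); last by apply: (smM oS); [exact: sm_cst | exact: (s3 i)].
  by apply: (smD oS (s1 i)); apply: (smN oS); exact: (s2 i).
apply: (cst_end_eq oS (fun s x _ => E i s x)).
apply: cst_endD; last by apply: cst_endM; [exact: cst_end_cst | exact: supp0_cst_end].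
apply: cst_endD => // s Ss; have [A H] := c2 i s Ss; exists A; apply: filterS H => t H x y Ax Ay.
by rewrite (H x y).
Qed.

Lemma cs_dense k s : S s -> [/\ cs (dense1 k s), cs (dense2 k s) & cs (dense3 k s)].
Proof.
move=> Ss.
have [s1 c1] := var_grad_family oU Uu0 vp sw1 zw1 fI.
have [s2 c2] := var_grad_family oU Uu0 vp sw2 zw2 fJ.
have [s3 c3] := torsion_family sxi cxi sze cze.
have sv i : sm S (dP k (crd p i)) by exact: (smP k (sp i : sm S (crd p i))).
have zv i : supp0 S (dP k (crd p i)) by rewrite dP_DD; exact: variation_supp0P vp.
have main q : smooth_family S q -> cs (fun x => \sum_i crd q i s x * dP k (crd p i) s x).
  move=> sq; apply: cs_sum => i.
  apply: (supp0_cs (F := fun s x => crd q i s x * dP k (crd p i) s x) _ _ Ss).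
    exact: (smM oS (sq i : sm S (crd q i)) (sv i)).
  exact: supp0Mr.
by split; [exact: (main _ s1)|exact: (main _ s2)|exact: (main _ s3)].
Qed.

Lemma dbracket_pd k s : S s -> pd ord0 k (fun t => bracket M dI dJ (p t)) s =
  \int[mu]_x \sum_i dbracket dI dJ (p s) x ord0 i * dP k (crd p i) s x.
Proof.
move=> Ss; rewrite (bracket_pd k Ss); have [c1 c2 c3] := cs_dense k Ss.
rewrite -(int_csZ r1 c3) -(int_csB c1 c2) -(int_csD (csD c1 (csN c2)) (cs_Z r1 c3)).
apply: eq_Rintegral => x _; rewrite /dense1 /dense2 /dense3 big_distrr -sumrB -big_split.
by apply: eq_bigr => i _; rewrite dbracketE mulrDl mulrBl -[r1 * _ * _]mulrA.
Qed.

Lemma smooth_bracket : smooth_on S (fun s => bracket M dI dJ (p s)).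
Proof.
apply: (smooth_eq oS (fun s Ss => esym (bracketE Ss))).
have szW := supp0_DOT_WF Phi eta r1 r2 vp sze cze (crd xi).
exact: (smooth_int oS (sm_DOT_WF sPhi eta_sym r1 r2 vp sze sxi) szW).
Qed.

Lemma bracket_skew s : S s -> bracket M dI dJ (p s) = - bracket M dJ dI (p s).
Proof.
move=> Ss; rewrite bracketE // (skew_DOT_WF oU sPhi eta_sym r1 r2 vp sxi cxi sze cze Ss); congr (- _).
apply: eq_Rintegral => x _; apply: eq_bigr => i _.
by rewrite (Mop_WF eta oU sPhi r1 r2 vp x i sxi Ss).
Qed.

End Functionals.

End Variation.

Lemma bracket_functional I dI J dJ : functional U u0 I dI -> functional U u0 J dJ ->
  functional U u0 (bracket M dI dJ) (dbracket dI dJ).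
Proof.
move=> fI fJ n S p vp.
have [s1 c1] := dbracket_family vp fI fJ.
split => //.
- exact: (smooth_bracket vp fI fJ).
- move=> s Ss; have [oS _ _ _] := vp.
  suff [A nA] : exists A, \forall t \near s, forall i x y, A <= `|x| -> A <= `|y| ->
      crd (fun s => dbracket dI dJ (p s)) i t x = crd (fun s => dbracket dI dJ (p s)) i t y.
    exists A; apply: filterS nA => t H x y Ax Ay; apply/rowP => i; exact: (H i x y Ax Ay).
  pose B i := sval (cid (c1 i s Ss)).
  exists (\big[Num.max/0]_i B i).
  have nB : \forall t \near s, forall i : 'I_N, forall x y, B i <= `|x| -> B i <= `|y| ->
      crd (fun s => dbracket dI dJ (p s)) i t x = crd (fun s => dbracket dI dJ (p s)) i t y.
    apply: (@filter_forall _ _ (fun i t => forall x y, B i <= `|x| -> B i <= `|y| ->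
      crd (fun s => dbracket dI dJ (p s)) i t x = crd (fun s => dbracket dI dJ (p s)) i t y) (nbhs s) _).
    by move=> i; exact: (svalP (cid (c1 i s Ss))).
  apply: filterS nB => t H i x y Ax Ay.
  by apply: (H i); [apply: le_trans Ax | apply: le_trans Ay]; exact: (le_bigmax _ B i).
- by move=> s k Ss; exact: (dbracket_pd vp fI fJ k Ss).
Qed.

Section Jacobi.
Variable u : @field R N.
Hypothesis pu : phase_space U u0 u.

(** No parameters at all: extending this family by a direction leaves exactly one, the coordinate
    along that direction. *)
Let p (_ : 'rV[R]_0) := u.
Let vp : smooth_variation U u0 setT p := phase_space_variation openT pu.
Let Uu x : U (u x). Proof. by case: pu => _ []. Qed.

Definition jacobi_hess (dI dJ dK : @field R N -> R -> 'rV[R]_N) : R :=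
  \int[mu]_x \sum_i var_grad dI u (M u (dJ u)) x ord0 i * M u (dK u) x ord0 i.

Definition jacobi_torsion (dI dJ dK : @field R N -> R -> 'rV[R]_N) : R :=
  \int[mu]_x \sum_i torsion u (dI u) (dJ u) x ord0 i * M u (dK u) x ord0 i.

Section Direction.
Variables (K : @field R N -> R) (dK : @field R N -> R -> 'rV[R]_N).
Hypothesis fK : functional U u0 K dK.

Let w (_ : 'rV[R]_0) := M u (dK u).
Let sK : smooth_family setT (fun _ : 'rV[R]_0 => dK u). Proof. by case: (functional_family fK vp). Qed.
Let cK : forall i, cst_end setT (crd (fun _ : 'rV[R]_0 => dK u) i).
Proof. by case: (functional_family fK vp). Qed.
Let sw : smooth_family setT w. Proof. exact: (Mop_family oU sPhi eta_sym r1 r2 vp sK). Qed.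
Let zw : forall i, supp0 setT (crd w i). Proof. exact: (Mop_supp0 eta oU sPhi r1 r2 vp sK cK). Qed.
Let vE := variation_ext vp sw zw.
Let z0 : 'rV[R]_(0 + 1) := pt 0 0.
Let Ez0 : ext_dom U setT p w z0 := ext_dom_pt0 oU Uu0 vp sw zw I.
Let uz0 : ext p w z0 = u. Proof. exact: ext_pt0. Qed.
Let k : 'I_(0 + 1) := rshift 0 ord0.
Let dk i x : dP k (crd (ext p w) i) z0 x = M u (dK u) x ord0 i.
Proof. by have := @dP_ext_r R N 0 setT p w i z0 x Logic.I. Qed.

(** [dIJ] is an arbitrary variational derivative of {I, J}. Its pairing with M dK is the derivative
    of {I, J} along u + e M dK, which the first variation gives independently of the choice of
    [dIJ]. *)
Lemma Jacobi_term I dI J dJ dIJ : functional U u0 I dI -> functional U u0 J dJ ->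
  functional U u0 (bracket M dI dJ) dIJ ->
  bracket M dIJ dK u = jacobi_hess dI dJ dK - jacobi_hess dJ dI dK + r1 * jacobi_torsion dI dJ dK.
Proof.
move=> fI fJ fIJ.
have [_ _ _ D] := fIJ _ _ _ vE.
have := bracket_pd vE fI fJ k Ez0; rewrite (D _ k Ez0).
have -> : \int[mu]_x (\sum_i dIJ (ext p w z0) x ord0 i * pd ord0 k (fun t => ext p w t x ord0 i) z0) =
    bracket M dIJ dK u.
  apply: eq_Rintegral => x _; apply: eq_bigr => i _; rewrite uz0; congr (_ * _).
  exact: dk.
move=> ->; congr (_ - _ + _ * _); apply: eq_Rintegral => x _; apply: eq_bigr => i _.
- by rewrite uz0 dk.
- by rewrite uz0 dk.
- by rewrite uz0 dk.
Qed.

(** Symmetry of the Hessian of I in the directions M dJ, frozen at u, and M dK, realised by the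
    parameter of the extended family. *)
Lemma jacobi_hess_sym I dI J dJ : functional U u0 I dI -> functional U u0 J dJ ->
  jacobi_hess dI dJ dK = jacobi_hess dI dK dJ.
Proof.
move=> fI fJ; have [oE sE UE zE] := vE.
have [sJ cJ] := functional_family fJ vp.
pose wJ := M u (dJ u).
have sM := Mop_family oU sPhi eta_sym r1 r2 vp sJ.
have zM := Mop_supp0 eta oU sPhi r1 r2 vp sJ cJ.
have swJ : smooth_family (ext_dom U setT p w) (fun=> wJ).
  move=> i; change (sm (ext_dom U setT p w) (fun _ : 'rV[R]_(0 + 1) => crd (fun _ : 'rV[R]_0 => M u (dJ u)) i 0)).
  apply: (sm_comp_pt (h := fun=> 0) oE (sM i : sm setT (crd (fun _ : 'rV[R]_0 => M u (dJ u)) i))) => //.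
  by move=> j; exact: smooth_cst.
have zwJ i : supp0 (ext_dom U setT p w) (crd (fun=> wJ) i).
  move=> t _; have [A /nbhs_singleton H] := zM i 0 Logic.I; exists A.
  by apply: filterE => t'; exact: H.
have := Hessian_symmetric oU Uu0 k vE swJ zwJ fI Ez0.
rewrite uz0 => H; symmetry; apply: etrans (etrans H _).
  apply: eq_Rintegral => x _; apply: eq_bigr => i _; congr (_ * _).
  exact: (var_gradE p w dI 0 x i).
apply: eq_Rintegral => x _; apply: eq_bigr => i _; congr (_ * _); exact: dk.
Qed.

End Direction.

(** The integrands already cancel. In the notation of [tri_assoc], the r1 terms have the form
    c(dJ_x, phi_dI, phi_dK.u_x), where phi_dI and phi_dK may be exchanged by associativity; the r2
    terms have the form c(dJ_x, phi_dI, dK_x), where symmetry of c is enough. *)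
Lemma torsion_cyclic I dI J dJ K dK : functional U u0 I dI -> functional U u0 J dJ ->
  functional U u0 K dK -> jacobi_torsion dI dJ dK + jacobi_torsion dJ dK dI + jacobi_torsion dK dI dJ = 0.
Proof.
move=> fI fJ fK.
pose fam (dI : @field R N -> R -> 'rV[R]_N) (_ : 'rV[R]_0) := dI u.
have [sI cI] : smooth_family setT (fam dI) /\ forall i, cst_end setT (crd (fam dI) i).
  exact: (functional_family fI vp).
have [sJ cJ] : smooth_family setT (fam dJ) /\ forall i, cst_end setT (crd (fam dJ) i).
  exact: (functional_family fJ vp).
have [sK cK] : smooth_family setT (fam dK) /\ forall i, cst_end setT (crd (fam dK) i).
  exact: (functional_family fK vp).
pose W q := WF Phi eta p r1 r2 q.
have E a b d : smooth_family setT (fam a) -> smooth_family setT (fam b) -> smooth_family setT (fam d) ->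
    forall x, \sum_i torsion u (a u) (b u) x ord0 i * M u (d u) x ord0 i =
    TT Phi eta p (fam a) (fam b) (W (fam d)) 0 x.
  move=> sa sb sd x; have := TTE p (W (fam d)) x sa sb (Logic.I : setT (0 : 'rV[R]_0)).
  move=> ->; apply: eq_bigr => i _; congr (_ * _).
  exact: (Mop_WF eta oU sPhi r1 r2 vp x i sd (Logic.I : setT (0 : 'rV[R]_0))).
have csT a b d : smooth_family setT (fam a) -> (forall i, cst_end setT (crd (fam a) i)) ->
    smooth_family setT (fam b) -> (forall i, cst_end setT (crd (fam b) i)) ->
    smooth_family setT (fam d) -> (forall i, cst_end setT (crd (fam d) i)) ->
    cs (fun x => \sum_i torsion u (a u) (b u) x ord0 i * M u (d u) x ord0 i).
  move=> sa ca sb cb sd cd; have [st zt] := torsion_family vp sa ca sb cb.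
  have sM := Mop_family oU sPhi eta_sym r1 r2 vp sd.
  apply: cs_sum => i.
  have st' : sm setT (crd (fun s => torsion (p s) (fam a s) (fam b s)) i) := st i.
  have sM' : sm setT (crd (fun s => M (p s) (fam d s)) i) := sM i.
  apply: (csM (supp0_cs st' (zt i) (Logic.I : setT (0 : 'rV[R]_0)))).
  exact: (sm_continuous sM' (Logic.I : setT (0 : 'rV[R]_0))).
have i1 := csT _ _ _ sI cI sJ cJ sK cK.
have i2 := csT _ _ _ sJ cJ sK cK sI cI.
have i3 := csT _ _ _ sK cK sI cI sJ cJ.
rewrite /jacobi_torsion -(int_csD i1 i2) -(int_csD (csD i1 i2) i3).
(* The right-hand side 0 is written as an integral too, which reduces the claim to a pointwise
   identity. *)
have z := int_csZ 0 i1; rewrite mul0r in z.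
rewrite -[RHS]z; apply: eq_Rintegral => x _; rewrite [RHS]mul0r.
have add3 (a a' b b' d d' : R) : a = a' -> b = b' -> d = d' -> a' + b' + d' = 0 -> a + b + d = 0.
  by move=> -> -> ->.
refine (add3 _ _ _ _ _ _ (E dI dJ dK sI sJ sK x) (E dJ dK dI sJ sK sI x) (E dK dI dJ sK sI sJ x) _).
have c12 i j k : c3 Phi p 0 x i j k = c3 Phi p 0 x j i k by exact: (d3_12 oU sPhi).
have c23 i j k : c3 Phi p 0 x i j k = c3 Phi p 0 x i k j by exact: (d3_23 oU sPhi).
have lin a b d : TRI Phi p a b (W (fam d)) 0 x =
    r1 * TRI Phi p a b (UP eta (CL Phi p (UP eta (phi Phi eta p (fam d))) (D_ (rshift 0 ord0) (crd p)))) 0 x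
    + r2 * TRI Phi p a b (UP eta (D_ (rshift 0 ord0) (crd (fam d)))) 0 x.
  exact: tri_lin3.
have sym a f g d : TRI Phi p a f (UP eta (CL Phi p g d)) 0 x = TRI Phi p a g (UP eta (CL Phi p f d)) 0 x.
  have H := TRI_assoc oU sPhi assoc (fun s x (_ : setT s) => Uu x) f g d a x (Logic.I : setT (0 : 'rV[R]_0)).
  exact (eq_trans (tri12 c12 _ _ _) (eq_trans (tri23 c23 _ _ _) (eq_trans H
    (eq_trans (esym (tri23 c23 _ _ _)) (esym (tri12 c12 _ _ _)))))).
have perm a b d : TRI Phi p a b d 0 x = TRI Phi p d b a 0 x by exact: (tri13 c12 c23).
rewrite /TT !lin.
set fx := UP eta (phi Phi eta p (fam dI)); set fy := UP eta (phi Phi eta p (fam dJ)).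
set fz := UP eta (phi Phi eta p (fam dK)); set v := D_ _ (crd p).
set X := UP eta (D_ _ (crd (fam dI))); set Y := UP eta (D_ _ (crd (fam dJ))).
set Z := UP eta (D_ _ (crd (fam dK))).
have e1 := sym Y fx fz v; have e2 := sym X fy fz v; have e3 := sym Z fy fx v.
have e4 := perm Y fx Z; have e5 := perm X fy Z; have e6 := perm X fz Y.
exact (cyclic_cancel r1 r2 e1 e2 e3 e4 e5 e6).
Qed.

Lemma Jacobi I dI J dJ K dK dIJ dJK dKI :
  functional U u0 I dI -> functional U u0 J dJ -> functional U u0 K dK ->
  functional U u0 (bracket M dI dJ) dIJ -> functional U u0 (bracket M dJ dK) dJK ->
  functional U u0 (bracket M dK dI) dKI ->
  bracket M dIJ dK u + bracket M dJK dI u + bracket M dKI dJ u = 0.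
Proof.
move=> fI fJ fK fIJ fJK fKI.
rewrite (Jacobi_term fK fI fJ fIJ) (Jacobi_term fI fJ fK fJK) (Jacobi_term fJ fK fI fKI).
rewrite (jacobi_hess_sym fK fI fJ) (jacobi_hess_sym fI fJ fK) (jacobi_hess_sym fJ fK fI).
have := torsion_cyclic fI fJ fK.
move: (jacobi_hess _ _ _) (jacobi_hess _ _ _) (jacobi_hess _ _ _) (jacobi_torsion _ _ _) (jacobi_torsion _ _ _) (jacobi_torsion _ _ _) => a b c d e f H.
by rewrite -[RHS](mulr0 r1) -H; ring.
Qed.

End Jacobi.

Lemma hamiltonian_Mop : hamiltonian U u0 M.
Proof.
split.
- by move=> I dI J dJ fI fJ; exists (dbracket dI dJ); exact (bracket_functional fI fJ).
- move=> I dI J dJ fI fJ u pu.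
  have vp : smooth_variation U u0 setT (fun _ : 'rV[R]_0 => u) := phase_space_variation openT pu.
  exact: (bracket_skew vp fI fJ (Logic.I : setT (0 : 'rV[R]_0))).
- move=> I dI J dJ K dK dIJ dJK dKI fI fJ fK fIJ fJK fKI u pu.
  exact: (Jacobi pu fI fJ fK fIJ fJK fKI).
Qed.

End Hamiltonian.

Lemma compatible_L01_L10 (R : realType) (N : nat) (U : set 'rV[R]_N) (u0 : 'rV[R]_N)
    (Phi : 'rV[R]_N -> R) (eta : 'M[R]_N) :
  open U -> U u0 -> smooth_on U Phi -> eta^T = eta -> associativity U eta Phi ->
  compatible U u0 (L01 eta Phi) (L10 eta).
Proof. by move=> oU Uu0 sPhi es assoc a b; exact: hamiltonian_Mop. Qed.

(** * Closed forms and total derivatives *)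

Section Poincare.
Context {R : realType} {N : nat}.
Implicit Types (B : set 'rV[R]_N) (t : R).

Definition cvx (B : set 'rV[R]_N) : Prop := forall u v t, B u -> B v -> 0 <= t <= 1 -> B (t *: (v - u) + u).

Lemma cvx_ball (p : 'rV[R]_N) (r : R) : cvx (ball p r).
Proof.
move=> u v t; rewrite mx_norm_ball /ball_ /= => Bu Bv /andP[t0 t1].
have -> : p - (t *: (v - u) + u) = t *: (p - v) + (1 - t) *: (p - u).
  by apply/rowP => i; rewrite !mxE; ring.
apply: le_lt_trans (ler_normD _ _) _; rewrite !normrZ (ger0_norm t0) (ger0_norm (_ : 0 <= 1 - t)) ?subr_ge0//.
have [->|tn0] := eqVneq t 0; first by rewrite mul0r add0r subr0 mul1r.
have tp : 0 < t by rewrite lt_neqAle eq_sym tn0.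
have -> : r = t * r + (1 - t) * r by ring.
by apply: ltr_leD; [rewrite ltr_pM2l | apply: ler_wpM2l; [rewrite subr_ge0 | exact: ltW]].
Qed.

Section Closed.
Variables (B : set 'rV[R]_N) (p : 'rV[R]_N) (om : 'I_N -> 'rV[R]_N -> R).
Hypotheses (oB : open B) (cB : cvx B) (Bp : B p) (som : forall k, smooth_on B (om k)).
Hypothesis closed_om : forall u k l, B u -> d_ l (om k) u = d_ k (om l) u.

Let c (u : 'rV[R]_N) (t : R) : 'rV[R]_N := t *: (u - p) + p.
Let K (u : 'rV[R]_N) (t : R) : R := \sum_k om k (c u t) * (u ord0 k - p ord0 k).
Let W : set 'rV[R]_(N + 1) := [set w | setT w /\ B (c (lsubmx w) (rsubmx w ord0 ord0))].

Let sc k (A : set 'rV[R]_(N + 1)) : open A ->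
  smooth_on A (fun w : 'rV[R]_(N + 1) => c (lsubmx w) (rsubmx w ord0 ord0) ord0 k).
Proof.
move=> oA; under eq_fun do rewrite !mxE.
apply: (smoothD oA); last exact: smooth_cst.
apply: (smoothM oA); first exact: smooth_coord.
by apply: (smoothD oA); [exact: smooth_coord | exact: smooth_cst].
Qed.

Let oW : open W.
Proof.
apply: (open_preimage_mx openT oB (g := fun w : 'rV[R]_(N + 1) => c (lsubmx w) (rsubmx w ord0 ord0))).
by move=> i k; rewrite (ord1 i : i = ord0); apply: sc; exact: openT.
Qed.

Let sK : smooth_on W (unc K).
Proof.
apply: (smooth_sum _ _ oW) => k; apply: (smoothM oW); last first.
  by under eq_fun do rewrite mxE; apply: (smoothD oW); [exact: smooth_coord | exact: smooth_cst].
apply: (smooth_comp oW _ (som k)); first by move=> w [].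
by move=> i j; rewrite (ord1 i : i = ord0); exact: (sc j oW).
Qed.

Let BW u t : B u -> 0 <= t <= 1 -> W (pt u t).
Proof.
move=> Bu t01; split => //=; rewrite row_mxKl row_mxKr mxE eqxx; exact: cB.
Qed.

Let fK := smooth_I01 oB BW sK.

(** By closedness the derivative of the integrand in u^l is the t-derivative of t om_l along the
    segment from p to u, and its integral over [0, 1] is om_l(u). *)
Let dK u t l : B u -> 0 <= t <= 1 ->
  dP l K u t = t * (\sum_k d_ k (om l) (c u t) * (u ord0 k - p ord0 k)) + om l (c u t).
Proof.
move=> Bu t01.
have Bc : B (c u t) by exact: cB.
have dc i j : differentiable (fun v => c v t i j) u.
  rewrite /c; under eq_fun do rewrite !mxE.
  apply: differentiableD; last exact: differentiable_cst.
  apply: differentiableM; first exact: differentiable_cst.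
  apply: differentiableB; [exact: differentiable_coord | exact: differentiable_cst].
have dom k : differentiable (fun v => om k (c v t)) u.
  apply: (@differentiable_comp _ _ _ _ (fun v => c v t) (om k)); last exact: smooth_differentiable (som k) Bc.
  exact: differentiable_mx.
have dq k : differentiable (fun v : 'rV[R]_N => v ord0 k - p ord0 k) u.
  by apply: differentiableB; [exact: differentiable_coord | exact: differentiable_cst].
have dterm k : differentiable (fun v => om k (c v t) * (v ord0 k - p ord0 k)) u by exact: differentiableM.
have pq k : pd ord0 l (fun v : 'rV[R]_N => v ord0 k - p ord0 k) u = (l == k)%:R.
  rewrite (pdD _ _ (differentiable_coord _ _ _) (differentiable_cst _ _)) pd_coord eqxx /=.
  by rewrite /pd derive_cst addr0.
have pc j : pd ord0 l (fun v => c v t ord0 j) u = t * (l == j)%:R.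
  rewrite /c; under eq_fun do rewrite !mxE.
  have d1 : differentiable (fun v : 'rV[R]_N => t * (v ord0 j - p ord0 j)) u.
    by apply: differentiableM => //; exact: differentiable_cst.
  rewrite (pdD _ _ d1 (differentiable_cst _ _)) (pdM _ _ (differentiable_cst _ _) (dq j)) pq.
  by rewrite /pd !derive_cst mul0r add0r addr0.
rewrite /dP; have [_ ->] := @pd_sum R 1 N _ (index_enum 'I_N) xpredT _ ord0 l u dterm.
transitivity (\sum_k (t * (d_ k (om l) (c u t) * (u ord0 k - p ord0 k)) + (l == k)%:R * om k (c u t))).
  apply: eq_bigr => k _; rewrite (pdM _ _ (dom k) (dq k)) pq mulrC [_ * _%:R]mulrC; congr (_ + _).
  rewrite (@pd_comp R 1 N 1 N (om k) (fun v => c v t) u ord0 l (smooth_differentiable (som k) Bc) dc).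
  rewrite big_ord1 (bigD1 l) //= big1 => [|j jl]; last by rewrite pc // eq_sym (negbTE jl) !mulr0.
  rewrite pc // eqxx mulr1 addr0 -/(d_ l (om k)) closed_om //; ring.
rewrite big_split -mulr_sumr; congr (_ + _) => /=.
by rewrite (bigD1 l) //= eqxx mul1r big1 ?addr0// => k kl; rewrite eq_sym (negbTE kl) mul0r.
Qed.

Lemma Poincare : exists f, smooth_on B f /\ forall u k, B u -> d_ k f u = om k u.
Proof.
exists (I01 K); have [sf df] := fK; split => // u l Bu.
rewrite /d_ df // /I01.
have dc t : is_derive t 1 (c u) (u - p).
  have di : derivable (@id 'rV[R]_N) (t *: (u - p) + p) (u - p) by exact: derivable_id.
  by have := is_derive_line di; rewrite derive_id.
have dH t : 0 <= t <= 1 -> is_derive t 1 (fun t => t * om l (c u t)) (dP l K u t).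
  move=> t01; have Bc : B (c u t) by exact: cB.
  have d1 := is_derive_comp_curve (smooth_differentiable (som l) Bc) (dc t).
  have d2 := @is_deriveM _ _ id (fun t => om l (c u t)) t 1 _ _ (is_derive_id t 1) d1.
  rewrite dK //; move: d2; rewrite (diff_pd _ (smooth_differentiable (som l) Bc)) big_ord1.
  rewrite /GRing.scale /= mulr1.
  under eq_bigr do rewrite mulrC !mxE.
  by [].
rewrite (@Rintegral_FTC2 R (fun t => t * om l (c u t)) (dP l K u) 0 1 ltr01 dH).
  by rewrite mul1r mul0r subr0 /c scale1r subrK.
apply: within01_continuous => t t01; apply: differentiable_continuous.
by rewrite unc_dP; apply: smooth_differentiable (smooth_pd _ _ sK) _; exact: BW.
Qed.

End Closed.

End Poincare.

(** * Differential functions with vanishing total derivative *)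

Section TotalDerivative.
Context {R : realType} {N : nat}.

Definition poly_field (P : 'I_N -> {poly R}) : @field R N := fun x => \row_i (P i).[x].

Lemma derive1n_poly_field P k : derive1n k (poly_field P) = poly_field (fun i => (P i)^`(k)).
Proof.
elim: k => [|k IH]; first by apply/funext => x; apply/rowP => i; rewrite !mxE.
rewrite derive1nS IH; apply/funext => x; rewrite derive1E.
have dP : derivable (poly_field (fun i => (P i)^`(k))) x 1.
  apply/derivable_mxP => a i; under eq_fun do rewrite mxE; exact: derivable_horner.
rewrite (derive_mx dP); apply/rowP => i; rewrite !mxE derivnS.
rewrite (derivE (P i)^`(k)) derive1E; congr ('D_1 _ x).
by apply/funext => y; rewrite mxE.
Qed.

Lemma derivable_poly_field P k x : derivable (derive1n k (poly_field P)) x 1.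
Proof.
rewrite derive1n_poly_field; apply/derivable_mxP => a i; under eq_fun do rewrite mxE.
exact: derivable_horner.
Qed.

(** Taylor polynomials realise every jet at 0, so a condition on the jets of all fields becomes a
    condition on all matrices. *)
Lemma jet_poly_field k (J : 'M[R]_(k.+1, N)) :
  exists u : @field R N, jet k u 0 = J /\ forall m x, derivable (derive1n m u) x 1.
Proof.
exists (poly_field (fun i => \poly_(a < k.+1) ((a`!)%:R^-1 * J (inord a) i))); split.
  apply/matrixP => a i; rewrite !mxE derive1n_poly_field !mxE horner_coef0 coef_derivn addn0 ffactnn.
  rewrite coef_poly ltn_ord inord_val -[LHS]mulr_natl mulrA divff ?mul1r //.
by move=> m x; exact: derivable_poly_field.
Qed.

(** Of a (k+1)-jet, the first k+1 rows are the k-jet and the last k+1 rows are its x-derivative. *)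
Definition jet_top k (J : 'M[R]_(k.+2, N)) : 'M[R]_(k.+1, N) := \matrix_(a, i) J (widen_ord (leqnSn _) a) i.
Definition jet_bot k (J : 'M[R]_(k.+2, N)) : 'M[R]_(k.+1, N) := \matrix_(a, i) J (lift ord0 a) i.

Lemma is_derive_jet k (u : @field R N) x : (forall m, derivable (derive1n m u) x 1) ->
  is_derive x 1 (jet k u) (jet_bot (jet k.+1 u x)).
Proof.
move=> du.
have E a i : is_derive x 1 (fun y => jet k u y a i) (jet_bot (jet k.+1 u x) a i).
  have -> : (fun y => jet k u y a i) = fun y => derive1n a u y ord0 i by apply/funext => y; rewrite mxE.
  rewrite !mxE lift0 derive1nS derive1E (derive_mx (du a)) mxE.
  by apply: DeriveDef => //; exact: (derivable_mxP _ _ _).1 (du a) ord0 i.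
have dj : derivable (jet k u) x 1 by apply/derivable_mxP => a i; case: (E a i).
apply: DeriveDef => //; rewrite (derive_mx dj); apply/matrixP => a i; rewrite mxE.
by case: (E a i).
Qed.

Section Constant.
Variables (B : set 'rV[R]_N) (k : nat) (f : 'M[R]_(k.+1, N) -> R).
Hypotheses (oB : open B) (cB : cvx B).
Let D : set 'M[R]_(k.+1, N) := [set J | B (row ord0 J)].
Hypothesis df : forall J, D J -> differentiable f J.
Hypothesis f0 : forall u x, admissible B u x -> is_derive x 1 (fun y => f (jet k u y)) 0.

Let diff0 (J : 'M[R]_(k.+2, N)) : B (row ord0 J) -> 'd f (jet_top J) (jet_bot J) = 0.
Proof.
move=> BJ; have [u [uJ du]] := jet_poly_field J.
have Ju : jet k u 0 = jet_top J.
  by apply/matrixP => a i; rewrite -uJ !mxE.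
have ru : u 0 = row ord0 J by apply/rowP => i; rewrite -uJ !mxE.
have adm : admissible B u 0.
  by split; [rewrite ru | near=> y; move=> m; exact: du].
have DJ : D (jet_top J).
  rewrite /D /= (_ : row ord0 (jet_top J) = row ord0 J) //.
  by apply/rowP => i; rewrite !mxE; congr (J _ i); exact: val_inj.
have dfu : differentiable f (jet k u 0) by rewrite Ju; exact: df.
have [_ e1] := is_derive_comp_curve dfu (is_derive_jet k (fun m => du m 0)).
have [_ e2] := f0 adm.
by rewrite -Ju -uJ -e1 e2.
Unshelve. all: by end_near. Qed.

Let oD : open D.
Proof.
have := @open_preimage_mx R k.+1 N 1 N setT B (row ord0) openT oB.
rewrite (_ : [set x | _] = D); last by apply/seteqP; split=> x //= [].
by apply => i j; under eq_fun do rewrite mxE; exact: smooth_coord.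
Qed.

(** Descending induction on the first row a that H may use. Moving H down one row gives a direction
    along which f is constant, by the induction hypothesis. Adding it to the (k+1)-jet therefore
    leaves the differential of f unchanged, but adds H to the x-derivative of the k-jet. Comparing
    the two vanishing total derivatives gives the claim with f only differentiable. *)
Let diff_low a (J H : 'M[R]_(k.+1, N)) : (a <= k.+1)%N -> D J ->
  (forall (b : 'I_k.+1) i, (b < a)%N -> H b i = 0) -> 'd f J H = 0.
Proof.
move=> ak; have [m] := ubnP (k.+1 - a); elim: m a ak J H => // m IH a ak J H.
have [ak'|ka] := ltnP a k.+1; last first.
  move=> _ _ H0; have -> : H = 0.
    by apply/matrixP => b i; rewrite mxE H0 // (leq_trans (ltn_ord b)).
  by rewrite linear0.
rewrite ltnS => am DJ H0.
(* H moved down by one row; its last row drops out here and reappears in [J1], which has one more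
   row. *)
pose T : 'M[R]_(k.+1, N) := \matrix_(b, i) (if (a < b)%N then H (inord b.-1) i else 0).
have T0 (b : 'I_k.+1) i : (b < a.+1)%N -> T b i = 0.
  by move=> ba; rewrite mxE ltnNge -ltnS ba.
have shiftD (J' : 'M[R]_(k.+1, N)) t : D J' -> D (t *: T + J').
  rewrite /D /= => BJ'; rewrite (_ : row ord0 _ = row ord0 J') //.
  by apply/rowP => i; rewrite !mxE ltn0 mulr0 add0r.
have dT J' t : D J' -> 'd f (t *: T + J') T = 0.
  move=> DJ'; apply: (IH a.+1 ak' _ _ _ (shiftD _ t DJ') T0).
  by rewrite subnS prednK // subn_gt0.
have fT J' : D J' -> f (T + J') = f J'.
  move=> DJ'; have [t _ E] := @MVT_line R _ f J' T (fun t _ => diff_derivable (df (shiftD J' t DJ'))).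
  by apply/eqP; rewrite -subr_eq0 E deriveE ?dT //; exact/df/shiftD.
have DTJ : D (T + J) by have := shiftD J 1 DJ; rewrite scale1r.
have dfE H' : 'd f (T + J) H' = 'd f J H'.
  refine (eq_trans (esym (deriveE H' (df DTJ))) (eq_trans _ (deriveE H' (df DJ)))).
  refine (eq_trans (esym (proj1 (derive_translate f T J H'))) _).
  apply: near_eq_derive; have nD : \forall J' \near J, D J' by exact: open_nbhs_nbhs.
  by apply: filterS nD => J' DJ'; exact: fT.
(* J extended by a zero row of order k+1; [J1] adds all rows of H, moved down by one, so that the
   lower parts differ by exactly H. *)
pose J0 : 'M[R]_(k.+2, N) := \matrix_(b, i) (if (b < k.+1)%N then J (inord b) i else 0).
pose J1 : 'M[R]_(k.+2, N) := J0 + \matrix_(b, i) (if (a < b)%N then H (inord b.-1) i else 0).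
have top0 : jet_top J0 = J.
  by apply/matrixP => b i; rewrite !mxE /= ltn_ord inord_val.
have top1 : jet_top J1 = T + J.
  by rewrite addrC -top0; apply/matrixP => b i; rewrite !mxE.
have bot1 : jet_bot J1 = jet_bot J0 + H.
  apply/matrixP => b i; rewrite !mxE lift0 /= inord_val; congr (_ + _).
  by case: ifPn => //; rewrite ltnS -ltnNge => ba; rewrite H0.
have r0 : row ord0 J0 = row ord0 J.
  by apply/rowP => i; rewrite !mxE /=; congr (J _ i); apply: val_inj; rewrite /= inordK.
have r1 : row ord0 J1 = row ord0 J.
  by rewrite -r0; apply/rowP => i; rewrite !mxE ltn0 addr0.
have e0 := diff0 (J := J0); rewrite r0 top0 in e0.
have e1 := diff0 (J := J1); rewrite r1 top1 bot1 dfE linearD in e1.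
have E := e1 DJ; have z := e0 DJ.
move: E z; move: ('d f J H) ('d f J (jet_bot J0)) => y z E ze.
by rewrite ze add0r in E.
Qed.

Lemma total_derivative0 J J' : D J -> D J' -> f J = f J'.
Proof.
move=> DJ DJ'.
have line (t : R) : 0 <= t <= 1 -> D (t *: (J - J') + J').
  move=> t01; rewrite /D /= (_ : row ord0 _ = t *: (row ord0 J - row ord0 J') + row ord0 J').
    exact: cB.
  by apply/rowP => i; rewrite !mxE.
have [t t01 E] := @MVT_line R _ f J' (J - J') (fun t t01 => diff_derivable (df (line t t01))).
apply/eqP; rewrite -subr_eq0 -{1}(subrK J' J) E deriveE; last exact/df/line.
by rewrite (@diff_low 0) //; exact: line.
Qed.

End Constant.

End TotalDerivative.

(** * Differential functions and their primitives *)

Section Admissible.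
Context {R : realType} {N : nat}.
Variable B : set 'rV[R]_N.
Hypothesis oB : open B.
Implicit Types (u : @field R N) (x : R).

Lemma admissible_derivable u x : admissible B u x -> forall m, derivable (derive1n m u) x 1.
Proof. by move=> [_ H]; exact: (nbhs_singleton H). Qed.

Arguments admissible_derivable {u x} ad m.

Lemma admissible_ux u x i : admissible B u x -> is_derive x 1 (fun y => u y ord0 i) (ux u i x).
Proof.
move=> /admissible_derivable /(_ 0%N) du.
rewrite /ux derive1E (derive_mx du) mxE; apply: DeriveDef => //.
exact: (derivable_mxP _ _ _).1 du ord0 i.
Qed.

Lemma near_admissible u x : admissible B u x -> \forall y \near x, admissible B u y.
Proof.
move=> ad; have cu : {for x, continuous u}.
  have /derivable1_diffP du : derivable u x 1 := admissible_derivable ad 0%N.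
  exact: differentiable_continuous.
case: ad => Bux du.
have nB : \forall y \near x, B (u y) by exact: (cu B (open_nbhs_nbhs (conj oB Bux))).
apply: filterS2 nB (near_join du) => y By Hy; split => //.
Qed.

Lemma is_derive_of_field f u x : smooth_on B f -> admissible B u x ->
  is_derive x 1 (fun y => f (u y)) (\sum_k d_ k f (u x) * ux u k x).
Proof.
move=> sf ad; have du := admissible_derivable ad 0%N.
have dfu : differentiable f (u x) by apply: (smooth_differentiable sf); case: ad.
have dux : is_derive x 1 u (\row_k ux u k x).
  apply: DeriveDef => //; rewrite (derive_mx du); apply/rowP => k; rewrite !mxE.
  by have [_ ->] := admissible_ux k ad.
have := is_derive_comp_curve dfu dux; rewrite (diff_pd _ dfu) big_ord1.
by under eq_bigr do rewrite mxE mulrC.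
Qed.

Lemma smooth_row0 k f : smooth_on B f -> smooth_on [set J : 'M[R]_(k.+1, N) | B (row ord0 J)] (fun J => f (row ord0 J)).
Proof.
move=> sf.
have sr i j (A : set 'M[R]_(k.+1, N)) : smooth_on A (fun J => row ord0 J i j).
  by under eq_fun do rewrite mxE; exact: smooth_coord.
have oD : open [set J : 'M[R]_(k.+1, N) | B (row ord0 J)].
  have := @open_preimage_mx R k.+1 N 1 N setT B (row ord0) openT oB.
  rewrite (_ : [set x | _] = [set J | B (row ord0 J)]); last by apply/seteqP; split=> x //= [].
  by apply => i j; exact: sr.
by apply: (smooth_comp oD _ sf) => // i j; exact: sr.
Qed.

Lemma row0_jet k u x : row ord0 (jet k u x) = u x.
Proof. by apply/rowP => i; rewrite !mxE. Qed.

Lemma differential_function_of_field f : smooth_on B f ->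
  differential_function B (fun u x => f (u x)).
Proof.
move=> sf; exists 0%N, (fun J => f (row ord0 J)); split; first exact: smooth_row0.
by move=> u x _; rewrite row0_jet.
Qed.

Lemma differential_function_derivable F u x : differential_function B F -> admissible B u x ->
  derivable (F u) x 1.
Proof.
move=> [k [f [sf Ff]]] ad.
have dj := is_derive_jet k (admissible_derivable ad).
have dfu : differentiable f (jet k u x).
  by apply: (smooth_differentiable sf); rewrite /= row0_jet; case: ad.
have [d _] := is_derive_comp_curve dfu dj.
apply: near_eq_derivable d; have := near_admissible ad; apply: filterS => y ady.
by rewrite Ff.
Qed.

Lemma primitive_unique F h : cvx B -> (exists p, B p) -> differential_function B F -> smooth_on B h ->
  (forall u x, admissible B u x -> 'D_1 (F u) x = \sum_k d_ k h (u x) * ux u k x) ->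
  exists c, forall u x, admissible B u x -> F u x = h (u x) + c.
Proof.
move=> cB [p Bp] dF sh HF; have [k [f [sf Ff]]] := dF.
pose g (J : 'M[R]_(k.+1, N)) := f J - h (row ord0 J).
have dg J : B (row ord0 J) -> differentiable g J.
  move=> BJ; apply: differentiableB; first exact: (smooth_differentiable sf).
  exact (@smooth_differentiable _ _ _ _ _ J (smooth_row0 (k := k) sh) BJ).
have g0 u x : admissible B u x -> is_derive x 1 (fun y => g (jet k u y)) 0.
  move=> ad; have d2 := is_derive_of_field sh ad.
  have d1 : is_derive x 1 (F u) (\sum_k d_ k h (u x) * ux u k x).
    by apply: DeriveDef; [exact: differential_function_derivable | exact: HF].
  have d3 := is_deriveB d1 d2; rewrite subrr in d3.
  apply: near_eq_is_derive d3; have := near_admissible ad; apply: filterS => y ady.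
  by rewrite /g row0_jet -Ff.
(* Any jet over a point of B serves to read off the constant: [total_derivative0] compares all jets
   over B, hence jets of different fields as well. *)
pose J0 : 'M[R]_(k.+1, N) := \matrix_(a, i) p ord0 i.
have BJ0 : B (row ord0 J0) by rewrite (_ : row ord0 J0 = p) //; apply/rowP => i; rewrite !mxE.
exists (g J0) => u x ad.
have Bj : B (row ord0 (jet k u x)) by rewrite row0_jet; case: ad.
rewrite -(total_derivative0 oB cB dg g0 Bj BJ0) /g row0_jet -Ff //.
by rewrite addrC subrK.
Qed.

End Admissible.

(** * Flows of the hierarchy *)

Section Hierarchy.
Context {R : realType} {N : nat}.
Variables (Phi : 'rV[R]_N -> R) (eta : 'M[R]_N) (B : set 'rV[R]_N) (p0 : 'rV[R]_N).
Hypotheses (oB : open B) (cB : cvx B) (Bp0 : B p0) (sPhi : smooth_on B Phi).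
Hypotheses (eta_sym : eta^T = eta) (assoc : associativity B eta Phi).
Implicit Types (u : @field R N) (w : 'rV[R]_N) (H h : 'rV[R]_N -> R) (fm : 'I_N -> 'rV[R]_N -> R).

Let sd3 i j k : smooth_on B (d3 Phi i j k). Proof. exact: smooth_d3. Qed.
Let etaC i j : eta i j = eta j i. Proof. by rewrite -{1}eta_sym mxE. Qed.

Lemma smooth_sum_mul (c : 'I_N -> R) fm : (forall j, smooth_on B (fm j)) ->
  smooth_on B (fun w => \sum_j c j * fm j w).
Proof.
by move=> sf; apply: smooth_sum => // j; apply: smoothM => //; exact: smooth_cst.
Qed.

Lemma d_sum I (r : seq I) (f : I -> 'rV[R]_N -> R) l w : (forall a, smooth_on B (f a)) -> B w ->
  d_ l (fun w => \sum_(a <- r) f a w) w = \sum_(a <- r) d_ l (f a) w.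
Proof.
move=> sf Bw.
have [_ E] := @pd_sum R _ _ I r xpredT f ord0 l w (fun a => smooth_differentiable (sf a) Bw).
exact E.
Qed.

Lemma d_mul f g l w : smooth_on B f -> smooth_on B g -> B w ->
  d_ l (fun w => f w * g w) w = d_ l f w * g w + f w * d_ l g w.
Proof.
by move=> sf sg Bw; rewrite /d_ pdM//; [exact: smooth_differentiable sf Bw | exact: smooth_differentiable sg Bw].
Qed.

Lemma d_scale (c : R) f l w : smooth_on B f -> B w -> d_ l (fun w => c * f w) w = c * d_ l f w.
Proof.
move=> sf Bw; have sc : smooth_on B (fun=> c) by exact: smooth_cst.
rewrite (d_mul _ sc sf Bw).
by rewrite {1}/d_ /pd derive_cst mul0r add0r.
Qed.

Definition potential H fm : Prop := [/\ smooth_on B H, (forall m, smooth_on B (fm m)) &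
  forall w, B w -> forall p k, d_ k (d_ p H) w = \sum_m d3 Phi p m k w * fm m w].

(* [om h n] is the form dphi_n when phi_n = (d/dx)^{-1} of L01_arg at grad h. *)
Definition om h (n s : 'I_N) : 'rV[R]_N -> R := fun w =>
  \sum_j \sum_r eta j r * (d3 Phi r n s w * d_ j h w).

Lemma smooth_om h n s : smooth_on B h -> smooth_on B (om h n s).
Proof.
move=> sh; apply: smooth_sum => // j; apply: smooth_sum_mul => r.
by apply: smoothM => //; exact: smooth_pd.
Qed.

(** The derivative of [om] has two parts. The one with fourth derivatives of Phi is symmetric in l
    and s; in the other the Hessian of h is c(f), so it contains two copies of c, between which
    associativity exchanges l and s. *)
Lemma om_closed h fm n s l w : potential h fm -> B w -> d_ l (om h n s) w = d_ s (om h n l) w.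
Proof.
move=> [sh sfm hE] Bw.
have E a b : d_ a (om h n b) w =
    \sum_j \sum_r eta j r * (d_ a (d3 Phi r n b) w * d_ j h w)
    + \sum_m fm m w * \sum_r \sum_j d3 Phi n b r w * eta r j * d3 Phi j a m w.
  have s1 j r : smooth_on B (fun w => d3 Phi r n b w * d_ j h w).
    by apply: smoothM => //; exact: smooth_pd.
  have s2 j r : smooth_on B (fun w => eta j r * (d3 Phi r n b w * d_ j h w)).
    by apply: smoothM => //; exact: smooth_cst.
  have s3 j : smooth_on B (fun w => \sum_r eta j r * (d3 Phi r n b w * d_ j h w)).
    exact: smooth_sum.
  rewrite (d_sum _ _ s3 Bw).
  transitivity (\sum_j \sum_r (eta j r * (d_ a (d3 Phi r n b) w * d_ j h w)
     + \sum_m fm m w * (d3 Phi n b r w * eta r j * d3 Phi j a m w))).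
    apply: eq_bigr => j _; rewrite (d_sum _ _ (s2 j) Bw); apply: eq_bigr => r _.
    rewrite (d_scale _ _ (s1 j r) Bw) (d_mul _ (sd3 r n b) (smooth_pd ord0 j sh : smooth_on B (d_ j h)) Bw).
    rewrite (hE w Bw) mulrDr [X in _ + X = _]mulrA big_distrr /=; congr (_ + _); apply: eq_bigr => m _.
    rewrite (d3_12 oB sPhi r n b Bw) (d3_23 oB sPhi n r b Bw) (d3_23 oB sPhi j m a Bw) (etaC j r).
    move: (d3 Phi n b r w) (d3 Phi j a m w) (fm m w) (eta r j) => X Y Z T; ring.
  under eq_bigr do rewrite big_split /=.
  rewrite big_split /=; congr (_ + _).
  under eq_bigr do rewrite exchange_big /=.
  rewrite exchange_big; apply: eq_bigr => m _; rewrite exchange_big big_distrr /=.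
  by apply: eq_bigr => r _; rewrite big_distrr.
refine (eq_trans (E l s) (eq_trans _ (esym (E s l)))).
apply: (f_equal2 (fun x y : R => x + y)).
  apply: eq_bigr => j _; apply: eq_bigr => r _.
  by rewrite (d4_swap oB sPhi l r n s Bw).
apply: eq_bigr => m _; apply: (f_equal (fun x : R => fm m w * x)).
exact (assoc Bw n s l m).
Qed.

(** The Poincare lemma is used at three levels: for the antiderivatives f, for each row of the
    matrix c(f'), and for the 1-form of the resulting functions. The f are fixed before c because
    (d/dx)^{-1} may add any constants to them, and each choice must lead to a Hessian again. *)
Lemma next_potential h fm : potential h fm -> exists f : 'I_N -> 'rV[R]_N -> R,
  [/\ (forall n, smooth_on B (f n)), (forall n s w, B w -> d_ s (f n) w = om h n s w) &
   forall c : 'I_N -> R, exists H, potential H (fun m w => \sum_n eta m n * (f n w + c n))].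
Proof.
move=> hp; have [sh _ _] := hp.
have ex n : exists f, smooth_on B f /\ forall w s, B w -> d_ s f w = om h n s w.
  apply: (Poincare oB cB Bp0) => [s|w s l Bw]; first exact: smooth_om.
  exact: (om_closed _ _ _ hp).
have [f Hf] := choice ex.
have sf n : smooth_on B (f n) by case: (Hf n).
have df n s w : B w -> d_ s (f n) w = om h n s w by case: (Hf n) => _; exact.
exists f; split => // c.
pose fm' m w := \sum_n eta m n * (f n w + c n).
have sfc n : smooth_on B (fun w => f n w + c n) by apply: smoothD => //; exact: smooth_cst.
have sfm' m : smooth_on B (fm' m) by exact: smooth_sum_mul.
have dfm' m l w : B w -> d_ l (fm' m) w = \sum_n eta m n * om h n l w.
  move=> Bw; have s1 n : smooth_on B (fun w => eta m n * (f n w + c n)).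
    by apply: smoothM => //; exact: smooth_cst.
  rewrite (d_sum _ _ s1 Bw); apply: eq_bigr => n _; rewrite (d_scale _ _ (sfc n) Bw); congr (_ * _).
  rewrite /d_ pdD; [|exact: smooth_differentiable (sf n) Bw|exact: differentiable_cst].
  by rewrite {2}/pd derive_cst addr0; exact: df.
pose X p k w := \sum_m d3 Phi p m k w * fm' m w.
have sX p k : smooth_on B (X p k) by apply: smooth_sum => // m; exact: smoothM.
have X_closed p w k l : B w -> d_ l (X p k) w = d_ k (X p l) w.
  move=> Bw.
  have E a b : d_ a (X p b) w = \sum_m d_ a (d3 Phi p m b) w * fm' m w
     + \sum_j \sum_r eta j r * d_ j h w * \sum_m \sum_n d3 Phi p b m w * eta m n * d3 Phi n a r w.
    have s1 m : smooth_on B (fun w => d3 Phi p m b w * fm' m w) by exact: smoothM.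
    rewrite (d_sum _ _ s1 Bw).
    transitivity (\sum_m (d_ a (d3 Phi p m b) w * fm' m w + \sum_n \sum_j \sum_r
       eta j r * d_ j h w * (d3 Phi p b m w * eta m n * d3 Phi n a r w))).
      apply: eq_bigr => m _; rewrite (d_mul _ (sd3 p m b) (sfm' m) Bw); congr (_ + _).
      rewrite (dfm' m a w Bw).
      rewrite [LHS]mulr_sumr; apply: eq_bigr => n _.
      rewrite /om [LHS]mulrA [LHS]mulr_sumr; apply: eq_bigr => j _.
      rewrite [LHS]mulr_sumr; apply: eq_bigr => r _.
      rewrite (d3_23 oB sPhi p m b Bw) (d3_12 oB sPhi r n a Bw) (d3_23 oB sPhi n r a Bw).
      move: (d3 Phi p b m w) (d3 Phi n a r w) (d_ j h w) (eta m n) (eta j r) => X1 X2 X3 X4 X5; ring.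
    rewrite [LHS]big_split /=; apply: (f_equal2 (fun x y : R => x + y)) => //.
    rewrite [LHS](eq_bigr _ (fun i _ => exchange_big _ _ _ _ _ _)) [LHS]exchange_big; apply: eq_bigr => j _ /=.
    rewrite [LHS](eq_bigr _ (fun i _ => exchange_big _ _ _ _ _ _)) [LHS]exchange_big; apply: eq_bigr => r _ /=.
    rewrite [RHS]mulr_sumr; apply: eq_bigr => m _; rewrite [RHS]mulr_sumr; exact: eq_bigr.
  refine (eq_trans (E l k) (eq_trans _ (esym (E k l)))).
  apply: (f_equal2 (fun x y : R => x + y)).
    by apply: eq_bigr => m _; rewrite (d4_swap oB sPhi l p m k Bw).
  apply: eq_bigr => j _; apply: eq_bigr => r _.
  apply: (f_equal (fun x : R => eta j r * d_ j h w * x)); exact (assoc Bw p k l r).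
have ex2 p : exists g, smooth_on B g /\ forall w k, B w -> d_ k g w = X p k w.
  have [g [sg dg]] := Poincare oB cB Bp0 (sX p) (X_closed p).
  by exists g; split=> [|w k Bw]; [exact sg | exact (dg w k Bw)].
have [g Hg] := choice ex2.
have sg p : smooth_on B (g p) by case: (Hg p).
have dg p w k : B w -> d_ k (g p) w = X p k w by case: (Hg p) => _; exact.
(* The matrix [X] is symmetric in p and k by the symmetry of the third derivatives, so the
   primitives [g] of its rows are themselves the components of a closed form. *)
have g_closed w p k : B w -> d_ k (g p) w = d_ p (g k) w.
  move=> Bw; refine (eq_trans (dg p w k Bw) (eq_trans _ (esym (dg k w p Bw)))).
  apply: eq_bigr => m _; apply: (f_equal (fun x : R => x * fm' m w)).
  by rewrite (d3_12 oB sPhi p m k Bw) (d3_23 oB sPhi m p k Bw) (d3_12 oB sPhi m k p Bw).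
have [H [sH dH]] := Poincare oB cB Bp0 sg g_closed.
exists H; split => [|m|w Bw p k]; [exact sH | exact (sfm' m) |].
refine (eq_trans (d_eq oB (f := d_ p H) (g := g p) k _ Bw) (dg p w k Bw)) => w' Bw'.
exact (dH w' p Bw').
Qed.

End Hierarchy.

Lemma derive1_row {R : realType} {N : nat} (c : R -> 'rV[R]_N) (d : 'I_N -> R) (x : R) :
  (forall j, is_derive x 1 (fun y => c y ord0 j) (d j)) ->
  derivable c x 1 /\ forall j, derive1 c x ord0 j = d j.
Proof.
move=> dc; have dcx : derivable c x 1.
  by apply/derivable_mxP => i j; rewrite (ord1 i : i = ord0); case: (dc j).
by split=> // j; rewrite derive1E (derive_mx dcx) mxE; have [_ ->] := dc j.
Qed.

Lemma sum_delta (K : pzSemiRingType) (n : nat) (F : 'I_n -> K) j : \sum_m F m * (m == j)%:R = F j.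
Proof.
rewrite (bigD1 j) //= eqxx mulr1 big1 ?addr0 // => m /negbTE ->; by rewrite mulr0.
Qed.

Section Invariant.
Context {R : realType} {N : nat}.
Variables (Phi : 'rV[R]_N -> R) (eta : 'M[R]_N).
Variables (B : set 'rV[R]_N) (p0 : 'rV[R]_N).
Hypotheses (oB : open B) (cB : cvx B) (Bp0 : B p0) (sPhi : smooth_on B Phi).
Hypotheses (eta_sym : eta^T = eta) (eta_nondeg : eta \in unitmx) (assoc : associativity B eta Phi).
Implicit Types (u : @field R N) (w : 'rV[R]_N) (H h : 'rV[R]_N -> R) (fm : 'I_N -> 'rV[R]_N -> R).
Implicit Type V : @flow R N.

Definition mflow fm : @flow R N := fun u x =>
  \row_i \sum_p eta i p * \sum_k (\sum_m d3 Phi p m k (u x) * fm m (u x)) * ux u k x.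

(** The part of L01 after (d/dx)^{-1} multiplies u_x by the vector field eta phi, so every value of
    L01 has the form [mflow] as soon as the antiderivatives are functions of u. *)
Lemma L01_out_mult u phi x : L01_out eta Phi u phi x =
  \row_i \sum_p eta i p * \sum_k (\sum_m d3 Phi p m k (u x) * (\sum_n eta m n * phi n x)) * ux u k x.
Proof.
apply/rowP => i; rewrite !mxE.
rewrite [LHS](eq_bigr _ (fun m _ => exchange_big _ _ _ _ _ _)) [LHS]exchange_big.
apply: eq_bigr => p _ /=; rewrite mulr_sumr.
rewrite [LHS](eq_bigr _ (fun m _ => eq_bigr _ (fun n _ => erefl _))).
rewrite [LHS](eq_bigr _ (fun m _ => exchange_big _ _ _ _ _ _)) [LHS]exchange_big.
apply: eq_bigr => k _ /=; rewrite mulr_suml mulr_sumr; apply: eq_bigr => m _.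
transitivity ((eta i p * d3 Phi p m k (u x) * ux u k x) * \sum_n eta m n * phi n x); last first.
  move: (d3 _ _ _ _ _) (ux _ _ _) (\sum_n _) => X Y Z; ring.
rewrite [RHS]mulr_sumr; apply: eq_bigr => n _.
move: (d3 _ _ _ _ _) (ux _ _ _) => X Y; ring.
Qed.

Lemma L01_arg_grad u (xi : R -> 'rV[R]_N) h (n : 'I_N) x : (forall j, xi x ord0 j = d_ j h (u x)) ->
  L01_arg eta Phi u xi n x = \sum_s om Phi eta h n s (u x) * ux u s x.
Proof.
move=> xiE; rewrite /L01_arg.
rewrite [LHS](eq_bigr _ (fun j _ => exchange_big _ _ _ _ _ _)) [LHS]exchange_big.
apply: eq_bigr => s _ /=; rewrite mulr_suml; apply: eq_bigr => j _.
rewrite mulr_suml; apply: eq_bigr => r _; rewrite xiE.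
move: (d3 _ _ _ _ _) (ux _ _ _) (d_ _ _ _) => X Y Z; ring.
Qed.

Lemma L10_grad H fm u x : potential Phi B H fm -> admissible B u x ->
  L10 eta u (fun y => grad H (u y)) x = mflow fm u x.
Proof.
move=> [sH _ HE] ad; apply/rowP => i; rewrite !mxE; apply: eq_bigr => j _.
have [|_ ->] := @derive1_row R N (fun y => grad H (u y)) (fun j => \sum_k d_ k (d_ j H) (u x) * ux u k x) x.
  move=> l; rewrite (_ : (fun y => _) = fun y => d_ l H (u y)); last by apply/funext => y; rewrite mxE.
  by apply: (is_derive_of_field _ ad); exact: smooth_pd.
by apply: (f_equal (fun x : R => _ * x)); apply: eq_bigr => k _; rewrite HE //; case: ad.
Qed.

Lemma differential_function_grad h j : smooth_on B h ->
  differential_function B (fun u x => grad h (u x) ord0 j).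
Proof.
move=> sh; under eq_fun do under eq_fun do rewrite mxE.
by apply: (differential_function_of_field oB); exact: smooth_pd.
Qed.

(** The induction invariant. [H] is a density for V with respect to L10 and produces the next flow
    through L01; the density for L01 comes from the previous level, so its existence is carried
    along separately. *)
Definition good V : Prop := exists H fm, [/\ potential Phi B H fm,
  (forall u x, admissible B u x -> V u x = mflow fm u x) &
  hamiltonian_flow B (L01_value B eta Phi) V].

Lemma good_L10 V H fm : potential Phi B H fm -> (forall u x, admissible B u x -> V u x = mflow fm u x) ->
  L10_value B eta (fun u x => grad H (u x)) V.
Proof.
move=> pH VE; split; first by move=> j; apply: differential_function_grad; case: pH.
by move=> u x ad; rewrite (L10_grad pH ad) VE.
Qed.

Lemma good_bi_hamiltonian V : good V -> bi_hamiltonian B eta Phi V.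
Proof.
move=> [H [fm [pH VE ham]]]; split=> //; exists H; split; first by case: pH.
exact: (good_L10 pH VE).
Qed.

Lemma good_recursion V : good V -> exists V', recursion B eta Phi V V'.
Proof.
move=> [H [fm [pH VE _]]]; have [f [sf df _]] := next_potential oB cB Bp0 sPhi eta_sym assoc pH.
exists (fun u x => L01_out eta Phi u (fun n y => f n (u y)) x).
exists (fun u x => grad H (u x)); split; first exact: (good_L10 pH VE).
split; first by move=> j; apply: differential_function_grad; case: pH.
exists (fun n u y => f n (u y)); split=> // n; split; first exact: (differential_function_of_field oB).
move=> u x ad; rewrite (@L01_arg_grad u _ H); last by move=> j; rewrite mxE.
have := is_derive_of_field (sf n) ad.
rewrite (eq_bigr (fun s => om Phi eta H n s (u x) * ux u s x)) // => s _.
by rewrite df //; case: ad.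
Qed.

(** The flow is multiplication of u_x by the n-th constant basis vector, and c of that vector is the
    Hessian of [d_ n Phi]. *)
Lemma good_structural n : good (structural_flow eta Phi n).
Proof.
have pH : potential Phi B (d_ n Phi) (fun m _ => (m == n)%:R).
  split; [exact: smooth_pd | by move=> m; exact: smooth_cst | move=> w Bw p k].
  refine (eq_trans _ (esym (sum_delta (fun m => d3 Phi p m k w) n))).
  by change (d3 Phi k p n w = d3 Phi p n k w); rewrite (d3_12 oB sPhi k p n Bw) (d3_23 oB sPhi p k n Bw).
have VE u x : structural_flow eta Phi n u x = mflow (fun m _ => (m == n)%:R) u x.
  apply/rowP => i; rewrite !mxE; apply: eq_bigr => p _; rewrite mulr_sumr; apply: eq_bigr => k _.
  by rewrite (sum_delta (fun m => d3 Phi p m k (u x)) n) mulrA.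
exists (d_ n Phi), (fun m _ => (m == n)%:R); split=> //.
have g0 (w : 'rV[R]_N) j : d_ j (fun=> 0 : R) w = 0 by rewrite /d_ /pd derive_cst.
(* With density 0, L01 has to produce the flow from antiderivatives of 0 alone, that is, from
   constants. *)
exists (fun=> 0); split; first exact: smooth_cst.
split; first by move=> j; apply: differential_function_grad; exact: smooth_cst.
(* Raised with eta, the n-th column of the inverse matrix becomes the n-th basis vector. *)
exists (fun n' _ _ => invmx eta n' n); split.
  move=> n'; split.
    by apply: (differential_function_of_field oB (f := fun=> invmx eta n' n)); exact: smooth_cst.
  move=> u x ad; rewrite (@L01_arg_grad u _ (fun=> 0)); last by move=> j; rewrite mxE.
  rewrite big1 => [|s _]; first exact: is_derive_cst.
  rewrite /om big1 ?mul0r // => j _; rewrite big1 // => r _.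
  by rewrite g0 !mulr0.
move=> u x ad; rewrite VE L01_out_mult; apply/rowP => i; rewrite !mxE.
apply: eq_bigr => p _; apply: (f_equal (fun x : R => _ * x)); apply: eq_bigr => k _.
apply: (f_equal (fun x : R => x * _)); apply: eq_bigr => m _; apply: (f_equal (fun x : R => _ * x)).
by have := congr1 (fun M : 'M[R]_N => M m n) (mulmxV eta_nondeg); rewrite !mxE => ->.
Qed.

(** An argument of L10 with given value is determined up to constants c_j, and adding c_j to the
    gradient amounts to a linear term in the density, which does not change its Hessian. *)
Lemma potential_affine H fm (c : 'I_N -> R) : potential Phi B H fm ->
  let h := fun w : 'rV[R]_N => H w + \sum_j c j * w ord0 j in
  potential Phi B h fm /\ forall w j, B w -> d_ j h w = d_ j H w + c j.
Proof.
move=> [sH sfm HE] h.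
have sl : smooth_on B (fun w : 'rV[R]_N => \sum_j c j * w ord0 j).
  by apply: (smooth_sum_mul oB) => j; exact: smooth_coord.
have dl w j : B w -> d_ j (fun w : 'rV[R]_N => \sum_j c j * w ord0 j) w = c j.
  move=> Bw.
  have s1 (a : 'I_N) : smooth_on B (fun w : 'rV[R]_N => w ord0 a) by exact: smooth_coord.
  have s2 a : smooth_on B (fun w : 'rV[R]_N => c a * w ord0 a).
    by apply: smoothM => //; exact: smooth_cst.
  rewrite (d_sum _ _ s2 Bw) (bigD1 j) //= big1 => [|a /negbTE aj].
    by rewrite (d_scale _ _ (s1 j) Bw) /d_ pd_coord !eqxx mulr1 addr0.
  by rewrite (d_scale _ _ (s1 a) Bw) /d_ pd_coord [j == a]eq_sym aj andbF mulr0.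
have dh w j : B w -> d_ j h w = d_ j H w + c j.
  move=> Bw; rewrite {1}/d_ /h pdD; first by have := dl w j Bw; rewrite /d_ => ->.
    exact: (smooth_differentiable sH Bw).
  exact: (smooth_differentiable sl Bw).
split; last exact dh.
split; [exact (smoothD oB sH sl) | exact sfm | move=> w Bw p k].
refine (eq_trans _ (HE w Bw p k)).
refine (eq_trans (d_eq oB (f := d_ p h) (g := fun w => d_ p H w + c p) k _ Bw) _) => [w' Bw'|].
  exact (dh w' p Bw').
rewrite {1}/d_ pdD; [|exact: (smooth_differentiable (smooth_pd ord0 p sH) Bw)|exact: differentiable_cst].
by rewrite {2}/pd derive_cst addr0.
Qed.

(** All values of the recursion are covered: its argument [xi] and its antiderivatives [phi] are
    arbitrary differential functions with prescribed x-derivatives, and each differs by constants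
    from the one built from [H]. *)
Lemma good_step V V' : good V -> recursion B eta Phi V V' -> good V'.
Proof.
move=> [H [fm [pH VE _]]] [xi [[dxi VL] [_ [phi [prim V'E]]]]].
have [sH _ HE] := pH.
have exB : exists p, B p by exists p0.
have dxiE u x j : admissible B u x ->
    'D_1 (fun y => xi u y ord0 j) x = \sum_k d_ k (d_ j H) (u x) * ux u k x.
  move=> ad.
  have dx i : is_derive x 1 (fun y => xi u y ord0 i) ('D_1 (fun y => xi u y ord0 i) x).
    by apply: DeriveDef => //; exact: (differential_function_derivable oB (dxi i) ad).
  have [_ dE] := derive1_row dx.
  (* Both [xi] and the gradient of H give V under L10; since eta is invertible, their x-derivatives
     agree. *)
  pose a : 'cV[R]_N := \col_i 'D_1 (fun y => xi u y ord0 i) x.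
  pose b : 'cV[R]_N := \col_i \sum_k (\sum_m d3 Phi i m k (u x) * fm m (u x)) * ux u k x.
  have ab : eta *m a = eta *m b.
    apply/colP => i; have := congr1 (fun v : 'rV[R]_N => v ord0 i) (etrans (esym (VL _ _ ad)) (VE _ _ ad)).
    rewrite !mxE => E; refine (etrans (etrans _ E) _); apply: eq_bigr => l _; rewrite mxE //.
    by rewrite dE.
  have := congr1 (fun v : 'cV[R]_N => v j ord0) (can_inj (mulKmx eta_nondeg) ab); rewrite !mxE => ->.
  by apply: eq_bigr => k _; rewrite HE //; case: ad.
have xiE j : exists c, forall u x, admissible B u x -> xi u x ord0 j = d_ j H (u x) + c.
  apply: (primitive_unique oB cB exB (dxi j) (smooth_pd ord0 j sH)) => u x ad; exact: dxiE.
have [c xic] := choice xiE.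
have [ph dh] := potential_affine c pH; set h := (fun w => _) in ph dh.
have [f [sf df next]] := next_potential oB cB Bp0 sPhi eta_sym assoc ph.
have argE u x n : admissible B u x ->
    L01_arg eta Phi u (xi u) n x = \sum_s om Phi eta h n s (u x) * ux u s x.
  by move=> ad; apply: L01_arg_grad => j; rewrite xic // dh //; case: ad.
have phiE n : exists c, forall u x, admissible B u x -> phi n u x = f n (u x) + c.
  have [dphi dphiE] := prim n.
  apply: (primitive_unique oB cB exB dphi (sf n)) => u x ad.
  have [_ ->] := dphiE u x ad; rewrite argE //; apply: eq_bigr => s _.
  by rewrite df //; case: ad.
have [c' phic] := choice phiE.
have [H' pH'] := next c'.
exists H', (fun m w => \sum_n eta m n * (f n w + c' n)); split => //.
  move=> u x ad; rewrite V'E // L01_out_mult; apply/rowP => i; rewrite !mxE.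
  apply: eq_bigr => p _; apply: (f_equal (fun x : R => _ * x)); apply: eq_bigr => k _.
  apply: (f_equal (fun x : R => x * _)); apply: eq_bigr => m _; apply: (f_equal (fun x : R => _ * x)).
  by apply: eq_bigr => n _; rewrite phic.
have sh : smooth_on B h by case: ph.
exists h; split => //; split=> [j|]; first exact: differential_function_grad.
exists phi; split => // n; have [dphi dphiE] := prim n; split=> // u x ad.
have := dphiE u x ad; rewrite argE // (@L01_arg_grad u _ h) // => j; by rewrite mxE.
Qed.

End Invariant.

(** * Commuting flows *)

Section Curves.
Context {R : realType} {N : nat}.
Implicit Types (O : set R) (g : R -> R) (u : @field R N).

(** Functions of one variable are regarded as functions of a 1 by 1 matrix, so that the closure
    properties of [smooth_on] apply to curves. *)
Definition lift_set O : set 'rV[R]_1 := [set z | O (z ord0 ord0)].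
Definition smooth_curve O g : Prop := smooth_on (lift_set O) (fun z => g (z ord0 ord0)).

Lemma open_lift_set O : open O -> open (lift_set O).
Proof.
move=> oO; rewrite openE => z Oz.
have c : {for z, continuous (fun z : 'rV[R]_1 => z ord0 ord0 : R)}.
  by apply: differentiable_continuous; exact: differentiable_coord.
exact (c O (open_nbhs_nbhs (conj oO Oz))).
Qed.

Lemma pd_lift g (z : 'rV[R]_1) i j : pd i j (fun z : 'rV[R]_1 => g (z ord0 ord0)) z = derive1 g (z ord0 ord0) /\
  (derivable (fun z : 'rV[R]_1 => g (z ord0 ord0)) z (delta_mx i j) <-> derivable g (z ord0 ord0) 1).
Proof.
rewrite derive1E /pd; apply: derive_transfer => h.
by rewrite !mxE (ord1 i : i = ord0) (ord1 j : j = ord0) !eqxx.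
Qed.

Lemma iter_pd_lift s g : iter_pd s (fun z : 'rV[R]_1 => g (z ord0 ord0)) =
  fun z => derive1n (size s) g (z ord0 ord0).
Proof.
elim: s => //= -[i j] s ->; apply/funext => z.
by have [-> _] := pd_lift (derive1n (size s) g) z i j.
Qed.

Lemma smooth_curveP O g : smooth_curve O g <-> forall k x, O x -> derivable (derive1n k g) x 1.
Proof.
split=> [sg k x Ox|dg s z Oz].
  pose z : 'rV[R]_1 := \row__ x; have zx : z ord0 ord0 = x by rewrite mxE.
  have := sg (nseq k (ord0, ord0)) z; rewrite iter_pd_lift size_nseq /lift_set /= zx => /(_ Ox) df.
  have [_ H] := pd_lift (derive1n k g) z ord0 ord0; move: H; rewrite zx => H; refine (H.1 _).
  exact: diff_derivable.
rewrite iter_pd_lift.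
apply: (@differentiable_comp _ _ _ _ (fun z : 'rV[R]_1 => z ord0 ord0 : R) (derive1n (size s) g)).
  exact: differentiable_coord.
by apply/derivable1_diffP; exact: dg.
Qed.

Lemma smooth_curve_eq O f g : open O -> (forall x, O x -> f x = g x) -> smooth_curve O f -> smooth_curve O g.
Proof. by move=> oO fg; apply: (smooth_eq (open_lift_set oO)) => z; exact: fg. Qed.

Lemma smooth_curve_derive1 O g : open O -> smooth_curve O g -> smooth_curve O (derive1 g).
Proof.
move=> oO sg; have := smooth_pd ord0 ord0 sg; apply: (smooth_eq (open_lift_set oO)) => z _.
by have [-> _] := pd_lift g z ord0 ord0.
Qed.

Lemma derive1n_row O u k : open O ->
  (forall j x, (j < k)%N -> O x -> derivable (derive1n j u) x 1) ->
  forall x i, O x -> derive1n k u x ord0 i = derive1n k (fun y => u y ord0 i) x.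
Proof.
move=> oO; elim: k => // k IH du x i Ox.
have IHk y l : O y -> derive1n k u y ord0 l = derive1n k (fun y => u y ord0 l) y.
  by move=> Oy; apply: IH => // j z jk; apply: du; exact: ltnW.
rewrite !derive1nS !derive1E (derive_mx (du k x (ltnSn k) Ox)) mxE.
apply: near_eq_derive; have : nbhs x O by exact: open_nbhs_nbhs.
by apply: filterS => y Oy; exact: IHk.
Qed.

Lemma smooth_curve_row O u : open O -> (forall i, smooth_curve O (fun x => u x ord0 i)) <->
  (forall k x, O x -> derivable (derive1n k u) x 1).
Proof.
move=> oO; split=> [su k|du i].
  have : forall j x, (j < k.+1)%N -> O x -> derivable (derive1n j u) x 1.
    elim: k.+1 => // {}k IH j x; rewrite ltnS leq_eqVlt => /orP[/eqP -> Ox|]; last exact: IH.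
    apply/derivable_mxP => i l; rewrite (ord1 i : i = ord0).
    have d : derivable (derive1n k (fun x => u x ord0 l)) x 1 by exact: ((smooth_curveP _ _).1 (su l)).
    apply: near_eq_derivable d; have : nbhs x O by exact: open_nbhs_nbhs.
    by apply: filterS => y Oy; rewrite (derive1n_row oO IH).
  by move=> H x; exact: H.
apply/smooth_curveP => k x Ox; have d := (derivable_mxP _ _ _).1 (du k x Ox) ord0 i.
apply: near_eq_derivable d; have : nbhs x O by exact: open_nbhs_nbhs.
by apply: filterS => y Oy; rewrite (derive1n_row oO) // => j z _; exact: du.
Qed.

Lemma smooth_curve_field O u (B : set 'rV[R]_N) f : open O -> (forall x, O x -> B (u x)) -> smooth_on B f ->
  (forall i, smooth_curve O (fun x => u x ord0 i)) -> smooth_curve O (fun x => f (u x)).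
Proof.
move=> oO uB sf su; apply: (smooth_comp (open_lift_set oO) _ sf) => [z|i j]; first exact: uB.
by rewrite (ord1 i : i = ord0); exact: su.
Qed.

Lemma smooth_curve_ux O u i : open O -> (forall k x, O x -> derivable (derive1n k u) x 1) -> smooth_curve O (ux u i).
Proof.
move=> oO du; have sui := (smooth_curve_row u oO).2 du i.
apply: (smooth_curve_eq oO _ (smooth_curve_derive1 oO sui)) => x Ox.
by have := @derive1n_row O u 1 oO (fun j y _ => du j y) x i Ox.
Qed.

End Curves.

Section Commuting.
Context {R : realType} {N : nat}.
Variable B : set 'rV[R]_N.
Hypothesis oB : open B.
Implicit Types (u : @field R N) (V : @flow R N) (Y : 'I_N -> 'I_N -> 'rV[R]_N -> R).

Definition hydro Y V : Prop := forall u x, admissible B u x ->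
  forall i, V u x ord0 i = \sum_k Y i k (u x) * ux u k x.

Lemma smooth_near u x : admissible B u x -> exists O : set R, [/\ open O, O x,
  (forall y, O y -> admissible B u y) & forall k y, O y -> derivable (derive1n k u) y 1].
Proof.
move=> ad; exists (interior [set y | admissible B u y]); split.
- exact: open_interior.
- exact: (near_admissible oB ad).
- by move=> y; exact: interior_subset.
- move=> k y Oy; exact (admissible_derivable (interior_subset Oy) (m := k)).
Qed.

Lemma hydro_smooth Y V u O : open O -> (forall i k, smooth_on B (Y i k)) -> hydro Y V ->
  (forall y, O y -> admissible B u y) -> (forall k y, O y -> derivable (derive1n k u) y 1) ->
  forall k y, O y -> derivable (derive1n k (V u)) y 1.
Proof.
move=> oO sY hV adO du; apply/(smooth_curve_row _ oO) => i.
have oL := open_lift_set oO.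
have su := (smooth_curve_row u oO).2 du.
have uB y : O y -> B (u y) by move=> /adO [].
apply: (smooth_curve_eq (f := fun y => \sum_k Y i k (u y) * ux u k y) oO) => [y Oy|].
  by rewrite (hV u y (adO y Oy) i).
apply: smooth_sum => // k; apply: smoothM => //.
  exact: (smooth_curve_field oO uB (sY i k) su).
exact: smooth_curve_ux.
Qed.

(** A Frechet derivative evaluates the flow at perturbed fields, while its formula is known only at
    admissible ones; for small e the perturbed fields are admissible. *)
Lemma near_perturbation u v O x : open O -> O x -> B (u x) ->
  (forall k y, O y -> derivable (derive1n k u) y 1) ->
  (forall k y, O y -> derivable (derive1n k v) y 1) ->
  \forall e \near (0 : R), admissible B (fun y => u y + e *: v y) x.
Proof.
move=> oO Ox Bux du dv.
have ad e k y : O y -> derivable (derive1n k (fun y => u y + e *: v y)) y 1.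
  move: k y; apply/(smooth_curve_row _ oO) => i; have oL := open_lift_set oO.
  apply: (smooth_curve_eq (f := fun y => u y ord0 i + e * v y ord0 i) oO) => [y _|]; first by rewrite !mxE.
  apply: smoothD => //; first exact: ((smooth_curve_row u oO).2 du i).
  apply: smoothM => //; first exact: smooth_cst.
  exact: ((smooth_curve_row v oO).2 dv i).
have c : {for 0, continuous (fun e : R => u x + e *: v x)}.
  by apply: cvgD; [exact: cvg_cst | apply: cvgZr_tmp; exact: cvg_id].
have Bc : nbhs (u x + 0 *: v x) B by rewrite scale0r addr0; exact: open_nbhs_nbhs.
have nB : \forall e \near (0 : R), B (u x + e *: v x) := c B Bc.
apply: filterS nB => e Be; split => //.
have : nbhs x O by exact: open_nbhs_nbhs.
by apply: filterS => y Oy k; exact: ad.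
Qed.

Lemma frechet Y V W u x O : (forall i k, smooth_on B (Y i k)) -> hydro Y V -> open O -> O x -> B (u x) ->
  (forall k y, O y -> derivable (derive1n k u) y 1) ->
  (forall k y, O y -> derivable (derive1n k (W u)) y 1) ->
  is_derive (0 : R) 1 (fun e : R => V (fun y => u y + e *: W u y) x)
    (\row_i \sum_k ((\sum_l d_ l (Y i k) (u x) * W u x ord0 l) * ux u k x + Y i k (u x) * ux (W u) k x)).
Proof.
move=> sY hV oO Ox Bux du dW.
set v := W u.
have nad := near_perturbation oO Ox Bux du dW.
have uxE e k : ux (fun y => u y + e *: v y) k x = ux u k x + e * ux v k x.
  have d1 := du 0%N x Ox; have d2 := dW 0%N x Ox.
  have E1 : 'D_1 (fun y => u y + e *: v y) x = 'D_1 u x + 'D_1 (fun y => e *: v y) x.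
    exact (deriveD d1 (derivableZ (k := e) d2)).
  have E2 : 'D_1 (fun y => e *: v y) x = e *: 'D_1 v x by exact (deriveZ e d2).
  by rewrite /ux !derive1E E1 E2 !mxE.
have dY i k : is_derive (0 : R) 1 (fun e : R => Y i k (u x + e *: v x))
    (\sum_l d_ l (Y i k) (u x) * v x ord0 l).
  have dc : is_derive (0 : R) 1 (fun e : R => u x + e *: v x) (v x).
    have := @is_derive_line R _ 'rV[R]_N id (u x) (v x) 0 ltac:(exact: derivable_id).
    rewrite derive_id; by under eq_fun do rewrite addrC.
  have dYi : differentiable (Y i k) (u x + 0 *: v x).
    by rewrite scale0r addr0; exact: (smooth_differentiable (sY i k)).
  have := is_derive_comp_curve dYi dc; rewrite (diff_pd _ dYi) big_ord1 scale0r addr0.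
  by under eq_bigr do rewrite mulrC.
have dF i : is_derive (0 : R) 1 (fun e : R => \sum_k Y i k (u x + e *: v x) * (ux u k x + e * ux v k x))
   (\sum_k ((\sum_l d_ l (Y i k) (u x) * v x ord0 l) * ux u k x + Y i k (u x) * ux v k x)).
  rewrite (_ : (fun e : R => _) = \sum_k (fun e : R => Y i k (u x + e *: v x) * (ux u k x + e * ux v k x))).
    2: by apply/funext => e; rewrite fct_sumE.
  apply: is_derive_sum => k.
  have d2 : is_derive (0 : R) 1 (fun e : R => ux u k x + e * ux v k x) (ux v k x).
    have := @is_derive_line R _ R id (ux u k x) (ux v k x) 0 ltac:(exact: derivable_id).
    rewrite derive_id; by under eq_fun do rewrite addrC.
  rewrite (_ : _ + _ = Y i k (u x + 0 *: v x) *: ux v k x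
      + (ux u k x + 0 * ux v k x) *: \sum_l d_ l (Y i k) (u x) * v x ord0 l).
    exact (is_deriveM (dY i k) d2).
  by rewrite scale0r mul0r !addr0 [LHS]addrC [_ * ux u k x]mulrC.
pose F (e : R) := \row_i \sum_k Y i k (u x + e *: v x) * (ux u k x + e * ux v k x).
have [dFv dFE] : derivable F 0 1 /\ forall j, derive1 F 0 ord0 j =
   \sum_k ((\sum_l d_ l (Y j k) (u x) * v x ord0 l) * ux u k x + Y j k (u x) * ux v k x).
  apply: derive1_row => j; rewrite (_ : (fun y => _) = fun e => \sum_k Y j k (u x + e *: v x) * (ux u k x + e * ux v k x)) //.
  by apply/funext => e; rewrite mxE.
apply: (@near_eq_is_derive _ _ _ F).
  apply: filterS nad => e ade; apply/rowP => i; rewrite mxE (hV _ _ ade).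
  by apply: eq_bigr => k _; rewrite uxE.
by apply: DeriveDef => //; apply/rowP => j; rewrite -derive1E dFE mxE.
Qed.

Lemma ux_hydro Y V u x k : (forall i k, smooth_on B (Y i k)) -> hydro Y V -> admissible B u x ->
  derivable (V u) x 1 ->
  ux (V u) k x = \sum_j ((\sum_l d_ l (Y k j) (u x) * ux u l x) * ux u j x + Y k j (u x) * derive1 (ux u j) x).
Proof.
move=> sY hV ad dV; have [S [oS Sx adS du]] := smooth_near ad.
have sux j : is_derive x 1 (ux u j) (derive1 (ux u j) x).
  rewrite derive1E; apply: DeriveDef => //.
  exact: ((smooth_curveP _ _).1 (smooth_curve_ux j oS du) 0%N x Sx).
rewrite /ux derive1E (derive_mx dV) mxE.
have E : \forall y \near x, \sum_j Y k j (u y) * ux u j y = V u y ord0 k.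
  by have := near_admissible oB ad; apply: filterS => y ady; rewrite (hV _ _ ady).
have D : is_derive x 1 (fun y => \sum_j Y k j (u y) * ux u j y)
    (\sum_j ((\sum_l d_ l (Y k j) (u x) * ux u l x) * ux u j x + Y k j (u x) * derive1 (ux u j) x)).
  rewrite (_ : (fun y : R => _) = \sum_j (fun y : R => Y k j (u y) * ux u j y)).
    2: by apply/funext => e; rewrite fct_sumE.
  apply: is_derive_sum => j.
  have := is_deriveM (is_derive_of_field (sY k j) ad) (sux j); rewrite /GRing.scale /=.
  by rewrite addrC [ux u j x * _]mulrC.
by have [_ ->] := near_eq_is_derive E D.
Qed.

(** Because the rows of Y1 are closed, the derivative of V1 along V2 is the x-derivative of Y1 Y2
    u_x, and likewise with 1 and 2 exchanged; the two agree because the matrices commute. *)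
Lemma commuting_hydro Y1 Y2 V1 V2 :
  (forall i k, smooth_on B (Y1 i k)) -> (forall i k, smooth_on B (Y2 i k)) ->
  (forall i k l w, B w -> d_ l (Y1 i k) w = d_ k (Y1 i l) w) ->
  (forall i k l w, B w -> d_ l (Y2 i k) w = d_ k (Y2 i l) w) ->
  (forall i j w, B w -> \sum_k Y1 i k w * Y2 k j w = \sum_k Y2 i k w * Y1 k j w) ->
  hydro Y1 V1 -> hydro Y2 V2 -> commuting B V1 V2.
Proof.
move=> sY1 sY2 c1 c2 Y12 h1 h2 u x ad.
have [S [oS Sx adS du]] := smooth_near ad.
have Bux : B (u x) by case: ad.
have dV1 := hydro_smooth oS sY1 h1 adS du; have dV2 := hydro_smooth oS sY2 h2 adS du.
(* The right-hand side is the expansion of d/dx (Ya Yb u_x), so it depends on the two flows only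
   through the product of their matrices. Closedness of [Ya] is needed to exchange the indices k and
   l. *)
have key Ya Yb Va Vb : (forall i k, smooth_on B (Ya i k)) -> (forall i k, smooth_on B (Yb i k)) ->
    (forall i k l w, B w -> d_ l (Ya i k) w = d_ k (Ya i l) w) -> hydro Ya Va -> hydro Yb Vb ->
    derivable (Vb u) x 1 -> forall i,
  \sum_k ((\sum_l d_ l (Ya i k) (u x) * Vb u x ord0 l) * ux u k x + Ya i k (u x) * ux (Vb u) k x) =
  \sum_j \sum_l d_ l (fun w => \sum_k Ya i k w * Yb k j w) (u x) * (ux u l x * ux u j x)
  + \sum_j (\sum_k Ya i k (u x) * Yb k j (u x)) * derive1 (ux u j) x.
  move=> sa sb ca ha hb dVb i.
  have E1 : \sum_k (\sum_l d_ l (Ya i k) (u x) * Vb u x ord0 l) * ux u k x =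
      \sum_j \sum_l \sum_k d_ l (Ya i k) (u x) * Yb k j (u x) * (ux u l x * ux u j x).
    transitivity (\sum_k \sum_l \sum_j d_ k (Ya i l) (u x) * Yb l j (u x) * (ux u k x * ux u j x)).
      apply: eq_bigr => k _; rewrite mulr_suml; apply: eq_bigr => l _.
      rewrite (ca i k l _ Bux) (hb _ _ ad) mulr_sumr mulr_suml; apply: eq_bigr => j _.
      move: (d_ _ _ _) (Yb _ _ _) (ux u j x) (ux u k x) => X1 X2 X3 X4; ring.
    rewrite [LHS](eq_bigr _ (fun i _ => exchange_big _ _ _ _ _ _)) [LHS]exchange_big.
    by [].
  have E2 : \sum_k Ya i k (u x) * ux (Vb u) k x =
      \sum_j \sum_l \sum_k Ya i k (u x) * d_ l (Yb k j) (u x) * (ux u l x * ux u j x)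
      + \sum_j (\sum_k Ya i k (u x) * Yb k j (u x)) * derive1 (ux u j) x.
    transitivity (\sum_k \sum_j (\sum_l Ya i k (u x) * d_ l (Yb k j) (u x) * (ux u l x * ux u j x)
        + Ya i k (u x) * Yb k j (u x) * derive1 (ux u j) x)).
      apply: eq_bigr => k _; rewrite (ux_hydro k sb hb ad dVb) mulr_sumr; apply: eq_bigr => j _.
      rewrite mulrDr mulrA; apply: (f_equal2 (fun x y : R => x + y)); last by rewrite mulrA.
      rewrite -mulrA mulr_suml mulr_sumr; apply: eq_bigr => l _.
      move: (d_ _ _ _) (Ya _ _ _) (ux u j x) (ux u l x) => X1 X2 X3 X4; ring.
    rewrite [LHS]exchange_big -big_split; apply: eq_bigr => j _ /=.
    rewrite [LHS]big_split /= mulr_suml; apply: (f_equal2 (fun x y : R => x + y)); last by [].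
    exact: exchange_big.
  rewrite [LHS]big_split /= E1 E2 addrA; apply: (f_equal2 (fun x y : R => x + y)); last by [].
  rewrite -big_split; apply: eq_bigr => j _ /=; rewrite -big_split; apply: eq_bigr => l _ /=.
  have s1 k : smooth_on B (fun w => Ya i k w * Yb k j w) by exact: smoothM.
  rewrite (d_sum _ _ s1 Bux) mulr_suml -big_split; apply: eq_bigr => k _ /=.
  rewrite (d_mul _ (sa i k) (sb k j) Bux).
  by rewrite mulrDl.
pose L := \row_i (\sum_j \sum_l d_ l (fun w => \sum_k Y1 i k w * Y2 k j w) (u x) * (ux u l x * ux u j x)
  + \sum_j (\sum_k Y1 i k (u x) * Y2 k j (u x)) * derive1 (ux u j) x).
exists L; split.
  have D := frechet sY1 h1 oS Sx Bux du dV2.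
  rewrite (_ : L = \row_i \sum_k ((\sum_l d_ l (Y1 i k) (u x) * V2 u x ord0 l) * ux u k x + Y1 i k (u x) * ux (V2 u) k x)); first exact D.
  apply/rowP => i; rewrite !mxE.
  exact (esym (key Y1 Y2 V1 V2 sY1 sY2 c1 h1 h2 (dV2 0%N x Sx) i)).
have D := frechet sY2 h2 oS Sx Bux du dV1.
rewrite (_ : L = \row_i \sum_k ((\sum_l d_ l (Y2 i k) (u x) * V1 u x ord0 l) * ux u k x + Y2 i k (u x) * ux (V1 u) k x)); first exact D.
apply/rowP => i; rewrite !mxE.
refine (eq_trans _ (esym (key Y2 Y1 V2 V1 sY2 sY1 c2 h2 h1 (dV1 0%N x Sx) i))).
apply: (f_equal2 (fun x y : R => x + y)).
  apply: eq_bigr => j _; apply: eq_bigr => l _; apply: (f_equal (fun y : R => y * _)).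
  exact: (d_eq oB (f := fun w => \sum_k Y1 i k w * Y2 k j w) (g := fun w => \sum_k Y2 i k w * Y1 k j w) l (Y12 i j) Bux).
by apply: eq_bigr => j _; rewrite Y12.
Qed.

End Commuting.

Section Multiplication.
Context {R : realType} {N : nat}.
Variables (Phi : 'rV[R]_N -> R) (eta : 'M[R]_N) (B : set 'rV[R]_N).
Hypotheses (oB : open B) (sPhi : smooth_on B Phi) (assoc : associativity B eta Phi).
Implicit Types (u : @field R N) (w : 'rV[R]_N) (H : 'rV[R]_N -> R) (fm gm : 'I_N -> 'rV[R]_N -> R).
Implicit Type V : @flow R N.

Definition mult fm (i k : 'I_N) : 'rV[R]_N -> R := fun w =>
  \sum_p eta i p * \sum_m d3 Phi p m k w * fm m w.

Lemma smooth_mult fm i k : (forall m, smooth_on B (fm m)) -> smooth_on B (mult fm i k).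
Proof.
move=> sfm; apply: (smooth_sum_mul oB) => p; apply: smooth_sum => // m.
by apply: smoothM => //; exact: (smooth_d3 sPhi).
Qed.

Lemma mflow_hydro V fm : (forall u x, admissible B u x -> V u x = mflow Phi eta fm u x) ->
  hydro B (mult fm) V.
Proof.
move=> VE u x ad i; rewrite VE // mxE.
under [LHS]eq_bigr do rewrite mulr_sumr.
rewrite exchange_big; apply: eq_bigr => j _ /=; rewrite mulr_suml; apply: eq_bigr => p _.
by rewrite mulrA.
Qed.

Lemma good_hydrodynamic V : good Phi eta B V -> hydrodynamic B V.
Proof.
move=> [H [fm [[_ sfm _] VE _]]].
exists (fun w => \matrix_(i, j) mult fm i j w); split.
  by move=> i j; under eq_fun do rewrite mxE; exact: smooth_mult.
by move=> u x ad i; rewrite (mflow_hydro VE) //; apply: eq_bigr => j _; rewrite mxE.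
Qed.

(** [mult fm] is eta times the Hessian of H, so each of its rows is a gradient. *)
Lemma mult_closed H fm i k l w : potential Phi B H fm -> B w ->
  d_ l (mult fm i k) w = d_ k (mult fm i l) w.
Proof.
move=> [sH sfm HE] Bw.
have E a b : d_ a (mult fm i b) w = \sum_p eta i p * d_ a (d_ b (d_ p H)) w.
  have sdd p : smooth_on B (d_ b (d_ p H)) by apply: smooth_pd; exact: smooth_pd.
  have s1 p : smooth_on B (fun w => eta i p * d_ b (d_ p H) w).
    by apply: smoothM => //; exact: smooth_cst.
  have E1 w' : B w' -> mult fm i b w' = \sum_p eta i p * d_ b (d_ p H) w'.
    move=> Bw'; apply: eq_bigr => p _; apply: (f_equal (fun x : R => eta i p * x)).
    exact (esym (HE w' Bw' p b)).
  refine (eq_trans (d_eq oB (f := mult fm i b) a E1 Bw) _).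
  refine (eq_trans (d_sum (index_enum 'I_N) a s1 Bw) _).
  by apply: eq_bigr => p _; exact (d_scale (eta i p) a (sdd p) Bw).
refine (eq_trans (E l k) (eq_trans _ (esym (E k l)))); apply: eq_bigr => p _.
apply: (f_equal (fun x : R => eta i p * x)).
exact (d_comm oB l k (smooth_pd ord0 p sH) Bw).
Qed.

(** After expansion, associativity exchanges the slots of f and g between the two copies of c. *)
Lemma mult_comm fm gm i j w : B w ->
  \sum_k mult fm i k w * mult gm k j w = \sum_k mult gm i k w * mult fm k j w.
Proof.
move=> Bw.
have E f g : \sum_k mult f i k w * mult g k j w = \sum_p eta i p * \sum_m \sum_n
    (f m w * g n w) * \sum_k \sum_q d3 Phi p m k w * eta k q * d3 Phi q n j w.
  transitivity (\sum_k \sum_p \sum_m \sum_q \sum_n eta i p * ((f m w * g n w) *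
       (d3 Phi p m k w * eta k q * d3 Phi q n j w))).
    apply: eq_bigr => k _; rewrite /mult [LHS]mulr_suml; apply: eq_bigr => p _.
    rewrite -[LHS]mulrA [X in _ * X = _]mulr_suml [LHS]mulr_sumr; apply: eq_bigr => m _.
    rewrite [X in _ * X = _]mulr_sumr [LHS]mulr_sumr; apply: eq_bigr => q _.
    rewrite [X in _ * (_ * X) = _]mulr_sumr [X in _ * X = _]mulr_sumr [LHS]mulr_sumr; apply: eq_bigr => n _.
    move: (d3 Phi p m k w) (d3 Phi q n j w) (f m w) (g n w) => X1 X2 X3 X4; ring.
  rewrite [LHS]exchange_big; apply: eq_bigr => p _ /=.
  rewrite [RHS]mulr_sumr [LHS]exchange_big; apply: eq_bigr => m _ /=.
  rewrite [RHS]mulr_sumr [LHS](eq_bigr _ (fun i _ => exchange_big _ _ _ _ _ _)) [LHS]exchange_big.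
  apply: eq_bigr => n _ /=; rewrite [X in _ = _ * X]mulr_sumr [RHS]mulr_sumr; apply: eq_bigr => k _ /=.
  by rewrite [X in _ = _ * X]mulr_sumr [RHS]mulr_sumr.
rewrite (E fm gm) (E gm fm); apply: eq_bigr => p _; apply: (f_equal (fun x : R => eta i p * x)).
rewrite [LHS]exchange_big; apply: eq_bigr => m _ /=; apply: eq_bigr => n _.
apply: (f_equal2 (fun x y : R => x * y)); first exact: mulrC.
exact (assoc Bw p n m j).
Qed.

Lemma good_commuting V1 V2 : good Phi eta B V1 -> good Phi eta B V2 -> commuting B V1 V2.
Proof.
move=> [H1 [f1 [p1 VE1 _]]] [H2 [f2 [p2 VE2 _]]].
have s1 m : smooth_on B (f1 m) by case: p1.
have s2 m : smooth_on B (f2 m) by case: p2.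
apply: (commuting_hydro oB (Y1 := mult f1) (Y2 := mult f2)).
- by move=> i k; exact: smooth_mult.
- by move=> i k; exact: smooth_mult.
- by move=> i k l w Bw; exact: (mult_closed _ _ _ p1).
- by move=> i k l w Bw; exact: (mult_closed _ _ _ p2).
- by move=> i j w Bw; exact: mult_comm.
- exact: mflow_hydro.
- exact: mflow_hydro.
Qed.

End Multiplication.

Theorem theorem17p2 (R : realType) (N : nat) (eta : 'M[R]_N)
    (U : set 'rV[R]_N) (Phi : 'rV[R]_N -> R)
    (eta_sym : eta^T = eta) (eta_nondeg : eta \in unitmx)
    (U_open : open U) (Phi_smooth : smooth_on U Phi)
    (Phi_assoc : associativity U eta Phi) :
  (forall u0 : 'rV[R]_N, U u0 -> compatible U u0 (L01 eta Phi) (L10 eta)) /\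
  (forall p : 'rV[R]_N, U p ->
     exists B : set 'rV[R]_N,
       [/\ open B, B p, B `<=` U &
         forall n : 'I_N,
           let V0 := structural_flow eta Phi n in
           [/\ (forall q V, hierarchy B eta Phi V0 q V ->
                  exists V', recursion B eta Phi V V'),
               (forall q V, hierarchy B eta Phi V0 q V -> hydrodynamic B V),
               (forall q V, hierarchy B eta Phi V0 q V ->
                  bi_hamiltonian B eta Phi V) &
               (forall q1 q2 V1 V2, hierarchy B eta Phi V0 q1 V1 ->
                  hierarchy B eta Phi V0 q2 V2 -> commuting B V1 V2)]]).
Proof.
split=> [u0 Uu0|p Up]; first exact: compatible_L01_L10.
(* A ball is convex, as the Poincare lemma and the uniqueness of primitives up to constants require.
   It is chosen before n and serves all structural flows. *)
have [r /= r0 pU] : exists2 r : R, 0 < r & ball p r `<=` U.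
  by have /nbhs_ballP := open_nbhs_nbhs (conj U_open Up).
have oB : open (ball p r) by exact: ball_open.
have Bp : ball p r p by exact: ballxx.
have cB := @cvx_ball R N p r.
have sPhi := smooth_subset pU Phi_smooth.
have aPhi : associativity (ball p r) eta Phi by move=> w /pU; exact: Phi_assoc.
exists (ball p r); split=> // n; set V0 := structural_flow eta Phi n.
(* Whatever constants of integration were chosen on the way, the invariant holds at every level, and
   the four claims are read off from it. *)
have hgood q V : hierarchy (ball p r) eta Phi V0 q V -> good Phi eta (ball p r) V.
  elim: q V => [|q IH] V /=; first by move=> ->; exact: good_structural.
  by move=> [V' [/IH gV' rec]]; exact: (good_step oB cB Bp sPhi eta_sym eta_nondeg aPhi gV' rec).
split=> [q V /hgood gV|q V /hgood gV|q V /hgood gV|q1 q2 V1 V2 /hgood g1 /hgood g2].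
- exact: (good_recursion oB cB Bp sPhi eta_sym aPhi gV).
- exact: (good_hydrodynamic oB sPhi gV).
- exact: (good_bi_hamiltonian oB gV).
- exact: (good_commuting oB sPhi aPhi g1 g2).
Qed.
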